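(* Let $n>2$ be an integer, let $\alpha\neq 0,1$ be a real number, and put $r=\frac1\alpha$. Let $A_n$, $G_n$, $P_\alpha$ denote the arithmetic mean, geometric mean and power mean of order $\alpha$ of non-negative real numbers $x_1,\dots,x_n$, and let $f$ be the one-variable function (depending on $n$ and $r$) defined in the context. Then for all non-negative real numbers $x_1,\dots,x_n$ for which $P_\alpha\neq G_n$ (so that the ratio below is defined), the following hold. 1. If $\alpha<0$, then $$-\infty<\frac{A_n-G_n}{P_\alpha-G_n}\le\omega_1=\frac{\nu_1}{\nu_1-1},$$ where $\nu_1$ is the minimum of $f(x)$ in the interval $\left(\frac1n,\frac1{n-1}\right)$. 2. If $\alpha>1$, then $$\omega_2=\frac{\nu_2}{\nu_2-1}\le\frac{A_n-G_n}{P_\alpha-G_n}\le\left(\frac{n}{n-1}\right)^{\frac1\alpha-1},$$ where $\nu_2$ is the maximum of $f(x)$ in the interval $\left(0,\frac1n\right)$. 3. If $\frac12<\alpha<1$ and $n<\frac1{1-\alpha}$, then $$\left(\frac{n}{n-1}\right)^{\frac1\alpha-1}\le\frac{A_n-G_n}{P_\alpha-G_n}\le\omega_3=\frac{\nu_3}{\nu_3-1},$$ where $\nu_3$ is the minimum of $f(x)$ in the interval $\left(0,\frac1n\right)$. 4. If $\frac12\le\alpha<1$ and $n\ge\frac1{1-\alpha}$, or if $0<\alpha\le\frac12$ and $n\ge\frac1\alpha$, then $$\left(\frac{n}{n-1}\right)^{\frac1\alpha-1}\le\frac{A_n-G_n}{P_\alpha-G_n}\le n^{\frac1\alpha-1}.$$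 5. If $0<\alpha<\frac12$ and $n<\frac1\alpha$, then $$\omega_4=\frac{\nu_4}{\nu_4-1}\le\frac{A_n-G_n}{P_\alpha-G_n}\le n^{\frac1\alpha-1},$$ where $\nu_4$ is the maximum of $f(x)$ in the interval $\left(\frac1n,\frac1{n-1}\right)$. (The existence of the minima and maxima $\nu_1,\nu_2,\nu_3,\nu_4$ in the indicated cases is part of the assertion.)
   Context: For non-negative reals $x_1,\dots,x_n$: $A_n=\frac1n\sum_{i=1}^n x_i$, $G_n=\left(\prod_{i=1}^n x_i\right)^{1/n}$, and for $\alpha\ne0$, $P_\alpha=\left(\frac1n\sum_{i=1}^n x_i^\alpha\right)^{1/\alpha}$, with the convention $P_\alpha=0$ if $\alpha<0$ and some $x_i=0$. With $r=\frac1\alpha$ ($\alpha\ne 0,1$), define for $0\le x\le\frac1{n-1}$, $x\neq\frac1n$, $$f(x)=\frac{g(x)-\frac1n}{p(x)-\frac1n},\qquad g(x)=\sqrt[n]{x^{n-1}(1-(n-1)x)},\qquad p(x)=\left(\frac{(n-1)x^{\frac1r}+(1-(n-1)x)^{\frac1r}}{n}\right)^r,$$ where for $r<0$ one sets $p(0)=p\left(\frac1{n-1}\right)=0$. (Thus $g(x)$ and $p(x)$ are the geometric mean and the power mean $P_\alpha$ of the $n$-tuple $(x,\dots,x,1-(n-1)x)$, whose arithmetic mean is $\frac1n$.) *)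

(* Defs.v *)
From mathcomp Require Import all_boot all_order all_algebra.
From mathcomp Require Import all_classical reals ereal exp.

Set Implicit Arguments.
Unset Strict Implicit.
Unset Printing Implicit Defensive.

Import Order.TTheory GRing.Theory Num.Theory.

Local Open Scope classical_set_scope.
Local Open Scope ring_scope.

(* In all the formulas below, [powR] is only used with a nonnegative base. Note
   that [0 `^ a = 0] for every [a != 0], negative [a] included; this is why
   negative orders with a vanishing entry are treated separately. *)

Definition amean (R : realType) (n : nat) (x : 'I_n -> R) : R :=
  (\sum_(i < n) x i) / n%:R.

Definition gmean (R : realType) (n : nat) (x : 'I_n -> R) : R :=
  (\prod_(i < n) x i) `^ n%:R^-1.

Definition pmean (R : realType) (a : R) (n : nat) (x : 'I_n -> R) : R :=
  if (a < 0) && [exists i, x i == 0] then 0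
  else ((\sum_(i < n) x i `^ a) / n%:R) `^ a^-1.

Definition mean_ratio (R : realType) (a : R) (n : nat) (x : 'I_n -> R) : R :=
  (amean x - gmean x) / (pmean a x - gmean x).

Definition g_fun (R : realType) (n : nat) (x : R) : R :=
  (x ^+ n.-1 * (1 - (n%:R - 1) * x)) `^ n%:R^-1.

Definition p_fun (R : realType) (n : nat) (r x : R) : R :=
  if (r < 0) && ((x == 0) || (x == (n%:R - 1)^-1)) then 0
  else (((n%:R - 1) * x `^ r^-1 + (1 - (n%:R - 1) * x) `^ r^-1) / n%:R) `^ r.

(* Meaningful for [0 <= x <= 1 / (n - 1)] and [x != 1 / n]. *)
Definition f_fun (R : realType) (n : nat) (r x : R) : R :=
  (g_fun n x - n%:R^-1) / (p_fun n r x - n%:R^-1).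

Definition is_min_on (R : realType) (f : R -> R) (I : set R) (m : R) : Prop :=
  (f @` I) m /\ lbound (f @` I) m.

Definition is_max_on (R : realType) (f : R -> R) (I : set R) (m : R) : Prop :=
  (f @` I) m /\ ubound (f @` I) m.

(* Main.v *)
(* Normalise the sum of the entries to [1], so that [A = s = 1 / n], and compare the
   gaps [s - G] and [(s - P) / (1 - a)]; a bound on [(A - G) / (P - G)] is a bound
   [s - G >= rho (s - P) / (1 - a)], or the opposite one, for a constant [rho > 0].

   Reduction to one variable: an interior extremum of [G - nu P] on the simplex is
   critical for every transfer between two entries, so all entries take the same
   value under a function [q] which is strictly monotone on either side of a point;
   the second-order condition allows at most one entry on one of the two sides.  Hence
   the extremal points are [(x, ..., x, y)], and the sign of the extremum tells on
   which side of [1 / n] the number [x] lies.  On the boundary [G = 0] and [P] is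
   bounded by convexity.

   One variable: with [t = x / y] and [b = 1 - a], the ratio of the derivatives of the
   two gaps is
   [H(t) = b t^(b - s) (t - 1) / (t^b - 1) * ((1 - s) t^a + s)^(- b / a)], whose
   logarithmic derivative [L_s(t) / t] satisfies [L_s(1 / t) = - L_(1 - s)(t)].  For
   [t > 1] and [0 < a < 1] the sign of [L_s(t)] is that of a convex quadratic in [s],
   nonpositive at [s = 1] and with explicit factorizations at [s = a] and [s = 1 / 2].
   Where [H] is monotone on a whole side of [1], so is [f] and the bound is its end
   value; otherwise the sign of [L_s] near [1] and the behaviour of [H] at the other
   end show that the extremum of [f] is attained inside the interval. *)

(* Write [b = 1 - a], and let [u], [V] be the two gaps. Since [P - G = u - b V], the mean ratio is
   [u / (u - b V)], and a bound comparing [u] with [rho V] becomes a bound by [rho / (rho - b)]. On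
   the one-parameter family [f = u / (b V)], so with [nu = rho / b] this number is [nu / (nu - 1)]:
   hence the form of the constants [omega]. Dividing by [b] keeps [V] positive off the center for
   [a < 1] and [a > 1] alike; the sign of [b] returns only in the passage from gaps to the ratio and
   to [f]. No limit of [f] is computed. An extremum is attained because the quotient of the gaps
   moves the right way next to [1 / n], and because [H] crosses a threshold at the other end. The
   obstacle for [a < 0] is the boundary, where [psum] is wrong by the convention on powers of [0]. A
   violated bound makes [G - nu P] positive somewhere, so the maximum may be sought among tuples
   whose product is bounded below. The hypothesis [n > 2] enters through [1 / n < 1 / 2], which
   makes the sign of [L_s] near [1] strict. *)
Require Import Defs.
From mathcomp Require Import all_boot all_order all_algebra.
From mathcomp Require Import all_classical reals ereal exp.
From mathcomp Require Import topology normedtype derive realfun.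
From mathcomp Require Import ring lra.

Set Implicit Arguments.
Unset Strict Implicit.
Unset Printing Implicit Defensive.

Import Order.TTheory GRing.Theory Num.Theory.
Import numFieldNormedType.Exports.

Local Open Scope classical_set_scope.
Local Open Scope ring_scope.

(** * Derivatives, quotients with a known slope, continuity of powers *)

Section RealAnalysis.
Variable R : realType.
Implicit Types (f g U V h : R -> R) (x y c d e k p : R).

(* A type-class-free wrapper: [apply:] never triggers instance search on it. *)
Definition der f x d : Prop := @is_derive R R R x 1 f d.

Lemma der_eq f x d e : der f x d -> d = e -> der f x e.
Proof. by move=> + <-. Qed.

Lemma der_cst k x : der (fun=> k) x 0.
Proof. exact: (is_derive_cst k x 1). Qed.

Lemma der_id x : der (fun y => y) x 1.
Proof. exact: (@is_derive_id R R x 1). Qed.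

Lemma derD f g x d e : der f x d -> der g x e -> der (fun y => f y + g y) x (d + e).
Proof. by move=> df dg; apply: is_deriveD. Qed.

Lemma derN f x d : der f x d -> der (fun y => - f y) x (- d).
Proof. by move=> df; apply: is_deriveN. Qed.

Lemma derM f g x d e :
  der f x d -> der g x e -> der (fun y => f y * g y) x (d * g x + f x * e).
Proof.
move=> df dg; apply: (@der_eq _ _ (f x *: e + g x *: d)); first exact: is_deriveM.
by rewrite addrC mulrC.
Qed.

Lemma der_comp f g x d e :
  der f (g x) d -> der g x e -> der (fun y => f (g y)) x (d * e).
Proof. by move=> df dg; apply: is_derive1_comp. Qed.

Lemma derV f x d : f x != 0 -> der f x d -> der (fun y => (f y)^-1) x (- (d / f x ^+ 2)).
Proof.
move=> fx df; apply: (@der_eq _ _ (- (f x) ^- 2 *: d)); first exact: is_deriveV.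
by rewrite -[LHS]/(_ * _) mulNr mulrC.
Qed.

Lemma der_powR f x d p : 0 < f x -> der f x d ->
  der (fun y => f y `^ p) x (p * f x `^ (p - 1) * d).
Proof.
by move=> fx df; apply: (@der_comp (fun y => y `^ p) f) => //; apply: is_derive1_powR.
Qed.

Lemma der_cvg f x d : der f x d -> {for x, continuous f}.
Proof. by case=> df _; apply/differentiable_continuous/derivable1_diffP. Qed.

Lemma der_within f (i : interval R) (df : R -> R) :
  (forall x, x \in i -> der f x (df x)) -> {within [set` i], continuous f}.
Proof. by move=> Df; apply: derivable_within_continuous => x /Df []. Qed.

Lemma der_mvt f (df : R -> R) x y : x < y ->
  {within `[x, y], continuous f} ->
  (forall z, x < z < y -> der f z (df z)) ->
  exists2 z, x < z < y & f y - f x = df z * (y - x).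
Proof.
move=> xy cf Df; have [|z] := MVT (df := df) xy _ cf; last first.
  by rewrite in_itv /= => zi e; exists z.
by move=> z; rewrite in_itv /=; exact: Df.
Qed.

Lemma der_incr f (df : R -> R) x y : x <= y ->
  {within `[x, y], continuous f} ->
  (forall z, x < z < y -> der f z (df z)) ->
  (forall z, x < z < y -> 0 <= df z) -> f x <= f y.
Proof.
rewrite le_eqVlt => /predU1P[-> //|xy cf Df df0].
have [z zi e] := der_mvt xy cf Df.
by rewrite -subr_ge0 e mulr_ge0 ?df0 // subr_ge0 ltW.
Qed.

Lemma der_sincr f (df : R -> R) x y : x < y ->
  {within `[x, y], continuous f} ->
  (forall z, x < z < y -> der f z (df z)) ->
  (forall z, x < z < y -> 0 < df z) -> f x < f y.
Proof.
move=> xy cf Df df0.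
have [z zi e] := der_mvt xy cf Df.
by rewrite -subr_gt0 e mulr_gt0 ?df0 // subr_gt0.
Qed.

Lemma within_sub f x y x' y' : x <= x' -> y' <= y ->
  {within `[x, y], continuous f} -> {within `[x', y'], continuous f}.
Proof.
move=> xx yy; apply: continuous_subspaceW => z /=.
by rewrite !in_itv /= => /andP[a b]; rewrite (le_trans xx a) (le_trans b yy).
Qed.

Lemma withinD f g x y : {within `[x, y], continuous f} ->
  {within `[x, y], continuous g} ->
  {within `[x, y], continuous (fun z => f z + g z)}.
Proof. by move=> cf cg z; apply: cvgD; [exact: cf|exact: cg]. Qed.

Lemma withinZ f k x y : {within `[x, y], continuous f} ->
  {within `[x, y], continuous (fun z => k * f z)}.
Proof. by move=> cf z; apply: cvgM; [exact: cvg_cst|exact: cf]. Qed.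

Lemma withinN f x y : {within `[x, y], continuous f} ->
  {within `[x, y], continuous (fun z => - f z)}.
Proof. by move=> cf z; apply: cvgN; exact: cf. Qed.

(* Monotone form of l'Hopital's rule. *)
Lemma slope_ratio_mono U V (dV : R -> R) h c e x : c < x < e ->
  {within `[c, e], continuous U} -> {within `[c, e], continuous V} ->
  (forall z, c < z < e -> der U z (h z * dV z)) ->
  (forall z, c < z < e -> der V z (dV z)) ->
  (forall z, c < z < e -> 0 < dV z) -> U c = 0 -> V c = 0 ->
  (forall y z, c < y -> y <= z -> z < e -> h y <= h z) ->
  U x * V e <= U e * V x.
Proof.
move=> /andP[cx xe] cU cV DU DV dV0 Uc Vc hm.
pose D k z := U z + k * V z.
have DD k z : c < z < e -> der (D k) z ((h z + k) * dV z).
  move=> zi; have := derD (DU z zi) (derM (der_cst k z) (DV z zi)).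
  by move/der_eq; apply; ring.
have cD k : {within `[c, e], continuous (D k)}.
  by apply: withinD => //; apply: withinZ.
have Vx : 0 < V x.
  rewrite -Vc; apply: (@der_sincr V dV) => //.
  - exact: (within_sub (lexx c) (ltW xe)).
  - by move=> z /andP[? zx]; apply: DV; rewrite (lt_trans zx xe) andbT.
  - by move=> z /andP[? zx]; apply: dV0; rewrite (lt_trans zx xe) andbT.
have Ve : V x < V e.
  apply: (@der_sincr V dV) => //.
  - exact: (within_sub (ltW cx) (lexx e)).
  - by move=> z /andP[zx ?]; apply: DV; rewrite (lt_trans cx zx).
  - by move=> z /andP[zx ?]; apply: dV0; rewrite (lt_trans cx zx).
(* The single slope [h x] separates the two pieces: [U' <= h x * V'] before [x], and
   [U' >= h x * V'] after it. *)
have left_part : U x <= h x * V x.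
  have : - D (- h x) c <= - D (- h x) x.
    apply: (@der_incr (fun z => - D (- h x) z)
             (fun z => - ((h z - h x) * dV z)) c x (ltW cx)).
    - by apply: withinN; apply: within_sub (cD _) => //; apply: ltW.
    - move=> z /andP[cz zx]; apply: derN; apply: DD.
      by rewrite cz (lt_trans zx xe).
    - move=> z /andP[cz zx]; rewrite -mulNr opprB mulr_ge0 //.
        by rewrite subr_ge0; apply: hm => //; apply: ltW.
      by apply: ltW; apply: dV0; rewrite cz (lt_trans zx xe).
  by rewrite /D Uc Vc; lra.
have right_part : U x - h x * V x <= U e - h x * V e.
  have : D (- h x) x <= D (- h x) e.
    apply: (@der_incr (D (- h x)) (fun z => (h z - h x) * dV z) x e (ltW xe)).
    - by apply: within_sub (cD _) => //; apply: ltW.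
    - by move=> z /andP[xz ze]; apply: DD; rewrite (lt_trans cx xz).
    - move=> z /andP[xz ze]; rewrite mulr_ge0 //.
        by rewrite subr_ge0; apply: hm => //; apply: ltW.
      by apply: ltW; apply: dV0; rewrite (lt_trans cx xz).
  by rewrite /D; lra.
(* The right-hand sides of [h1] and [h2] add up to the difference of the two sides of the claim. *)
have h1 : 0 <= (h x * V x - U x) * (V e - V x).
  by apply: mulr_ge0; rewrite subr_ge0 // ltW.
have h2 : 0 <= (U e - h x * V e - (U x - h x * V x)) * V x.
  by apply: mulr_ge0; [rewrite subr_ge0|apply: ltW].
nra.
Qed.

(* If [h = U' / V'] decreases near [c] and exceeds [U / V] near [e], then
   [U / V] cannot approach its infimum at either end. *)
Lemma slope_ratio_min U V (dV : R -> R) h c e x0 x1 w : c < x0 < e -> c < x1 < e ->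
  (forall y, y < e -> {within `[c, y], continuous U}) ->
  (forall y, y < e -> {within `[c, y], continuous V}) ->
  (forall z, c < z < e -> der U z (h z * dV z)) ->
  (forall z, c < z < e -> der V z (dV z)) ->
  (forall z, c < z < e -> 0 < dV z) -> U c = 0 -> V c = 0 ->
  (forall y z, c < y -> y <= z -> z < x0 -> h z <= h y) ->
  (forall z, x1 <= z < e -> U z <= w * V z) ->
  (forall z, x1 <= z < e -> w <= h z) ->
  exists2 z, c < z < e & forall x, c < x < e -> U z / V z <= U x / V x.
Proof.
move=> /andP[cx0 x0e] /andP[cx1 x1e] cU cV DU DV dV0 Uc Vc hm Uw hw.
have Vgt0 x : c < x < e -> 0 < V x.
  move=> /andP[cx xe]; rewrite -Vc; apply: (@der_sincr V dV) => //.
  - exact: cV.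
  - by move=> z /andP[? zx]; apply: DV; rewrite (lt_trans zx xe) andbT.
  - by move=> z /andP[? zx]; apply: dV0; rewrite (lt_trans zx xe) andbT.
(* The minimum is taken on the compact middle piece; each outer piece is then compared with the
   adjacent endpoint. *)
pose l := Num.min x0 x1; pose u := Num.max x0 x1.
have cl : c < l by rewrite lt_min cx0.
have ue : u < e by rewrite gt_max x0e.
have lu : l <= u by rewrite le_max ge_min lexx.
have [|z] := @EVT_min R (fun x => U x / V x) l u lu.
  have D x : x \in `[l, u]%R -> der (fun x => U x / V x) x
     (h x * dV x * (V x)^-1 + U x * - (dV x / V x ^+ 2)).
    rewrite in_itv /= => /andP[lx xu].
    have xi : c < x < e by rewrite (lt_le_trans cl lx) (le_lt_trans xu ue).
    apply: derM; first exact: DU.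
    by apply: derV; [rewrite gt_eqF // Vgt0|exact: DV].
  exact: der_within D.
rewrite in_itv /= => /andP[lz zu] zmin.
have zi : c < z < e by rewrite (lt_le_trans cl lz) (le_lt_trans zu ue).
exists z => // x /andP[cx xe].
have ratio_le y1 y2 : c < y1 < e -> c < y2 < e ->
    (U y1 / V y1 <= U y2 / V y2) = (U y1 * V y2 <= U y2 * V y1).
  by move=> i1 i2; rewrite ler_pdivrMr ?Vgt0 // mulrAC ler_pdivlMr ?Vgt0.
have [lx|xl] := leP l x; last first.
  apply: (@le_trans _ _ (U l / V l)).
    by apply: zmin; rewrite in_itv /= lexx.
  have le : l < e by apply: le_lt_trans ue.
  rewrite ratio_le ?cl ?cx ?xe ?le //.
  have := @slope_ratio_mono (fun z => - U z) V dV (fun z => - h z) c l x.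
  rewrite cx xl Uc Vc oppr0 => /(_ isT).
  rewrite !mulNr lerN2; apply=> //.
  - by apply: withinN; apply: cU.
  - exact: cV.
  - move=> y /andP[cy yl]; have := derN (DU y _); rewrite cy (lt_trans yl le).
    by move=> /(_ isT) /der_eq; apply; rewrite mulNr.
  - by move=> y /andP[cy yl]; apply: DV; rewrite cy (lt_trans yl le).
  - by move=> y /andP[cy yl]; apply: dV0; rewrite cy (lt_trans yl le).
  - move=> y y' cy yy yl; rewrite lerN2; apply: hm => //.
    by apply: lt_le_trans yl _; rewrite ge_min lexx.
have [xu|ux] := leP x u.
  by apply: zmin; rewrite in_itv /= lx.
apply: (@le_trans _ _ (U u / V u)).
  by apply: zmin; rewrite in_itv /= lu lexx.
have cu : c < u by apply: lt_le_trans lu.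
have x1u : x1 <= u by rewrite le_max lexx orbT.
rewrite ratio_le ?cu ?cx ?xe ?ue //.
(* Beyond [u] the slope is at least [w], while [U / V] is at most [w] at [u], so the quotient cannot
   fall below its value there. *)
have incr : U u - w * V u <= U x - w * V x.
  apply: (@der_incr (fun z => U z - w * V z) (fun z => (h z - w) * dV z) u x (ltW ux)).
  - apply: (within_sub (ltW cu) (lexx x)).
    by apply: withinD; [exact: cU|apply: withinN; apply: withinZ; exact: cV].
  - move=> y /andP[uy yx]; have yi : c < y < e.
      by rewrite (lt_trans cu uy) (lt_trans yx xe).
    have := derD (DU y yi) (derN (derM (der_cst w y) (DV y yi))).
    by move/der_eq; apply; ring.
  - move=> y /andP[uy yx]; have yi : c < y < e.
      by rewrite (lt_trans cu uy) (lt_trans yx xe).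
    rewrite mulr_ge0 // ?subr_ge0 ?(ltW (dV0 _ yi)) // hw //.
    by rewrite (le_trans x1u (ltW uy)) (lt_trans yx xe).
have Vux : V u < V x.
  apply: (@der_sincr V dV) => //.
  - by have := cV x xe; apply: within_sub => //; apply: ltW.
  - by move=> y /andP[uy yx]; apply: DV; rewrite (lt_trans cu uy) (lt_trans yx xe).
  - by move=> y /andP[uy yx]; apply: dV0; rewrite (lt_trans cu uy) (lt_trans yx xe).
have Vu : 0 < V u by apply: Vgt0; rewrite cu ue.
have Uwu : U u <= w * V u by apply: Uw; rewrite x1u ue.
have h1 : 0 <= (w * V u - U u) * (V x - V u).
  by apply: mulr_ge0; rewrite subr_ge0 // ltW.
have h2 : 0 <= (U x - w * V x - (U u - w * V u)) * V u.
  by apply: mulr_ge0; [rewrite subr_ge0|apply: ltW].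
nra.
Qed.

(** [powR] has a default value at negative bases; the absolute value is what makes a positive power
    continuous across [0], and it changes nothing on the nonnegative tuples of interest. *)
Lemma normr_powR_continuous_at p x : (0 < p) || (x != 0) ->
  {for x, continuous (fun x : R => `|x| `^ p)}.
Proof.
have [->|x0 _] := eqVneq x 0; last first.
  apply: (@continuous_comp _ _ _ (fun x : R => `|x|) (fun y : R => y `^ p)).
    exact: norm_continuous.
  have := @der_powR id `|x| 1 p; rewrite normr_gt0 => /(_ x0 (der_id _)).
  exact: der_cvg.
rewrite orbF => p0.
apply/cvgrPdist_lt => eps eps0 /=.
rewrite normr0 powR0 ?gt_eqF //.
near=> z; rewrite sub0r normrN ger0_norm ?powR_ge0 //.
have -> : eps = (eps `^ p^-1) `^ p.
  by rewrite -powRrM mulVf ?gt_eqF // powRr1 // ltW.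
apply: gt0_ltr_powR => //; rewrite ?nnegrE ?powR_ge0 //.
near: z; apply/nbhs_ballP; exists (eps `^ p^-1) => /=; first exact: powR_gt0.
by move=> z; rewrite /ball /= sub0r normrN.
Unshelve. all: by end_near. Qed.

Lemma normr_powR_continuous p : 0 < p -> continuous (fun x : R => `|x| `^ p).
Proof. by move=> p0 x; apply: normr_powR_continuous_at; rewrite p0. Qed.

(** Carries a one-variable bound from an open side of [1 / n] to the end where [g] vanishes, as
    needed on the boundary of the simplex. *)
Lemma within_limit_ge0 f x y : x < y -> {within `[x, y], continuous f} ->
  (forall z, x < z < y -> 0 <= f z) -> 0 <= f x /\ 0 <= f y.
Proof.
move=> xy /(continuous_within_itvP _ xy) [_ fx fy] f0; split.
  apply: (@closed_cvg _ _ _ _ f (fun u => 0 <= u) (@closed_ge R 0) _ (f x) fx).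
  near=> z; apply: f0; apply/andP; split.
    by near: z; apply: nbhs_right_gt.
  by near: z; apply: nbhs_right_lt.
apply: (@closed_cvg _ _ _ _ f (fun u => 0 <= u) (@closed_ge R 0) _ (f y) fy).
near=> z; apply: f0; apply/andP; split.
  by near: z; apply: nbhs_left_gt.
by near: z; apply: nbhs_left_lt.
Unshelve. all: by end_near. Qed.

End RealAnalysis.

Ltac derive_tac := repeat first
  [ apply: derD | apply: derN | apply: derM | apply: der_cst | apply: der_id
  | apply: der_powR | apply: derV ].

(** * Inequalities between real powers *)

Section PowerInequalities.
Variable R : realType.
Implicit Types a s t x p q : R.

Lemma powR_split x p q : 0 < x -> x `^ (p + q) = x `^ p * x `^ q.
Proof. by move=> x0; rewrite powRD // (gt_eqF x0); apply/implyP. Qed.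

Lemma powR_neq1 t p : 0 < t -> t != 1 -> p != 0 -> t `^ p - 1 != 0.
Proof.
move=> t0 t1 p0; rewrite subr_eq0 powR_eq1 (negbTE t1) (negbTE p0).
by rewrite ltNge (ltW t0).
Qed.

Lemma powR_gt1 t p : 1 < t -> 0 < p -> 1 < t `^ p.
Proof.
move=> t1 p0; rewrite -{1}(powRr0 t) /powR gt_eqF; last by lra.
by rewrite ltr_expR mul0r mulr_gt0 // ln_gt0.
Qed.

(** The expression vanishes at [t = 1], and its derivative [a b (t^(b - 1) - t^(a - 1))], with
    [b = 1 - a], is nonpositive before [1] and nonnegative after it. The product form of the
    hypothesis covers [0 < a <= 1/2] and [a > 1] together. *)
Lemma powR_balance_ge0 a t : 0 < t -> 0 <= a * (1 - a) * (1 - a - a) ->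
  0 <= a * t `^ (1 - a) - (1 - a) * t `^ a + (1 - a) - a.
Proof.
move=> t0 ha; set b := 1 - a.
pose k x := a * x `^ b - b * x `^ a + b - a.
have k1 : k 1 = 0 by rewrite /k !powR1; ring.
pose dk x := a * b * (x `^ (b - 1) - x `^ (a - 1)).
have Dk x : 0 < x -> der k x (dk x).
  by move=> x0; eapply der_eq; [rewrite /k; derive_tac|rewrite /dk; ring].
have W x y : 0 < x -> {within `[x, y], continuous k}.
  move=> x0; apply: (der_within (df := dk)) => z; rewrite in_itv /=.
  by move=> /andP[xz _]; apply: Dk; apply: lt_le_trans xz.
change (0 <= k t).
have [t1|t1] := leP t 1.
  have : - k t <= - k 1.
    apply: (@der_incr _ (fun x => - k x) (fun x => - dk x) _ _ t1).
    - by apply: withinN; apply: W.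
    - by move=> z /andP[tz _]; apply: derN; apply: Dk; apply: lt_trans tz.
    - move=> z /andP[tz z1].
      have zp : 0 < z <= 1 by rewrite (lt_trans t0 tz) ltW.
      rewrite /dk; have [ab|ab] := leP (a * b) 0.
        have [ab0|ab0] := leP a b.
          (* Here [a b <= 0] and [a <= b]: unless [a b = 0], the hypothesis forces [a = b], and the
             derivative vanishes in both cases. *)
          have [->|ne] := eqVneq (a * b) 0; first by rewrite mul0r oppr0.
          have : a * b < 0 by rewrite lt_neqAle ne.
          rewrite /b => ab'; rewrite (nmulr_rge0 _ ab') in ha.
          have -> : 1 - a = a by rewrite /b in ab0; lra.
          by rewrite subrr mulr0 oppr0.
        rewrite -mulrN opprB mulr_le0 // subr_le0.
        by apply: ger_powR => //; lra.
      have hab : 0 <= 1 - a - a by rewrite -(pmulr_rge0 _ ab).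
      have ab0 : a <= b by rewrite /b; lra.
      rewrite -mulrN opprB mulr_ge0 ?(ltW ab) // subr_ge0.
      by apply: ger_powR => //; lra.
  by rewrite k1 oppr0 oppr_le0.
rewrite -[leLHS]k1; apply: (@der_incr _ k dk _ _ (ltW t1)).
- exact: (W _ _ ltr01).
- by move=> z /andP[tz _]; apply: Dk; lra.
- move=> z /andP[tz z1].
  have zp : 1 <= z by lra.
  rewrite /dk; have [ab|ab] := leP (a * b) 0.
    have [ab0|ab0] := leP a b.
      have [->|ne] := eqVneq (a * b) 0; first by rewrite mul0r.
      have : a * b < 0 by rewrite lt_neqAle ne.
      rewrite /b => ab'; rewrite (nmulr_rge0 _ ab') in ha.
      have -> : 1 - a = a by rewrite /b in ab0; lra.
      by rewrite subrr mulr0.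
    rewrite mulr_le0 // subr_le0.
    by apply: ler_powR => //; lra.
  have hab : 0 <= 1 - a - a by rewrite -(pmulr_rge0 _ ab).
  have ab0 : a <= b by rewrite /b; lra.
  rewrite mulr_ge0 ?(ltW ab) // subr_ge0.
  by apply: ler_powR => //; lra.
Qed.

(** The derivative at [z] of the right side minus the left side is the quantity of
    [powR_balance_ge0] at [1 / z]. *)
Lemma powR_sub_le a t : 1 <= t -> 0 <= a * (1 - a) * (1 - a - a) ->
  t `^ (1 - a) - t `^ a <= (1 - a - a) * (t - 1).
Proof.
move=> t1 ha; set b := 1 - a.
pose k x := (b - a) * (x - 1) - (x `^ b - x `^ a).
have k1 : k 1 = 0 by rewrite /k !powR1; ring.
pose dk x := (b - a) - b * x `^ (b - 1) + a * x `^ (a - 1).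
have Dk x : 0 < x -> der k x (dk x).
  by move=> x0; eapply der_eq; [rewrite /k; derive_tac|rewrite /dk; ring].
suff : k 1 <= k t by rewrite k1 /k subr_ge0.
apply: (@der_incr _ k dk _ _ t1).
- apply: (der_within (df := dk)) => z; rewrite in_itv /=.
  by move=> /andP[xz _]; apply: Dk; lra.
- by move=> z /andP[tz _]; apply: Dk; lra.
- move=> z /andP[tz _].
  have z0 : 0 < z by lra.
  have := @powR_balance_ge0 a z^-1; rewrite invr_gt0 => /(_ z0 ha).
  rewrite -/b -!powR_inv1 ?(ltW z0) // -!powRrM !mulN1r.
  have -> : - b = a - 1 by rewrite /b; ring.
  have -> : - a = b - 1 by rewrite /b; ring.
  by have : b = 1 - a by []; rewrite /dk; lra.
Qed.

(** Bernoulli's inequality for all orders at once: the sign of [p (p - 1)] decides between convexity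
    and concavity, hence on which side of its tangent at [1] the power lies. *)
Lemma powR_tangent p x : 0 < x -> 0 <= p * (p - 1) * (x `^ p - 1 - p * (x - 1)).
Proof.
move=> x0; pose q := p * (p - 1).
pose k x := q * (x `^ p - 1 - p * (x - 1)).
have k1 : k 1 = 0 by rewrite /k powR1; ring.
pose dk x := q * p * (x `^ (p - 1) - 1).
have Dk z : 0 < z -> der k z (dk z).
  by move=> z0; eapply der_eq; [rewrite /k; derive_tac|rewrite /dk; ring].
have W y z : 0 < y -> {within `[y, z], continuous k}.
  move=> y0; apply: (der_within (df := dk)) => u; rewrite in_itv /=.
  by move=> /andP[yu _]; apply: Dk; apply: lt_le_trans yu.
have dkE z : dk z = p ^+ 2 * ((p - 1) * (z `^ (p - 1) - 1)).
  by rewrite /dk /q; ring.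
change (0 <= k x); have [x1|x1] := leP x 1.
  have : - k x <= - k 1.
    apply: (@der_incr _ (fun x => - k x) (fun x => - dk x) _ _ x1).
    - by apply: withinN; apply: W.
    - by move=> z /andP[tz _]; apply: derN; apply: Dk; apply: lt_trans tz.
    - move=> z /andP[xz z1]; rewrite dkE -mulrN mulr_ge0 ?sqr_ge0 //.
      have zp : 0 < z <= 1 by rewrite (lt_trans x0 xz) ltW.
      have [p1|p1] := leP (p - 1) 0.
        rewrite -mulrN mulr_le0 // oppr_le0 subr_ge0 -[leLHS](powRr0 z).
        exact: ger_powR.
      rewrite -mulrN mulr_ge0 ?(ltW p1) // oppr_ge0 subr_le0 -[leRHS](powRr0 z).
      by apply: ger_powR => //; apply: ltW.
  by rewrite k1 oppr0 oppr_le0.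
rewrite -[leLHS]k1; apply: (@der_incr _ k dk _ _ (ltW x1)).
- exact: (W _ _ ltr01).
- by move=> z /andP[tz _]; apply: Dk; lra.
- move=> z /andP[xz z1]; rewrite dkE mulr_ge0 ?sqr_ge0 //.
  have zp : 1 <= z by lra.
  have [p1|p1] := leP (p - 1) 0.
    rewrite mulr_le0 // subr_le0 -[leRHS](powRr0 z).
    exact: ler_powR.
  rewrite mulr_ge0 ?(ltW p1) // subr_ge0 -[leLHS](powRr0 z).
  by apply: ler_powR => //; apply: ltW.
Qed.

End PowerInequalities.

(** * Sign of the logarithmic derivative of the slope *)

Section LogSlope.
Variable R : realType.
Implicit Types a s t : R.

(* [t H'(t) / H(t)] for the function [H = slope] below, with [s = 1 / n]. *)
Definition logslope s a t :=
  a - s + (t - 1)^-1 - (1 - a) / (t `^ (1 - a) - 1)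
  + (1 - a) * s / ((1 - s) * t `^ a + s).

Lemma logslope_den_gt0 s a t : 0 < t -> 0 < s < 1 -> 0 < (1 - s) * t `^ a + s.
Proof.
by move=> t0 /andP[s0 s1]; rewrite addr_gt0 // mulr_gt0 ?powR_gt0 // subr_gt0.
Qed.

Lemma powRV t a : 0 < t -> t^-1 `^ a = (t `^ a)^-1.
Proof. by move=> t0; rewrite -powR_inv1 ?(ltW t0) // -powRrM mulN1r powRN. Qed.

Lemma logslopeV s a t : 0 < t -> t != 1 -> 0 < s < 1 -> a != 1 ->
  logslope s a t^-1 = - logslope (1 - s) a t.
Proof.
move=> t0 t1 si a1; rewrite /logslope !powRV //.
have si' : 0 < 1 - s < 1 by lra.
have hD := logslope_den_gt0 a t0 si'.
have hY : t `^ (1 - a) - 1 != 0 by rewrite powR_neq1 // subr_eq0 eq_sym.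
have hX := powR_gt0 a t0; have hY0 := powR_gt0 (1 - a) t0.
set X := t `^ a in hX hD *; set Y := t `^ (1 - a) in hY hY0 *.
have t1' : t - 1 != 0 by rewrite subr_eq0.
have hY' : 1 + -1 * Y != 0 by rewrite mulN1r -oppr_eq0 opprB.
have t1'' : 1 + -1 * t != 0 by rewrite mulN1r -oppr_eq0 opprB.
by field; rewrite hY' hY t1' t1'' !gt_eqF.
Qed.

Lemma powR_mul_compl a t : 0 < t -> t `^ a * t `^ (1 - a) = t.
Proof.
by move=> t0; rewrite -powR_split // addrCA subrr addr0 powRr1 // ltW.
Qed.

Lemma logslope_half a t : 0 < t -> t != 1 -> a != 1 ->
  logslope 2^-1 a t =
  - ((t + 1) * ((1 - a - a) * (t - 1) - (t `^ (1 - a) - t `^ a)))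
  / (2 * (t - 1) * (t `^ (1 - a) - 1) * (t `^ a + 1)).
Proof.
move=> t0 t1 a1; rewrite /logslope.
have hY : t `^ (1 - a) - 1 != 0 by rewrite powR_neq1 // subr_eq0 eq_sym.
have hX := powR_gt0 a t0.
have t1' : t - 1 != 0 by rewrite subr_eq0.
(* Once [t] is replaced by [t^a t^(1 - a)], both powers are free variables and the identity is
   rational. *)
move: (powR_mul_compl a t0) t1' hX hY.
move: (t `^ a) (t `^ (1 - a)) => X Y <- t1' hX hY.
by field; rewrite hY t1' /= !gt_eqF //; lra.
Qed.

Lemma logslope_diag a t : 0 < t -> t != 1 -> 0 < a < 1 ->
  logslope a a t =
  ((1 - a) * t + a) * (a * t `^ (1 - a) - (1 - a) * t `^ a + (1 - a) - a)
  / ((t - 1) * (t `^ (1 - a) - 1) * ((1 - a) * t `^ a + a)).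
Proof.
move=> t0 t1 ai; rewrite /logslope.
have hY : t `^ (1 - a) - 1 != 0 by rewrite powR_neq1 //; lra.
have hD := logslope_den_gt0 a t0 ai.
have t1' : t - 1 != 0 by rewrite subr_eq0.
move: (powR_mul_compl a t0) t1' hD hY.
move: (t `^ a) (t `^ (1 - a)) => X Y <- t1' hD hY.
by field; rewrite hY t1' /= gt_eqF.
Qed.

(** At [s = 1] only [1 / (t - 1) - (1 - a) / (t^(1 - a) - 1)] survives; its sign is the concavity of
    the power of order [1 - a]. *)
Lemma logslope_one_le0 a t : 1 < t -> 0 < a < 1 -> logslope 1 a t <= 0.
Proof.
move=> t1 ai; rewrite /logslope.
have Y1 : 1 < t `^ (1 - a) by apply: powR_gt1 => //; lra.
have := @powR_tangent R (1 - a) t; have -> : 0 < t by lra.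
move=> /(_ isT); rewrite nmulr_rge0; last by nra.
set Y := t `^ (1 - a) in Y1 * => hY.
have -> : a - 1 + (t - 1)^-1 - (1 - a) / (Y - 1) + (1 - a) * 1 / ((1 - 1) * t `^ a + 1)
   = (Y - 1 - (1 - a) * (t - 1)) / ((t - 1) * (Y - 1)).
  by rewrite subrr mul0r add0r; field; rewrite !gt_eqF // subr_gt0.
by rewrite pmulr_lle0 // invr_gt0 mulr_gt0 // subr_gt0.
Qed.

Lemma logslope_half_sign a t : 1 < t -> 0 < a < 1 ->
  (a <= 2^-1 -> logslope 2^-1 a t <= 0 /\ 0 <= logslope a a t) /\
  (2^-1 <= a -> 0 <= logslope 2^-1 a t /\ logslope a a t <= 0).
Proof.
move=> t1 ai.
have t0 : 0 < t by lra.
have t1' : t != 1 by rewrite gt_eqF.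
have a1 : a != 1 by rewrite lt_eqF //; lra.
have Y1 : 0 < t `^ (1 - a) - 1 by rewrite subr_gt0 powR_gt1 //; lra.
have X0 : 0 < t `^ a by apply: powR_gt0.
have hD := logslope_den_gt0 a t0 ai.
have c1 : 0 < (2 * (t - 1) * (t `^ (1 - a) - 1) * (t `^ a + 1))^-1.
  by rewrite invr_gt0; do ?apply: mulr_gt0; lra.
have c2 : 0 < ((t - 1) * (t `^ (1 - a) - 1) * ((1 - a) * t `^ a + a))^-1.
  by rewrite invr_gt0; do ?apply: mulr_gt0; lra.
have c3 : 0 < (1 - a) * t + a by rewrite addr_gt0 ?mulr_gt0 //; lra.
have t2 : 0 < t + 1 by lra.
rewrite logslope_half // logslope_diag //; split=> ha.
  have hb : 0 <= a * (1 - a) * (1 - a - a).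
    by apply: mulr_ge0; [apply: mulr_ge0|]; lra.
  split.
    rewrite (pmulr_lle0 _ c1) oppr_le0 (pmulr_rge0 _ t2) subr_ge0.
    exact: (powR_sub_le (ltW t1)).
  by rewrite (pmulr_lge0 _ c2) (pmulr_rge0 _ c3); apply: powR_balance_ge0.
(* The deciding factors of both factorizations are antisymmetric under [a <-> 1 - a], so the
   inequalities for [1 - a <= 1/2] give the opposite signs. *)
pose b := 1 - a.
have hb : 0 <= b * (1 - b) * (1 - b - b).
  by rewrite /b; apply: mulr_ge0; [apply: mulr_ge0|]; lra.
rewrite (pmulr_lge0 _ c1) oppr_ge0 (pmulr_lle0 _ c2) (pmulr_rle0 _ t2) (pmulr_rle0 _ c3).
have bE : 1 - b = a by rewrite /b; lra.
have := powR_balance_ge0 t0 hb; have := powR_sub_le (ltW t1) hb.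
by rewrite bE -/b; lra.
Qed.

Lemma logslope_quad s a t : 0 < t -> 0 < s < 1 ->
  logslope s a t * ((1 - s) * t `^ a + s) =
  (a - s + (t - 1)^-1 - (1 - a) / (t `^ (1 - a) - 1)) * ((1 - s) * t `^ a + s)
  + (1 - a) * s.
Proof.
move=> t0 si; rewrite /logslope mulrDl; congr (_ + _).
by rewrite divfK // gt_eqF // logslope_den_gt0.
Qed.

(** Multiplied by [(1 - s) t^a + s], [logslope] is quadratic in [s] with leading coefficient
    [t^a - 1 > 0]. This is its convexity at [s2], a convex combination of [s1] and [1]. Since the
    value at [1] is nonpositive, nonnegativity passes down from [s2] to [s1], and nonpositivity up
    from [s1] to [s2]. *)
Lemma logslope_convex s1 s2 a t : 1 < t -> 0 < a < 1 -> 0 < s1 <= s2 -> s2 < 1 ->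
  exists c1 c2 c3 : R, [/\ 0 < c1, 0 < c2, 0 <= c3 &
    c1 * logslope s2 a t <= c2 * logslope s1 a t + c3 * logslope 1 a t].
Proof.
move=> t1 ai /andP[s10 s12] s21.
have t0 : 0 < t by lra.
have i1 : 0 < s1 < 1 by lra.
have i2 : 0 < s2 < 1 by lra.
exists ((1 - s1) * ((1 - s2) * t `^ a + s2)), ((1 - s2) * ((1 - s1) * t `^ a + s1)).
exists (s2 - s1); split.
- by rewrite mulr_gt0 ?logslope_den_gt0 // subr_gt0; lra.
- by rewrite mulr_gt0 ?logslope_den_gt0 // subr_gt0.
- by lra.
rewrite -2!mulrA ![_ * logslope _ _ _]mulrC !logslope_quad //.
rewrite /logslope subrr mul0r add0r divr1 mulr1.
have X1 : 1 < t `^ a by apply: powR_gt1 => //; lra.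
set X := t `^ a in X1 *; set T := (t - 1)^-1; set W := _ / _.
rewrite -subr_ge0.
have -> : (1 - s2) * ((a - s1 + T - W) * ((1 - s1) * X + s1) + (1 - a) * s1) +
  (a - 1 + T - W + (1 - a)) * (s2 - s1) -
  (1 - s1) * ((a - s2 + T - W) * ((1 - s2) * X + s2) + (1 - a) * s2)
  = (X - 1) * ((1 - s1) * (1 - s2) * (s2 - s1)) by ring.
by rewrite !mulr_ge0 // subr_ge0; lra.
Qed.

(** Nonnegativity passes down to [s] from [a] if [a <= 1/2], and from [1/2] otherwise. *)
Lemma logslope_ge0_right s a t : 1 < t -> 0 < s <= 2^-1 -> s <= a -> 0 < a < 1 ->
  0 <= logslope s a t.
Proof.
move=> t1 /andP[s0 s2] sa ai.
have [neg pos] := logslope_half_sign t1 ai; have L1 := logslope_one_le0 t1 ai.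
have [a2|a2] := leP a 2^-1.
  have [_ h] := neg a2.
  have [||c1 [c2 [c3 [c10 c20 c30 hc]]]] := @logslope_convex s a a t t1 ai; [lra..|].
  rewrite -(pmulr_rge0 _ c20).
  have := mulr_ge0 (ltW c10) h; have := mulr_ge0_le0 c30 L1; lra.
have [h _] := pos (ltW a2).
have [||c1 [c2 [c3 [c10 c20 c30 hc]]]] := @logslope_convex s 2^-1 a t t1 ai; [lra..|].
rewrite -(pmulr_rge0 _ c20).
have := mulr_ge0 (ltW c10) h; have := mulr_ge0_le0 c30 L1; lra.
Qed.

(** The factorization at [s = 1/2] suffices: for [a > 1] both terms containing [s] decrease in [s],
    the last one because [1 - a < 0]. *)
Lemma logslope_ge0_right_gt1 s a t : 1 < t -> 0 < s <= 2^-1 -> 1 < a ->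
  0 <= logslope s a t.
Proof.
move=> t1 /andP[s0 s2] a1.
have t0 : 0 < t by lra.
have t1' : t != 1 by rewrite gt_eqF.
have a1' : a != 1 by rewrite gt_eqF.
have half : 0 <= logslope 2^-1 a t.
  rewrite logslope_half // mulNr -mulrN -invrN.
  have -> : - (2 * (t - 1) * (t `^ (1 - a) - 1) * (t `^ a + 1)) =
     2 * (t - 1) * (1 - t `^ (1 - a)) * (t `^ a + 1) by ring.
  have hY : t `^ (1 - a) <= 1.
    by rewrite -[leRHS](powRr0 t); apply: ler_powR; lra.
  have hX := powR_ge0 t a.
  have hb : 0 <= a * (1 - a) * (1 - a - a).
    by rewrite -mulrA; apply: mulr_ge0; [|apply: mulr_le0]; lra.
  apply: mulr_ge0.
    by apply: mulr_ge0; [lra|rewrite subr_ge0 powR_sub_le // ltW].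
  by rewrite invr_ge0; apply: mulr_ge0; [apply: mulr_ge0; [apply: mulr_ge0|]|]; lra.
apply: (le_trans half); rewrite /logslope lerD //; first by lra.
have i1 : 0 < s < 1 by lra.
have i2 : 0 < (2^-1 : R) < 1 by lra.
rewrite -!mulrA ler_nM2l; last by lra.
rewrite ler_pdivrMr ?logslope_den_gt0 // mulrAC ler_pdivlMr ?logslope_den_gt0 //.
have := powR_gt0 a t0; set X := t `^ a => X0.
rewrite -subr_ge0.
have -> : 2^-1 * ((1 - s) * X + s) - s * ((1 - 2^-1) * X + 2^-1) =
  (2^-1 - s) * X by field.
by rewrite mulr_ge0 //; lra.
Qed.

(** The reflection [t -> 1 / t] reduces this to nonpositivity of [logslope (1 - s) a] beyond [1],
    which passes up to [1 - s] from [1/2] or from [a]. *)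
Lemma logslope_ge0_left s a t : 0 < t < 1 -> 0 < s <= 2^-1 -> 0 < a -> a <= 1 - s ->
  0 <= logslope s a t.
Proof.
move=> /andP[t0 t1] /andP[s0 s2] a0 sa.
have ai : 0 < a < 1 by lra.
have u1 : 1 < t^-1 by rewrite invf_gt1.
have u0 : 0 < t^-1 by rewrite invr_gt0.
rewrite -[t]invrK logslopeV //; [|by rewrite gt_eqF|by lra|by rewrite lt_eqF //; lra].
rewrite oppr_ge0.
have [neg pos] := logslope_half_sign u1 ai; have L1 := logslope_one_le0 u1 ai.
have [a2|a2] := leP a 2^-1.
  have [h _] := neg a2.
  have [||c1 [c2 [c3 [c10 c20 c30 hc]]]] :=
    @logslope_convex 2^-1 (1 - s) a t^-1 u1 ai; [lra..|].
  rewrite -(pmulr_rle0 _ c10).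
  have := mulr_ge0_le0 (ltW c20) h; have := mulr_ge0_le0 c30 L1; lra.
have [_ h] := pos (ltW a2).
have [||c1 [c2 [c3 [c10 c20 c30 hc]]]] :=
  @logslope_convex a (1 - s) a t^-1 u1 ai; [lra..|].
rewrite -(pmulr_rle0 _ c10).
have := mulr_ge0_le0 (ltW c20) h; have := mulr_ge0_le0 c30 L1; lra.
Qed.

End LogSlope.

(** * The slope near [1] and its monotonicity *)

Section Slope.
Variable R : realType.
Implicit Types (a s t x p : R) (f : R -> R).

(** Continuity of [f2] makes it positive on a whole ball, and two integrations follow. It serves
    both for the sign of [logslope] near [1] and for the second-order condition at an extremum. *)
Lemma second_derivative_pos f (f1 f2 : R -> R) x r : 0 < r ->
  (forall y, `|y - x| < r -> der f y (f1 y)) ->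
  (forall y, `|y - x| < r -> der f1 y (f2 y)) ->
  f x = 0 -> f1 x = 0 -> 0 < f2 x -> {for x, continuous f2} ->
  exists2 d, 0 < d <= r & forall y, `|y - x| < d -> y != x -> 0 < f y.
Proof.
move=> r0 Df Df1 fx f1x f2x cf2.
have /cvgr_dist_lt /(_ _ f2x) /nbhs_ballP [d /= d0 hd] := cf2.
have f2pos y : `|y - x| < d -> 0 < f2 y.
  move=> yd; have /= := hd y; rewrite /ball /= distrC => /(_ yd).
  by move=> /ltr_normlP [_]; lra.
exists (Num.min d r) => [|y]; first by rewrite lt_min d0 r0 ge_min lexx orbT.
rewrite lt_min => /andP[yd yr] yx.
have inr z : (x < z < y) || (y < z < x) -> `|z - x| < d /\ `|z - x| < r.
  move=> /orP zi; move: yd yr; rewrite !ltr_norml => /andP[? ?] /andP[? ?].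
  by split; apply/andP; split; case: zi => /andP[? ?]; lra.
have W (u : R -> R) (du : R -> R) p q : (forall z, p <= z <= q -> der u z (du z)) ->
    {within `[p, q], continuous u}.
  by move=> Du; apply: (der_within (df := du)) => z; rewrite in_itv /=; apply: Du.
have inr' z : (x <= z <= y) || (y <= z <= x) -> `|z - x| < r.
  move=> /orP zi; move: yr; rewrite !ltr_norml => /andP[? ?].
  by apply/andP; split; case: zi => /andP[? ?]; lra.
have [xy|] := ltP x y.
  have f1pos z : x < z < y -> 0 < f1 z.
    move=> /andP[xz zy]; rewrite -f1x; apply: (@der_sincr _ f1 f2 _ _ xz).
    - apply: W (f2) _ _ _ => u /andP[u1 u2]; apply: Df1; apply: inr'.
      by rewrite u1 (le_trans u2 (ltW zy)).
    - move=> u /andP[u1 u2]; apply: Df1; apply: inr'.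
      by rewrite (ltW u1) ltW // (lt_trans u2 zy).
    - move=> u /andP[u1 u2]; apply: f2pos; apply: (inr _ _).1.
      by rewrite u1 (lt_trans u2 zy).
  rewrite -fx; apply: (@der_sincr _ f f1 _ _ xy).
  - by apply: W (f1) _ _ _ => u ui; apply: Df; apply: inr'; rewrite ui.
  - move=> u /andP[u1 u2]; apply: Df; apply: inr'.
    by rewrite (ltW u1) (ltW u2).
  - exact: f1pos.
rewrite le_eqVlt (negbTE yx) /= => xy.
have f1neg z : y < z < x -> f1 z < 0.
  move=> /andP[yz zx]; rewrite -f1x; apply: (@der_sincr _ f1 f2 _ _ zx).
  - apply: W (f2) _ _ _ => u /andP[u1 u2]; apply: Df1; apply: inr'.
    by rewrite (le_trans (ltW yz) u1) u2 orbT.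
  - move=> u /andP[u1 u2]; apply: Df1; apply: inr'.
    by rewrite (ltW u2) (ltW (lt_trans yz u1)) orbT.
  - move=> u /andP[u1 u2]; apply: f2pos; apply: (inr _ _).1.
    by rewrite u2 (lt_trans yz u1) orbT.
rewrite -oppr_lt0 -oppr0 -fx.
apply: (@der_sincr _ (fun z => - f z) (fun z => - f1 z) _ _ xy).
- apply: withinN; apply: W (f1) _ _ _ => u ui; apply: Df; apply: inr'.
  by rewrite ui orbT.
- move=> u /andP[u1 u2]; apply: derN; apply: Df; apply: inr'.
  by rewrite (ltW u1) (ltW u2) orbT.
- by move=> u ui; rewrite oppr_gt0 f1neg.
Qed.

Lemma powR_sub1_div x p : 0 < x -> x `^ (p - 1) = x `^ p / x.
Proof. by move=> x0; rewrite powR_split // powR_inv1 // ltW. Qed.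

Lemma mul_powR_sub1_gt0 p t : 0 < t -> t != 1 -> p != 0 ->
  0 < p * ((t - 1) * (t `^ p - 1)).
Proof.
move=> t0 t1 p0.
have [tlt1|tgt1] : t < 1 \/ 1 < t.
  by case: (ltgtP t 1) t1 => // *; [left|right].
- have [pn|pp] : p < 0 \/ 0 < p.
    by case: (ltgtP p 0) p0 => // *; [left|right].
  + have : t^-1 `^ (- p) > 1 by apply: powR_gt1; [rewrite invf_gt1|rewrite oppr_gt0].
    rewrite powRV // powRN invrK => h.
    by rewrite nmulr_rgt0 // nmulr_rlt0 // ?subr_gt0 // subr_lt0.
  + have : t^-1 `^ p > 1 by apply: powR_gt1 => //; rewrite invf_gt1.
    rewrite powRV // invf_gt1 ?powR_gt0 // => h.
    by rewrite pmulr_rgt0 // nmulr_rgt0 // subr_lt0.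
- have [pn|pp] : p < 0 \/ 0 < p.
    by case: (ltgtP p 0) p0 => // *; [left|right].
  + have : t `^ (- p) > 1 by apply: powR_gt1; rewrite ?oppr_gt0.
    rewrite powRN invf_gt1 ?powR_gt0 // => h.
    by rewrite nmulr_rgt0 // pmulr_rlt0 // ?subr_gt0 // subr_lt0.
  + have h : t `^ p > 1 by apply: powR_gt1.
    by rewrite pmulr_rgt0 // pmulr_rgt0 // subr_gt0.
Qed.

(* The limit of [logslope s a] at [1] is [a * (1 / 2 - s)]; since [logslope] is
   undefined there, clear denominators and look at second order. *)
Lemma logslope_near1 s a : 0 < s < 2^-1 -> a != 0 -> a != 1 ->
  exists2 d, 0 < d <= 1 & forall t, `|t - 1| < d -> t != 1 -> 0 < a * logslope s a t.
Proof.
move=> si a0 a1; pose b := 1 - a.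
have b0 : b != 0 by rewrite subr_eq0 eq_sym.
pose D t := (1 - s) * t `^ a + s.
pose D1 t := (1 - s) * (a * t `^ (a - 1)).
pose D2 t := (1 - s) * (a * ((a - 1) * t `^ (a - 1 - 1))).
pose M t := (t - 1) * (t `^ b - 1).
pose M1 t := (t `^ b - 1) + (t - 1) * (b * t `^ (b - 1)).
pose M2 t := 2 * (b * t `^ (b - 1)) + (t - 1) * (b * ((b - 1) * t `^ (b - 1 - 1))).
pose N t := t `^ b - 1 - b * (t - 1).
pose N1 t := b * t `^ (b - 1) - b.
pose N2 t := b * ((b - 1) * t `^ (b - 1 - 1)).
pose K t := (a - s) * D t + b * s.
(* [F] is [a * logslope s a t] times the positive factor [D t * (b * M t)]. It vanishes to first
   order at [1], and the factor [a b] turns its second derivative there into [a^2 b^2 (1 - 2 s)],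
   positive for every order. *)
pose F t := a * b * (K t * M t + D t * N t).
pose F1 t := a * b * ((a - s) * D1 t * M t + K t * M1 t + D1 t * N t + D t * N1 t).
pose F2 t := a * b * ((a - s) * D2 t * M t + 2 * ((a - s) * D1 t * M1 t) + K t * M2 t
                      + D2 t * N t + 2 * (D1 t * N1 t) + D t * N2 t).
have pos t : `|t - 1| < 1 -> 0 < t by rewrite ltr_norml => /andP[? ?]; lra.
have DF t : `|t - 1| < 1 -> der F t (F1 t).
  move=> /pos t0; rewrite /F; eapply der_eq.
    by rewrite /K /M /D /N; derive_tac.
  by rewrite /F1 /K /M /M1 /D /D1 /N /N1; ring.
have DF1 t : `|t - 1| < 1 -> der F1 t (F2 t).
  move=> /pos t0; rewrite /F1; eapply der_eq.
    by rewrite /K /M /D /N /D1 /M1 /N1; derive_tac.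
  by rewrite /F2 /K /M /M1 /M2 /D /D1 /D2 /N /N1 /N2; ring.
have [||||d d01 hd] := second_derivative_pos (x := 1) ltr01 DF DF1.
- by rewrite /F /M /N !powR1; ring.
- by rewrite /F1 /M /N /M1 /N1 !powR1; ring.
- rewrite /F2 /K /M /M1 /M2 /D /D1 /D2 /N /N1 /N2 !powR1.
  have -> : a * b * ((a - s) * ((1 - s) * (a * ((a - 1) * 1))) * ((1 - 1) * (1 - 1)) +
   2 * ((a - s) * ((1 - s) * (a * 1)) * (1 - 1 + (1 - 1) * (b * 1))) +
   ((a - s) * ((1 - s) * 1 + s) + b * s) *
   (2 * (b * 1) + (1 - 1) * (b * ((b - 1) * 1))) +
   (1 - s) * (a * ((a - 1) * 1)) * (1 - 1 - b * (1 - 1)) +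
   2 * ((1 - s) * (a * 1) * (b * 1 - b)) + ((1 - s) * 1 + s) * (b * ((b - 1) * 1)))
   = a ^+ 2 * b ^+ 2 * (1 - 2 * s) by rewrite /b; ring.
  apply: mulr_gt0; last by lra.
  by apply: mulr_gt0; rewrite exprn_even_gt0.
- have : exists e, der F2 1 e.
    eexists; rewrite /F2 /K /M /M1 /M2 /D /D1 /D2 /N /N1 /N2.
    by derive_tac; rewrite ?ltr01.
  by case=> e; apply: der_cvg.
exists d => // t td t1.
have t0 : 0 < t by apply: pos; case/andP: d01 => _; apply: lt_le_trans.
have := hd t td t1; rewrite /F.
have hM : 0 < b * M t by apply: mul_powR_sub1_gt0.
have hD : 0 < D t by apply: logslope_den_gt0 => //; lra.
have -> : a * b * (K t * M t + D t * N t) = (a * logslope s a t) * (D t * (b * M t)).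
  rewrite /logslope /K /M /D /N -/b.
  have h1 : t - 1 != 0 by rewrite subr_eq0.
  have h2 : t `^ b - 1 != 0 by rewrite powR_neq1.
  by field; rewrite h1 h2 /= gt_eqF.
by rewrite pmulr_lgt0 // mulr_gt0.
Qed.

(* The derivative ratio [(1 - a) g' / p'] as a function of [t = x / (1 - (n - 1) x)],
   with [s = 1 / n]. *)
Definition slope s a t := t `^ (1 - a - s) * ((1 - a) * ((t - 1) / (t `^ (1 - a) - 1)))
  * ((1 - s) * t `^ a + s) `^ (- ((1 - a) / a)).

Lemma slope_gt0 s a t : 0 < t -> t != 1 -> 0 < s < 1 -> a != 1 -> 0 < slope s a t.
Proof.
move=> t0 t1 si a1; have b0 : 1 - a != 0 by rewrite subr_eq0 eq_sym.
apply: mulr_gt0; last by apply: powR_gt0; apply: logslope_den_gt0.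
apply: mulr_gt0; first exact: powR_gt0.
have := mul_powR_sub1_gt0 t0 t1 b0.
have h2 : t `^ (1 - a) - 1 != 0 by rewrite powR_neq1.
have -> : (1 - a) * ((t - 1) * (t `^ (1 - a) - 1)) =
  ((1 - a) * ((t - 1) / (t `^ (1 - a) - 1))) * (t `^ (1 - a) - 1) ^+ 2 by field.
have h3 : 0 < (t `^ (1 - a) - 1) ^+ 2 by rewrite exprn_even_gt0.
by rewrite (pmulr_lgt0 _ h3).
Qed.

Lemma der_slope s a t : 0 < t -> t != 1 -> 0 < s < 1 -> a != 0 -> a != 1 ->
  der (slope s a) t (slope s a t * logslope s a t / t).
Proof.
move=> t0 t1 si a0 a1; have b0 : 1 - a != 0 by rewrite subr_eq0 eq_sym.
have hD := logslope_den_gt0 a t0 si.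
have h2 : t `^ (1 - a) - 1 != 0 by rewrite powR_neq1.
have h1 : t - 1 != 0 by rewrite subr_eq0.
eapply der_eq.
  by rewrite /slope; derive_tac.
rewrite /logslope /slope !(powR_sub1_div _ t0) !(powR_sub1_div _ hD).
have := powR_mul_compl a t0; move: h1 h2 hD.
set Z := _ `^ (- _); set W := t `^ (1 - a - s).
move: (t `^ a) (t `^ (1 - a)) Z W (lt0r_neq0 t0) => X Y Z W t0' h1 h2 hD tE.
by field; rewrite a0 h1 h2 t0' gt_eqF.
Qed.

Lemma slope_mono s a t1 t2 : 0 < s < 1 -> a != 0 -> a != 1 -> 0 < t1 <= t2 ->
  (t2 < 1) || (1 < t1) ->
  (forall t, t1 <= t <= t2 -> 0 <= logslope s a t) -> slope s a t1 <= slope s a t2.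
Proof.
move=> si a0 a1 /andP[t0 t12] t1'.
have ok t : t1 <= t <= t2 -> 0 < t /\ t != 1.
  move=> /andP[h1 h2]; split; first exact: lt_le_trans h1.
  by case/orP: t1' => h; [rewrite lt_eqF|rewrite gt_eqF]; lra.
move=> hL; have okw t : t1 < t < t2 -> t1 <= t <= t2 by lra.
have Ds t : t1 <= t <= t2 -> der (slope s a) t (slope s a t * logslope s a t / t).
  by move=> /ok [? ?]; apply: der_slope.
apply: (@der_incr _ (slope s a) (fun t => slope s a t * logslope s a t / t) _ _ t12).
- apply: (der_within (df := fun t => slope s a t * logslope s a t / t)) => t.
  by rewrite in_itv /=; apply: Ds.
- by move=> t /okw; apply: Ds.
- move=> t /okw ti; have [h1 h2] := ok t ti.
  by rewrite divr_ge0 ?(ltW h1) // mulr_ge0 ?hL // ltW // slope_gt0.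
Qed.

Lemma slope_anti s a t1 t2 : 0 < s < 1 -> a != 0 -> a != 1 -> 0 < t1 <= t2 ->
  (t2 < 1) || (1 < t1) ->
  (forall t, t1 <= t <= t2 -> logslope s a t <= 0) -> slope s a t2 <= slope s a t1.
Proof.
move=> si a0 a1 /andP[t0 t12] t1'.
have ok t : t1 <= t <= t2 -> 0 < t /\ t != 1.
  move=> /andP[h1 h2]; split; first exact: lt_le_trans h1.
  by case/orP: t1' => h; [rewrite lt_eqF|rewrite gt_eqF]; lra.
move=> hL; have okw t : t1 < t < t2 -> t1 <= t <= t2 by lra.
have Ds t : t1 <= t <= t2 -> der (slope s a) t (slope s a t * logslope s a t / t).
  by move=> /ok [? ?]; apply: der_slope.
rewrite -lerN2.
apply: (@der_incr _ (fun t => - slope s a t)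
  (fun t => - (slope s a t * logslope s a t / t)) _ _ t12).
- apply: withinN.
  apply: (der_within (df := fun t => slope s a t * logslope s a t / t)) => t.
  by rewrite in_itv /=; apply: Ds.
- by move=> t /okw ti; apply: derN; apply: Ds.
- move=> t /okw ti; have [h1 h2] := ok t ti.
  rewrite -mulNr divr_ge0 ?(ltW h1) // -mulrN mulr_ge0 ?oppr_ge0 ?hL //.
  by rewrite ltW // slope_gt0.
Qed.

End Slope.

(** * Behaviour of the slope at the far ends *)

Section SlopeAsymptotics.
Variable R : realType.
Implicit Types a s t w p : R.

(** The bound [2 <= t1] is kept for crude estimates such as [t / 2 <= t - 1]. *)
Lemma powR_unbounded p w : 0 < p -> exists2 t1, 2 <= t1 & forall t, t1 <= t -> w <= t `^ p.
Proof.
move=> p0; exists (2 + `|w| `^ p^-1) => [|t tt]; first by rewrite lerDl powR_ge0.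
apply: (le_trans (ler_norm w)).
have -> : `|w| = (`|w| `^ p^-1) `^ p.
  by rewrite -powRrM mulVf ?gt_eqF // powRr1.
have h : `|w| `^ p^-1 <= t by apply: le_trans tt; rewrite lerDr.
apply: ge0_ler_powR => //; rewrite ?nnegrE ?powR_ge0 ?(ltW p0) //.
by apply: le_trans h; rewrite powR_ge0.
Qed.

(** The last factor of [slope] has a positive exponent and a base at least [s], and
    [(t - 1) / (t^(1 - a) - 1)] is at least [(t / 2) / t^(1 - a)]; so the slope is at least
    [c t^(1 - s)]. *)
Lemma slope_oo_neg s a w : 0 < s < 1 -> a < 0 ->
  exists2 t1, 1 < t1 & forall t, t1 <= t -> w <= slope s a t.
Proof.
move=> si a0; pose c := (1 - a) / 2 * s `^ (- ((1 - a) / a)).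
have e0 : 0 < - ((1 - a) / a).
  by rewrite -mulrN -invrN divr_gt0 //; lra.
have c0 : 0 < c by rewrite mulr_gt0 ?powR_gt0 //; lra.
have [|t1 t12 ht] := @powR_unbounded (1 - s) (w / c); first by lra.
exists t1; first by lra.
move=> t tt; have t0 : 0 < t by lra.
apply: (@le_trans _ _ (c * t `^ (1 - s))).
  by rewrite mulrC -ler_pdivrMr // ht.
have Y1 : 1 < t `^ (1 - a) by apply: powR_gt1; lra.
have Y0 := powR_gt0 (1 - a) t0.
rewrite /slope [X in X <= _]mulrC /c mulrA.
apply: ler_pM; rewrite ?powR_ge0 //.
- by rewrite mulr_ge0 ?powR_ge0 //; lra.
- have -> : t `^ (1 - s) * ((1 - a) / 2) =
      t `^ (1 - a - s) * ((1 - a) * (t / 2 / t `^ (1 - a))).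
    have -> : t `^ (1 - a - s) = t `^ (1 - a) * t `^ (- s) by rewrite powR_split.
    have -> : t `^ (1 - s) = t * t `^ (- s) by rewrite powR_split // powRr1 // ltW.
    by field; rewrite gt_eqF.
  rewrite ler_pM2l ?powR_gt0 // ler_pM2l; last by lra.
  apply: ler_pM; rewrite ?invr_ge0 ?(ltW Y0) //; [lra|lra|].
  by rewrite lef_pV2 ?posrE //; lra.
- apply: ge0_ler_powR; rewrite ?nnegrE ?(ltW e0) //; first by lra.
    by rewrite ltW // logslope_den_gt0.
  by rewrite lerDr mulr_ge0 ?powR_ge0 //; lra.
Qed.

(** The slope dominates a multiple of [t^(1 - a - s)] if [a < 1], where the exponent is negative
    because [a > 1 - s], and of [t^(- s)] if [a > 1], where [t^(1 - a)] blows up in the denominator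
    too. *)
Lemma slope_0_oo s a w : 0 < s < 1 -> 1 - s < a -> a != 1 ->
  exists2 t1, 0 < t1 < 1 & forall t, 0 < t <= t1 -> w <= slope s a t.
Proof.
move=> si sa a1.
suff [c [p [c0 p0 hc]]] : exists c p, [/\ 0 < c, 0 < p &
    forall t, 0 < t <= 2^-1 -> c * t^-1 `^ p <= slope s a t].
  have [t1 t12 ht] := @powR_unbounded p (w / c) p0.
  exists t1^-1; first by rewrite invr_gt0 invf_lt1; lra.
  move=> t /andP[t0 tt]; have t10 : 0 < t1 by lra.
  have tt' : t1 <= t^-1 by rewrite -[t1]invrK lef_pV2 ?posrE ?invr_gt0.
  apply: le_trans (hc t _); first by rewrite mulrC -ler_pdivrMr // ht.
  rewrite t0 (le_trans tt) // lef_pV2 ?posrE //; lra.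
have [a1'|a1'] : a < 1 \/ 1 < a by case: (ltgtP a 1) a1 => // *; [left|right].
(* For [t <= 1/2] the quotient [(1 - t) / (1 - t^(1 - a))] is at least [1/2], and the last factor of
   [slope] is at least [1]. *)
- exists ((1 - a) / 2), (s - (1 - a)); split; [lra|lra|].
  move=> t /andP[t0 t2]; rewrite powRV // -powRN opprB.
  have Y1 : t `^ (1 - a) < 1.
    have : 1 < t^-1 `^ (1 - a).
      by apply: powR_gt1; [rewrite invf_gt1 //; lra|lra].
    by rewrite powRV // invf_gt1 // powR_gt0.
  have Y0 := powR_gt0 (1 - a) t0.
  rewrite /slope [X in X <= _]mulrC -[X in X <= _]mulr1.
  apply: ler_pM; rewrite ?ler01 //.
  + by rewrite mulr_ge0 ?powR_ge0 //; lra.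
  + rewrite ler_pM2l ?powR_gt0 // ler_pM2l; last by lra.
    rewrite -[X in _ <= X]mulrNN -invrN !opprB.
    rewrite ler_pdivlMr; last by lra.
    by nra.
  + rewrite powRN -[X in X <= _]invr1.
    have hD := logslope_den_gt0 a t0 si.
    rewrite lef_pV2 ?posrE ?ltr01 ?powR_gt0 //.
    have one : 1 `^ ((1 - a) / a) = 1 :> R by rewrite powR1.
    rewrite -[leRHS]one.
    apply: ge0_ler_powR; rewrite ?nnegrE ?(ltW hD) ?ler01 //.
      by rewrite divr_ge0 //; lra.
    have : t `^ a <= 1.
      by rewrite -[leRHS](powRr0 t); apply: ger_powR; lra.
    have : 0 <= t `^ a by apply: powR_ge0.
    by nra.
(* Now [1/2] bounds [1 - t] from below, and the last factor has a positive exponent and a base at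
   least [s]. *)
- exists ((a - 1) / 2 * s `^ (- ((1 - a) / a))), s.
  have e0 : 0 < - ((1 - a) / a) by rewrite -mulNr divr_gt0; lra.
  split; [by rewrite mulr_gt0 ?powR_gt0 //; lra|lra|].
  move=> t /andP[t0 t2]; rewrite powRV // -powRN.
  have Y1 : 1 < t `^ (1 - a).
    have : 1 < t^-1 `^ (a - 1).
      by apply: powR_gt1; [rewrite invf_gt1 //; lra|lra].
    by rewrite powRV // -powRN opprB.
  rewrite /slope [X in X <= _]mulrC mulrA.
  apply: ler_pM; rewrite ?powR_ge0 //.
  + by rewrite mulr_ge0 ?powR_ge0 //; lra.
  + have -> : t `^ (1 - a - s) = t `^ (- s) * t `^ (1 - a).
      by rewrite addrC powR_split.
    rewrite -mulrA ler_pM2l ?powR_gt0 //.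
    have -> : t `^ (1 - a) * ((1 - a) * ((t - 1) / (t `^ (1 - a) - 1))) =
      t `^ (1 - a) * (1 - a) * (t - 1) / (t `^ (1 - a) - 1) by rewrite !mulrA.
    rewrite ler_pdivlMr; last by lra.
    have : 0 <= (a - 1) * t `^ (1 - a) * (2^-1 - t).
      by apply: mulr_ge0; [apply: mulr_ge0|]; lra.
    by lra.
  + apply: ge0_ler_powR; rewrite ?nnegrE ?(ltW e0) //; first by lra.
      by rewrite ltW // logslope_den_gt0.
    by rewrite lerDr mulr_ge0 ?powR_ge0 //; lra.
Qed.

(** As soon as [t^(1 - a) >= 2], the slope is at most [c t^(a - s)]: dropping [s] from the base of
    the last factor, whose exponent is negative, leaves a multiple of [t^(a - 1)]. *)
Lemma slope_oo_0 s a w : 0 < s < 1 -> 0 < a < s -> 0 < w ->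
  exists2 t1, 1 < t1 & forall t, t1 <= t -> slope s a t <= w.
Proof.
move=> si ai w0; pose c := 2 * (1 - a) * (1 - s) `^ (- ((1 - a) / a)).
have c0 : 0 < c by rewrite !mulr_gt0 ?powR_gt0 //; lra.
have [|t1 t12 ht] := @powR_unbounded (s - a) (c / w); first by lra.
have [|t2 t22 ht2] := @powR_unbounded (1 - a) 2; first by lra.
exists (Num.max t1 t2); first by rewrite lt_max; apply/orP; left; lra.
move=> t; rewrite ge_max => /andP[tt1 tt2]; have t0 : 0 < t by lra.
have h := ht t tt1; have Y2 := ht2 t tt2.
have P0 := powR_gt0 (s - a) t0.
apply: (@le_trans _ _ (c / t `^ (s - a))); last first.
  by rewrite ler_pdivrMr // mulrC -ler_pdivrMr.
rewrite -powRN opprB.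
have -> : c * t `^ (a - s) = (t `^ (1 - a - s) * ((1 - a) * (t / (t `^ (1 - a) / 2))))
   * ((1 - s) * t `^ a) `^ (- ((1 - a) / a)).
  have s1 : 0 <= 1 - s by lra.
  rewrite powRM ?powR_ge0 // -powRrM.
  have -> : a * - ((1 - a) / a) = - (1 - a) by field; lra.
  have -> : a - s = (1 - a - s) + 1 - (1 - a) - (1 - a) by ring.
  rewrite /c !(powR_split _ _ t0) !powRN !(powR_split _ _ t0) powRr1 ?(ltW t0) // !powRN.
  by field; rewrite !gt_eqF ?powR_gt0 //; lra.
have hD := logslope_den_gt0 a t0 si.
have D0 : 0 < (1 - s) * t `^ a by rewrite mulr_gt0 ?powR_gt0 //; lra.
apply: ler_pM; rewrite ?powR_ge0 //.
- rewrite mulr_ge0 ?powR_ge0 // mulr_ge0 //; first by lra.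
  by rewrite divr_ge0 //; lra.
- rewrite ler_pM2l ?powR_gt0 // ler_pM2l; last by lra.
  apply: ler_pM; [lra|rewrite invr_ge0; lra|lra|].
  by rewrite lef_pV2 ?posrE; lra.
- rewrite !powRN lef_pV2 ?posrE ?powR_gt0 //.
  apply: ge0_ler_powR; rewrite ?nnegrE ?(ltW hD) ?(ltW D0) //.
    by rewrite divr_ge0 //; lra.
  by rewrite lerDl; lra.
Qed.

End SlopeAsymptotics.

(** * The family [(x, ..., x, 1 - (n - 1) x)] *)

Section OneVariable.
Variables (R : realType) (n : nat) (a : R).
Hypotheses (hn : (2 < n)%N) (a0 : a != 0) (a1 : a != 1).
Implicit Types x t : R.

Local Notation N := (n%:R : R).
Local Notation s := (N^-1).
Local Notation m := (N - 1).
Local Notation y x := (1 - m * x).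

Lemma natr_gt2 : 2 < N.
Proof. by rewrite ltr_nat. Qed.

Lemma invn_itv : 0 < s < 2^-1.
Proof.
have := natr_gt2 => h; rewrite invr_gt0 ltf_pV2 ?posrE //; lra.
Qed.

Let N2 := natr_gt2.
Let si := invn_itv.
Let si1 : 0 < s < 1. Proof. by move: si; lra. Qed.
Let msE : m * s = 1 - s.
Proof. by rewrite mulrBl mul1r divff // gt_eqF //; move: N2; lra. Qed.

Lemma compl_gt0 x : x < m^-1 -> 0 < y x.
Proof.
move=> h; have m0 : 0 < m by move: N2; lra.
by rewrite subr_gt0 mulrC -ltr_pdivlMr // div1r.
Qed.

Lemma invm_gt : s < m^-1.
Proof. by rewrite ltf_pV2 ?posrE; move: N2; lra. Qed.

(* [ratio x] is the quotient of the two entries of [(x, ..., x, 1 - (n - 1) x)]. *)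
Definition ratio x := x / y x.
(** The inverse of [ratio]; it carries thresholds found for [t] back to [x]. *)
Definition unratio t := t / (1 + m * t).

Lemma unratio_itv t : 0 < t -> 0 < unratio t < m^-1.
Proof.
move=> t0; have m0 : 0 < m by move: N2; lra.
have h : 0 < 1 + m * t by rewrite addr_gt0 // mulr_gt0.
rewrite divr_gt0 //= /unratio ltr_pdivrMr // mulrC ltr_pdivlMr //; lra.
Qed.

Lemma ratio_gt0 x : 0 < x < m^-1 -> 0 < ratio x.
Proof. by move=> /andP[x0 /compl_gt0 y0]; rewrite divr_gt0. Qed.

Lemma ratio_le x t : x < m^-1 -> 0 < t -> (ratio x <= t) = (x <= unratio t).
Proof.
move=> /compl_gt0 y0 t0; have m0 : 0 < m by move: N2; lra.
have h : 0 < 1 + m * t by rewrite addr_gt0 // mulr_gt0.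
rewrite ler_pdivrMr // ler_pdivlMr // -subr_ge0 -[in RHS]subr_ge0.
by congr (0 <= _); ring.
Qed.

Lemma ratio_ge x t : x < m^-1 -> 0 < t -> (t <= ratio x) = (unratio t <= x).
Proof.
move=> /compl_gt0 y0 t0; have m0 : 0 < m by move: N2; lra.
have h : 0 < 1 + m * t by rewrite addr_gt0 // mulr_gt0.
rewrite ler_pdivlMr // ler_pdivrMr // -subr_ge0 -[in RHS]subr_ge0.
by congr (0 <= _); ring.
Qed.

Lemma ratio_lt x t : x < m^-1 -> 0 < t -> (ratio x < t) = (x < unratio t).
Proof. by move=> *; rewrite !ltNge ratio_ge. Qed.

Lemma ratio_gt x t : x < m^-1 -> 0 < t -> (t < ratio x) = (unratio t < x).
Proof. by move=> *; rewrite !ltNge ratio_le. Qed.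

Lemma unratio1 : unratio 1 = s.
Proof. by rewrite /unratio mulr1 addrCA subrr addr0 div1r. Qed.

Lemma ratio_mono x1 x2 : x1 < m^-1 -> x2 < m^-1 -> x1 <= x2 -> ratio x1 <= ratio x2.
Proof.
move=> h1 h2 h; rewrite /ratio ler_pdivrMr ?compl_gt0 // mulrAC.
rewrite ler_pdivlMr ?compl_gt0 // -subr_ge0.
have -> : x2 * (1 - m * x1) - x1 * (1 - m * x2) = x2 - x1 by ring.
by rewrite subr_ge0.
Qed.

Definition den x := (1 - s) * ratio x `^ a + s.

Lemma g_funE x : 0 < x < m^-1 -> g_fun n x = y x * ratio x `^ (1 - s).
Proof.
move=> xi; have /andP[x0 /compl_gt0 y0] := xi; have t0 := ratio_gt0 xi.
have xE : x = ratio x * y x by rewrite divfK // gt_eqF.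
rewrite /g_fun {1}xE exprMn -mulrA -exprSr prednK ?(ltn_trans _ hn) //.
rewrite powRM ?exprn_ge0 ?(ltW y0) ?(ltW t0) // mulrC.
rewrite -!powR_mulrn ?(ltW y0) ?(ltW t0) // -!powRrM.
rewrite mulfV ?powRr1 ?(ltW y0) //; last by rewrite gt_eqF //; move: N2; lra.
by rewrite -subn1 natrB ?(ltn_trans _ hn) // msE.
Qed.

Lemma p_funE x : 0 < x < m^-1 -> p_fun n a^-1 x = y x * den x `^ a^-1.
Proof.
move=> xi; have /andP[x0 xm] := xi; have y0 := compl_gt0 xm.
have t0 := ratio_gt0 xi.
have xE : x = ratio x * y x by rewrite divfK // gt_eqF.
rewrite /p_fun (gt_eqF x0) (lt_eqF xm) andbF invrK {1}xE.
rewrite powRM ?(ltW y0) ?(ltW t0) //.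
have -> : (m * (ratio x `^ a * y x `^ a) + y x `^ a) / N = y x `^ a * den x.
  by rewrite /den -msE; ring.
rewrite powRM ?powR_ge0 ?ltW ?logslope_den_gt0 // -powRrM divff // powRr1 //.
exact: ltW.
Qed.

Definition gapG x := s - g_fun n x.
(** The power mean is below [1 / n] for [a < 1] and above it for [a > 1]; the division makes the gap
    positive off the center in both cases. *)
Definition gapP x := (s - p_fun n a^-1 x) / (1 - a).
Definition dgapP x := (1 - s) * den x `^ ((1 - a) / a) *
  ((ratio x `^ (1 - a) - 1) / (ratio x `^ (1 - a) * (1 - a))).

Lemma der_open (f g : R -> R) l u x d : l < x < u -> (forall z, l < z < u -> f z = g z) ->
  der g x d -> der f x d.
Proof.
move=> xi fg; apply: near_eq_is_derive.
have : x \in `]l, u[%R by rewrite in_itv.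
by move=> /near_in_itvoo; apply: filterS => z; rewrite in_itv /= => /fg.
Qed.

Let b0 : 1 - a != 0. Proof. by rewrite subr_eq0 eq_sym. Qed.

Lemma der_gapP x : 0 < x < m^-1 -> der gapP x (dgapP x).
Proof.
move=> xi; have /andP[x0 xm] := xi; have y0 := compl_gt0 xm.
have t0 := ratio_gt0 xi; have hD : 0 < den x by apply: logslope_den_gt0.
apply: (der_open xi (g := fun x => (s - y x * den x `^ a^-1) / (1 - a))).
  by move=> z zi; rewrite /gapP p_funE.
eapply der_eq.
  rewrite /den /ratio; derive_tac => //.
  by rewrite gt_eqF.
rewrite -/(ratio x) -/(den x) /dgapP.
have -> : (1 - a) / a = a^-1 - 1 by field.
rewrite !powR_sub1_div //.
have -> : ratio x `^ (1 - a) = ratio x / ratio x `^ a.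
  by rewrite powR_split // powRr1 ?(ltW t0) // powRN.
have X0 := powR_gt0 a t0; have E0 := powR_gt0 a^-1 hD.
have tE : ratio x = x / y x by [].
have DE : den x = (1 - s) * ratio x `^ a + s by [].
move: (den x `^ a^-1) E0 => E E0.
move: hD; rewrite DE; move: X0; move: (ratio x `^ a) => X X0 hD.
rewrite tE.
have hs : N != 0 by rewrite gt_eqF //; move: N2; lra.
have hD' : (n%:R - 1) * X + 1 != 0.
  by rewrite gt_eqF // addr_gt0 // mulr_gt0 //; move: N2; lra.
by field; rewrite hD' hs a0 b0 !gt_eqF.
Qed.

Lemma slope_dgapP x : 0 < x < m^-1 -> x != s ->
  slope s a (ratio x) * dgapP x = (1 - s) * (ratio x `^ (1 - s) / ratio x) * (ratio x - 1).
Proof.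
move=> xi xs; have /andP[x0 xm] := xi; have t0 := ratio_gt0 xi.
have hD : 0 < den x by apply: logslope_den_gt0.
have t1 : ratio x != 1.
  by rewrite eq_le ratio_le // ratio_ge // unratio1 -eq_le.
rewrite /slope /dgapP -/(den x) powRN.
have -> : ratio x `^ (1 - a - s) = ratio x `^ (1 - a) / ratio x `^ s.
  by rewrite powR_split // powRN.
have -> : ratio x `^ (1 - s) = ratio x / ratio x `^ s.
  by rewrite powR_split // powRr1 ?(ltW t0) // powRN.
have h2 : ratio x `^ (1 - a) - 1 != 0 by rewrite powR_neq1.
have E0 := powR_gt0 ((1 - a) / a) hD.
have Y0 := powR_gt0 (1 - a) t0; have S0 := powR_gt0 s t0.
move: (den x `^ _) (ratio x `^ (1 - a)) (ratio x `^ s) E0 Y0 S0 h2 => E Y S E0 Y0 S0 h2.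
have hs : n%:R != 0 :> R by rewrite gt_eqF //; move: N2; lra.
by field; rewrite hs h2 b0 !gt_eqF.
Qed.

(** Stated without [slope], which degenerates at [t = 1], so that it holds at the center as well. *)
Lemma der_gapG x : 0 < x < m^-1 ->
  der gapG x ((1 - s) * (ratio x `^ (1 - s) / ratio x) * (ratio x - 1)).
Proof.
move=> xi; have /andP[x0 xm] := xi; have y0 := compl_gt0 xm.
have t0 := ratio_gt0 xi.
apply: (der_open xi (g := fun x => s - y x * ratio x `^ (1 - s))).
  by move=> z zi; rewrite /gapG g_funE.
eapply der_eq.
  rewrite /ratio; derive_tac => //.
  by rewrite gt_eqF.
rewrite -/(ratio x) !powR_sub1_div //.
have tE : ratio x = x / y x by [].
have E0 := powR_gt0 (1 - s) t0.
move: (ratio x `^ _) E0 => E E0; rewrite tE.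
have hs : n%:R != 0 :> R by rewrite gt_eqF //; move: N2; lra.
by field; rewrite hs !gt_eqF.
Qed.

Lemma der_gapG_slope x : 0 < x < m^-1 -> x != s ->
  der gapG x (slope s a (ratio x) * dgapP x).
Proof. by move=> xi xs; rewrite slope_dgapP //; apply: der_gapG. Qed.

Lemma dgapP_gt0 x : s < x < m^-1 -> 0 < dgapP x.
Proof.
move=> /andP[sx xm]; have x0 : 0 < x by move: si1; lra.
have xi : 0 < x < m^-1 by rewrite x0.
have t0 := ratio_gt0 xi; have hD : 0 < den x by apply: logslope_den_gt0.
have t1 : 1 < ratio x by rewrite ratio_gt // unratio1.
apply: mulr_gt0; first by rewrite mulr_gt0 ?powR_gt0 //; move: si1; lra.
have := mul_powR_sub1_gt0 t0 (negbT (gt_eqF t1)) b0.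
have Y0 := powR_gt0 (1 - a) t0.
have c0 : 0 < (ratio x - 1) * (1 - a) ^+ 2 * ratio x `^ (1 - a).
  apply: mulr_gt0 => //; apply: mulr_gt0; first by rewrite subr_gt0.
  by rewrite exprn_even_gt0.
have -> : (1 - a) * ((ratio x - 1) * (ratio x `^ (1 - a) - 1)) =
  (ratio x `^ (1 - a) - 1) / (ratio x `^ (1 - a) * (1 - a)) *
   ((ratio x - 1) * (1 - a) ^+ 2 * ratio x `^ (1 - a)).
  by field; rewrite b0 gt_eqF.
by rewrite (pmulr_lgt0 _ c0).
Qed.

Lemma dgapP_lt0 x : 0 < x < s -> dgapP x < 0.
Proof.
move=> /andP[x0 sx]; have xm : x < m^-1 by apply: lt_trans sx invm_gt.
have xi : 0 < x < m^-1 by rewrite x0.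
have t0 := ratio_gt0 xi; have hD : 0 < den x by apply: logslope_den_gt0.
have t1 : ratio x < 1 by rewrite ratio_lt // unratio1.
rewrite /dgapP pmulr_rlt0; last first.
  by rewrite mulr_gt0 ?powR_gt0 //; move: si1; lra.
have := mul_powR_sub1_gt0 t0 (negbT (lt_eqF t1)) b0.
have Y0 := powR_gt0 (1 - a) t0.
have c0 : (ratio x - 1) * ((1 - a) ^+ 2 * ratio x `^ (1 - a)) < 0.
  rewrite nmulr_rlt0 ?subr_lt0 //; apply: mulr_gt0 => //.
  by rewrite exprn_even_gt0.
have -> : (1 - a) * ((ratio x - 1) * (ratio x `^ (1 - a) - 1)) =
  (ratio x `^ (1 - a) - 1) / (ratio x `^ (1 - a) * (1 - a)) *
   ((ratio x - 1) * ((1 - a) ^+ 2 * ratio x `^ (1 - a))).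
  by field; rewrite b0 gt_eqF.
by rewrite (nmulr_lgt0 _ c0).
Qed.

Let cs : 0 < s < m^-1. Proof. by rewrite invm_gt; move: si; lra. Qed.
Let ratios : ratio s = 1.
Proof.
by apply/eqP; rewrite eq_le ratio_le // ?ratio_ge // ?unratio1 ?lexx // invm_gt.
Qed.

Lemma gapG_center : gapG s = 0.
Proof.
rewrite /gapG g_funE // ratios powR1 mulr1 msE; ring.
Qed.

Lemma gapP_center : gapP s = 0.
Proof.
rewrite /gapP p_funE // /den ratios powR1 mulr1 subrK powR1 mulr1 msE.
by rewrite (_ : s - _ = 0) ?mul0r //; ring.
Qed.

Lemma gap_within (l u : R) : 0 < l -> u < m^-1 ->
  {within `[l, u], continuous gapG} /\ {within `[l, u], continuous gapP}.
Proof.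
move=> l0 um; split.
  apply: (der_within (df := fun x => (1 - s) * (ratio x `^ (1 - s) / ratio x) * (ratio x - 1))) => z.
  by rewrite in_itv /= => /andP[lz zu]; apply: der_gapG; rewrite (lt_le_trans l0 lz) (le_lt_trans zu um).
apply: (der_within (df := dgapP)) => z.
by rewrite in_itv /= => /andP[lz zu]; apply: der_gapP; rewrite (lt_le_trans l0 lz) (le_lt_trans zu um).
Qed.

Lemma gap_incr_right x1 x2 : s <= x1 -> x1 < x2 -> x2 < m^-1 ->
  gapG x1 < gapG x2 /\ gapP x1 < gapP x2.
Proof.
move=> sx1 x12 x2m; have s0 : 0 < s by move: si; lra.
have [cG cP] := gap_within (lt_le_trans s0 sx1) x2m.
have ok z : x1 < z < x2 -> s < z < m^-1 /\ 0 < z < m^-1.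
  by move=> /andP[h1 h2]; rewrite (le_lt_trans sx1 h1) (lt_trans h2 x2m) (lt_trans s0 (le_lt_trans sx1 h1)).
split.
  apply: (der_sincr (df := fun x => (1 - s) * (ratio x `^ (1 - s) / ratio x) * (ratio x - 1)) x12 cG).
    by move=> z /ok [_ zi]; apply: der_gapG.
  move=> z /ok [/andP[sz zm] zi]; have t0 := ratio_gt0 zi.
  have t1 : 1 < ratio z by rewrite ratio_gt // unratio1.
  have c0 : 0 < 1 - s by move: si1; lra.
  apply: mulr_gt0; last by rewrite subr_gt0.
  by apply: mulr_gt0 => //; apply: divr_gt0; rewrite ?powR_gt0.
apply: (der_sincr x12 cP).
  by move=> z /ok [_ zi]; apply: der_gapP.
by move=> z /ok [zi _]; apply: dgapP_gt0.
Qed.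

Lemma gap_decr_left x1 x2 : 0 < x1 -> x1 < x2 -> x2 <= s ->
  gapG x2 < gapG x1 /\ gapP x2 < gapP x1.
Proof.
move=> x10 x12 x2s; have [s0 sm] := andP cs.
have [cG cP] := gap_within x10 (le_lt_trans x2s sm).
have ok z : x1 < z < x2 -> 0 < z < s /\ 0 < z < m^-1.
  by move=> /andP[h1 h2]; rewrite (lt_trans x10 h1) (lt_le_trans h2 x2s) (lt_trans (lt_le_trans h2 x2s) sm).
split.
  rewrite -ltrN2; apply: (der_sincr (f := fun z => - gapG z)
    (df := fun x => - ((1 - s) * (ratio x `^ (1 - s) / ratio x) * (ratio x - 1))) x12 (withinN cG)).
    by move=> z /ok [_ zi]; apply: derN; apply: der_gapG.
  move=> z /ok [/andP[z0 zs] zi]; have t0 := ratio_gt0 zi.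
  have t1 : ratio z < 1 by rewrite ratio_lt ?unratio1 //; apply: lt_trans sm.
  have c0 : 0 < 1 - s by move: si1; lra.
  rewrite -mulrN; apply: mulr_gt0; last by rewrite oppr_gt0 subr_lt0.
  by apply: mulr_gt0 => //; apply: divr_gt0; rewrite ?powR_gt0.
rewrite -ltrN2; apply: (der_sincr (f := fun z => - gapP z) (df := fun z => - dgapP z) x12 (withinN cP)).
  by move=> z /ok [_ zi]; apply: derN; apply: der_gapP.
by move=> z /ok [zi _]; rewrite oppr_gt0; apply: dgapP_lt0.
Qed.

Lemma der_reflect (f : R -> R) x d : der f (- x) d -> der (fun z => f (- z)) x (- d).
Proof.
move=> df; have := der_comp (g := fun z => - z) df (derN (der_id x)).
by move/der_eq; apply; rewrite mulrN1.
Qed.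

Lemma within_ext (f g : R -> R) (l u : R) : (forall z, l <= z <= u -> f z = g z) ->
  {within `[l, u], continuous f} -> {within `[l, u], continuous g}.
Proof.
move=> fg; apply: (@subspace_eq_continuous R [set` `[l, u]] R f g) => z.
by rewrite inE /= in_itv /=; apply: fg.
Qed.

Lemma gap_within_closed (l u : R) : 0 <= l -> u <= m^-1 -> 0 < a ->
  {within `[l, u], continuous gapG} /\ {within `[l, u], continuous gapP}.
Proof.
move=> l0 um apos; have m0 : 0 < m by move: N2; lra.
have [s0 _] := andP si; have r0 : 0 < a^-1 by rewrite invr_gt0.
have yge x : x <= u -> 0 <= y x.
  move=> xu; rewrite subr_ge0 mulrC -ler_pdivlMr // div1r.
  exact: le_trans um.
have ycont : continuous (fun x : R => y x).
  move=> x; have : exists d, der (fun x => y x) x d by eexists; derive_tac.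
  by case=> d /der_cvg.
split.
  (* With absolute values the formulas of both gaps are continuous on the whole line, and they are
     unchanged where both entries are nonnegative. *)
  have : continuous (fun x : R => s - `|x ^+ n.-1 * y x| `^ s).
    move=> x; apply: cvgB; first exact: cvg_cst.
    apply: (@continuous_comp _ _ _ (fun x => x ^+ n.-1 * y x) (fun z : R => `|z| `^ s)).
      by apply: cvgM; [exact: exprn_continuous|exact: ycont].
    exact: normr_powR_continuous.
  move=> /continuous_subspaceT => /(_ [set` `[l, u]]).
  apply: within_ext => x /andP[lx xu].
  rewrite /gapG /g_fun /= ger0_norm // mulr_ge0 ?exprn_ge0 ?yge //.
  exact: le_trans lx.
have : continuous (fun x : R =>
    (s - `|(m * `|x| `^ a + `|y x| `^ a) / N| `^ a^-1) / (1 - a)).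
  move=> x; apply: cvgM; last exact: cvg_cst.
  apply: cvgB; first exact: cvg_cst.
  apply: (@continuous_comp _ _ _ (fun x : R => (m * `|x| `^ a + `|y x| `^ a) / N)
     (fun z : R => `|z| `^ a^-1)); last exact: normr_powR_continuous.
  apply: cvgM; last exact: cvg_cst.
  apply: cvgD; first by apply: cvgM; [exact: cvg_cst|exact: normr_powR_continuous].
  apply: (@continuous_comp _ _ _ (fun x : R => y x) (fun z : R => `|z| `^ a)).
    exact: ycont.
  exact: normr_powR_continuous.
move=> /continuous_subspaceT => /(_ [set` `[l, u]]).
apply: within_ext => x /andP[lx xu].
rewrite /gapP /p_fun /= ltNge (ltW r0) /= invrK.
have x0 : 0 <= x by apply: le_trans lx.
rewrite (ger0_norm x0) (ger0_norm (yge x xu)) ger0_norm //.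
apply: divr_ge0; last by move: N2; lra.
by rewrite addr_ge0 ?mulr_ge0 ?powR_ge0 // ltW.
Qed.

(** At these orders [logslope] is nonnegative for every [t > 1], so [slope] increases up to the end
    and the monotone rule applies to the whole side. *)
Lemma gap_end_right x : (1 < a) || (s <= a < 1) -> s < x < m^-1 ->
  gapG x * gapP m^-1 <= gapG m^-1 * gapP x.
Proof.
move=> ha xi; have [s0 sm] := andP cs.
have apos : 0 < a.
  by case/orP: ha => [|/andP[h _]]; [lra|apply: lt_le_trans h].
have [cG cP] := gap_within_closed (ltW s0) (lexx _) apos.
apply: (@slope_ratio_mono _ gapG gapP dgapP (fun x => slope s a (ratio x)) s m^-1 x xi cG cP).
- move=> z /andP[sz zm]; apply: der_gapG_slope; last by rewrite gt_eqF.
  by rewrite zm (lt_trans s0 sz).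
- by move=> z /andP[sz zm]; apply: der_gapP; rewrite zm (lt_trans s0 sz).
- exact: dgapP_gt0.
- exact: gapG_center.
- exact: gapP_center.
- move=> y1 y2 sy1 y12 y2m; have y1m := le_lt_trans y12 y2m.
  have t1 : 1 < ratio y1 by rewrite ratio_gt // unratio1.
  apply: slope_mono => //.
  + by rewrite ratio_mono // (lt_trans ltr01 t1).
  + by rewrite t1 orbT.
  + move=> t /andP[h1 _]; have tgt1 := lt_le_trans t1 h1.
    have hs : 0 < s <= 2^-1 by move: si; lra.
    case/orP: ha => [a1'|/andP[sa a1']]; first exact: logslope_ge0_right_gt1.
    by apply: logslope_ge0_right => //; rewrite apos.
Qed.

Lemma gap_end_left x : 0 < a <= 1 - s -> 0 < x < s ->
  gapG 0 * gapP x <= gapG x * gapP 0.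
Proof.
move=> /andP[apos ha] /andP[x0 xs]; have [s0 sm] := andP cs.
have [cG cP] := gap_within_closed (lexx 0) (ltW sm) apos.
have xi : - s < - x < 0 by rewrite ltrN2 xs oppr_lt0.
have ok z : - s < z < 0 -> 0 < - z < s.
  by move=> /andP[h1 h2]; rewrite oppr_gt0 h2 ltrNl h1.
have okm z : 0 < z < s -> 0 < z < m^-1.
  by move=> /andP[-> h]; rewrite (lt_trans h sm).
(* The rule measures from the left end of an interval, so the line is reflected to start at [1 / n].
   In that direction the slope decreases, hence the sign on [gapG]. *)
have := @slope_ratio_mono _ (fun z => - gapG (- z)) (fun z => gapP (- z))
  (fun z => - dgapP (- z)) (fun z => - slope s a (ratio (- z))) (- s) 0 (- x) xi.
rewrite !opprK oppr0 !mulNr lerN2; apply.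
- by apply: withinN; apply: within_continuous_compN; rewrite oppr0 opprK.
- by apply: within_continuous_compN; rewrite oppr0 opprK.
- move=> z /ok zi; rewrite mulrNN.
  have := der_gapG_slope (okm _ zi) (negbT (lt_eqF (andP zi).2)).
  by move=> /der_reflect /derN /der_eq; apply; rewrite opprK.
- by move=> z /ok /okm zi; apply: der_reflect; apply: der_gapP.
- by move=> z /ok zi; rewrite oppr_gt0 dgapP_lt0.
- by rewrite gapG_center oppr0.
- exact: gapP_center.
- move=> y1 y2 sy1 y12 y20; rewrite lerN2.
  have i1 : 0 < - y1 < s by apply: ok; rewrite sy1 (le_lt_trans y12 y20).
  have i2 : 0 < - y2 < s by apply: ok; rewrite y20 (lt_le_trans sy1 y12).
  have t1 : ratio (- y1) < 1.
    by rewrite ratio_lt ?unratio1 ?(andP i1).2 //; apply: (andP (okm _ i1)).2.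
  have t2 := ratio_gt0 (okm _ i2).
  apply: slope_mono => //.
  + rewrite t2 ratio_mono ?lerN2 //.
      by case/andP: (okm _ i2).
    by case/andP: (okm _ i1).
  + by rewrite t1.
  + move=> t /andP[h1 h2]; apply: logslope_ge0_left => //.
      by rewrite (lt_le_trans t2 h1) (le_lt_trans h2 t1).
    by move: si; lra.
Qed.

Lemma slope_anti_near_right : a < 0 ->
  exists2 x0, s < x0 < m^-1 & forall y1 y2, s < y1 -> y1 <= y2 -> y2 < x0 ->
    slope s a (ratio y2) <= slope s a (ratio y1).
Proof.
move=> an; have [d /andP[d0 _] hd] := logslope_near1 si a0 a1.
have d1 : 0 < 1 + d by lra.
have [s0 sm] := andP cs; have ui := unratio_itv d1.
exists (unratio (1 + d)) => [|y1 y2 sy1 y12 y2x].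
  by rewrite -ratio_lt // ratios ltrDl d0; case/andP: ui.
have y2m : y2 < m^-1 by case/andP: ui => _; apply: lt_trans.
have y1m := le_lt_trans y12 y2m.
have t1 : 1 < ratio y1 by rewrite ratio_gt // unratio1.
have t2 : ratio y2 < 1 + d by rewrite ratio_lt.
apply: slope_anti => //.
- by rewrite ratio_mono // (lt_trans ltr01 t1).
- by rewrite t1 orbT.
- move=> t /andP[h1 h2]; have tgt1 := lt_le_trans t1 h1.
  have := hd t; rewrite gtr0_norm ?subr_gt0 // ltrBlDl (le_lt_trans h2 t2).
  by rewrite gt_eqF // => /(_ isT isT); rewrite nmulr_rgt0 // => /ltW.
Qed.

Lemma slope_mono_near_right : 0 < a ->
  exists2 x0, s < x0 < m^-1 & forall y1 y2, s < y1 -> y1 <= y2 -> y2 < x0 ->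
    slope s a (ratio y1) <= slope s a (ratio y2).
Proof.
move=> an; have [d /andP[d0 _] hd] := logslope_near1 si a0 a1.
have d1 : 0 < 1 + d by lra.
have [s0 sm] := andP cs; have ui := unratio_itv d1.
exists (unratio (1 + d)) => [|y1 y2 sy1 y12 y2x].
  by rewrite -ratio_lt // ratios ltrDl d0; case/andP: ui.
have y2m : y2 < m^-1 by case/andP: ui => _; apply: lt_trans.
have y1m := le_lt_trans y12 y2m.
have t1 : 1 < ratio y1 by rewrite ratio_gt // unratio1.
have t2 : ratio y2 < 1 + d by rewrite ratio_lt.
apply: slope_mono => //.
- by rewrite ratio_mono // (lt_trans ltr01 t1).
- by rewrite t1 orbT.
- move=> t /andP[h1 h2]; have tgt1 := lt_le_trans t1 h1.
  have := hd t; rewrite gtr0_norm ?subr_gt0 // ltrBlDl (le_lt_trans h2 t2).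
  by rewrite gt_eqF // => /(_ isT isT); rewrite pmulr_rgt0 // => /ltW.
Qed.

Lemma slope_mono_near_left : 0 < a ->
  exists2 x0, 0 < x0 < s & forall y1 y2, x0 < y1 -> y1 <= y2 -> y2 < s ->
    slope s a (ratio y1) <= slope s a (ratio y2).
Proof.
move=> an; have [d /andP[d0 d1] hd] := logslope_near1 si a0 a1.
pose e := 1 - d / 2; have e0 : 0 < e by rewrite /e; lra.
have [s0 sm] := andP cs; have /andP[u0 um] := unratio_itv e0.
exists (unratio e) => [|y1 y2 xy1 y12 y2s].
  by rewrite u0 -ratio_gt // ratios /e; lra.
have y2m := lt_trans y2s sm.
have y1m := le_lt_trans y12 y2m.
have t1 : e < ratio y1 by rewrite ratio_gt.
have t2 : ratio y2 < 1 by rewrite ratio_lt ?unratio1.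
apply: slope_mono => //.
- by rewrite ratio_mono // (lt_trans e0 t1).
- by rewrite t2.
- move=> t /andP[h1 h2]; have tlt1 := le_lt_trans h2 t2.
  have : `|t - 1| < d.
    by rewrite ltr0_norm ?subr_lt0 // opprB; move: (lt_le_trans t1 h1); rewrite /e; lra.
  move=> /hd; rewrite lt_eqF // => /(_ isT).
  by rewrite pmulr_rgt0 // => /ltW.
Qed.

Lemma g_fun_ge0 x : 0 <= g_fun n x.
Proof. exact: powR_ge0. Qed.

Lemma p_fun_ge0 r x : 0 <= p_fun n r x.
Proof. by rewrite /p_fun; case: ifP => // _; apply: powR_ge0. Qed.

Lemma gapG_le x : gapG x <= s.
Proof. by rewrite /gapG gerBl g_fun_ge0. Qed.

Lemma ratio_min_right : a < 0 ->
  exists2 z, s < z < m^-1 & forall x, s < x < m^-1 -> gapG z / gapP z <= gapG x / gapP x.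
Proof.
move=> an; have [s0 sm] := andP cs.
have [x0 x0i h0] := slope_anti_near_right an.
(* [w] bounds the quotient from above beyond [x0]: there [gapG <= s] and [gapP >= gapP x0]. *)
pose w := s / gapP x0.
have V0 : 0 < gapP x0.
  by rewrite -gapP_center; case/andP: x0i => *; apply: (gap_incr_right _ _ _).2.
have [t1 t1gt ht] := @slope_oo_neg R s a w si1 an.
have t10 : 0 < t1 by lra.
pose x1 := Num.max x0 (unratio t1).
have x1i : s < x1 < m^-1.
  by rewrite lt_max gt_max; case/andP: x0i => -> ->; case/andP: (unratio_itv t10).
apply: (@slope_ratio_min _ gapG gapP dgapP (fun x => slope s a (ratio x)) s m^-1 x0 x1 w x0i x1i).
- by move=> z zm; apply: (gap_within s0 zm).1.
- by move=> z zm; apply: (gap_within s0 zm).2.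
- move=> z /andP[sz zm]; apply: der_gapG_slope; last by rewrite gt_eqF.
  by rewrite zm (lt_trans s0 sz).
- by move=> z /andP[sz zm]; apply: der_gapP; rewrite zm (lt_trans s0 sz).
- exact: dgapP_gt0.
- exact: gapG_center.
- exact: gapP_center.
- exact: h0.
- move=> z /andP[x1z zm]; apply: (le_trans (gapG_le z)).
  rewrite /w mulrAC (ler_pdivlMr _ _ V0) (ler_pM2l s0).
  have : x0 <= z by apply: le_trans x1z; rewrite le_max lexx.
  rewrite le_eqVlt => /predU1P[->|x0z]; [exact: lexx|apply: ltW].
  by apply: (gap_incr_right _ x0z zm).2; apply: ltW; case/andP: x0i.
- move=> z /andP[x1z zm]; apply: ht; rewrite ratio_ge //.
  by apply: le_trans x1z; rewrite le_max lexx orbT.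
Qed.

Lemma ratio_max_right : 0 < a < s ->
  exists2 z, s < z < m^-1 & forall x, s < x < m^-1 -> gapG x / gapP x <= gapG z / gapP z.
Proof.
move=> ai; have [s0 sm] := andP cs; have [apos alt] := andP ai.
have b0' : 0 < 1 - a by move: si; lra.
have [x0 x0i h0] := slope_mono_near_right apos.
have U0 : 0 < gapG x0.
  by rewrite -gapG_center; case/andP: x0i => *; apply: (gap_incr_right _ _ _).1.
(* [w] bounds the quotient from below beyond [x0]: there [gapG >= gapG x0], and
   [gapP <= s / (1 - a)] because [p >= 0]. *)
pose w := gapG x0 * (1 - a) / s.
have w0 : 0 < w by rewrite divr_gt0 // mulr_gt0.
have [t1 t1gt ht] := @slope_oo_0 R s a w si1 ai w0.
have t10 : 0 < t1 by lra.
pose x1 := Num.max x0 (unratio t1).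
have x1i : s < x1 < m^-1.
  by rewrite lt_max gt_max; case/andP: x0i => -> ->; case/andP: (unratio_itv t10).
suff [z zi hz] : exists2 z, s < z < m^-1 & forall x, s < x < m^-1 ->
    - gapG z / gapP z <= - gapG x / gapP x.
  exists z => [|x xi]; first exact: zi.
  by have := hz x xi; rewrite !mulNr lerN2; apply.
apply: (@slope_ratio_min _ (fun z => - gapG z) gapP dgapP
  (fun x => - slope s a (ratio x)) s m^-1 x0 x1 (- w) x0i x1i).
- by move=> z zm; apply: withinN; apply: (gap_within s0 zm).1.
- by move=> z zm; apply: (gap_within s0 zm).2.
- move=> z /andP[sz zm]; rewrite mulNr; apply: derN.
  apply: der_gapG_slope; last by rewrite gt_eqF.
  by rewrite zm (lt_trans s0 sz).
- by move=> z /andP[sz zm]; apply: der_gapP; rewrite zm (lt_trans s0 sz).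
- exact: dgapP_gt0.
- by rewrite gapG_center oppr0.
- exact: gapP_center.
- by move=> y1 y2 *; rewrite lerN2; apply: h0.
- move=> z /andP[x1z zm]; rewrite mulNr lerN2.
  have x0z : x0 <= z by apply: le_trans x1z; rewrite le_max lexx.
  apply: (@le_trans _ _ (gapG x0)).
    have -> : w * gapP z = gapG x0 * ((s - p_fun n a^-1 z) / s).
      by rewrite /w /gapP; field; rewrite b0 /= gt_eqF //; move: N2; lra.
    rewrite (ger_pMr _ U0) (ler_pdivrMr _ _ s0) mul1r gerBl.
    exact: p_fun_ge0.
  move: x0z; rewrite le_eqVlt => /predU1P[->|x0z]; [exact: lexx|apply: ltW].
  by apply: (gap_incr_right _ x0z zm).1; apply: ltW; case/andP: x0i.
- move=> z /andP[x1z zm]; rewrite lerN2; apply: ht; rewrite ratio_ge //.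
  by apply: le_trans x1z; rewrite le_max lexx orbT.
Qed.

Lemma ratio_min_left : 1 - s < a ->
  exists2 z, 0 < z < s & forall x, 0 < x < s -> gapG z / gapP z <= gapG x / gapP x.
Proof.
move=> sa; have [s0 sm] := andP cs.
have apos : 0 < a by move: si; lra.
have [x0 x0i h0] := slope_mono_near_left apos.
have [x00 x0s] := andP x0i.
pose w := s / gapP x0.
have V0 : 0 < gapP x0 by rewrite -gapP_center; apply: (gap_decr_left _ _ _).2.
have [t1 /andP[t10 t11] ht] := @slope_0_oo R s a w si1 sa a1.
pose x1 := Num.min x0 (unratio t1).
have x1i : 0 < x1 < s.
  by rewrite lt_min gt_min; case/andP: x0i => -> ->; case/andP: (unratio_itv t10) => ->.
have ok z : - s < z < 0 -> 0 < - z < s.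
  by move=> /andP[h1 h2]; rewrite oppr_gt0 h2 ltrNl h1.
have okm z : 0 < z < s -> 0 < z < m^-1.
  by move=> /andP[-> h]; rewrite (lt_trans h sm).
have oppi z : 0 < z < s -> - s < - z < 0.
  by move=> /andP[h1 h2]; rewrite ltrN2 h2 oppr_lt0.
suff [z zi hz] : exists2 z, - s < z < 0 & forall x, - s < x < 0 ->
    gapG (- z) / gapP (- z) <= gapG (- x) / gapP (- x).
  exists (- z) => [|x xi]; first exact: ok.
  by have := hz (- x) (oppi _ xi); rewrite opprK.
apply: (@slope_ratio_min _ (fun z => gapG (- z)) (fun z => gapP (- z)) (fun z => - dgapP (- z))
  (fun x => slope s a (ratio (- x))) (- s) 0 (- x0) (- x1) w (oppi _ x0i) (oppi _ x1i)).
- move=> z z0; apply: within_continuous_compN; rewrite opprK.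
  by apply: (gap_within _ sm).1; rewrite oppr_gt0.
- move=> z z0; apply: within_continuous_compN; rewrite opprK.
  by apply: (gap_within _ sm).2; rewrite oppr_gt0.
- move=> z /ok zi; rewrite mulrN.
  by apply: der_reflect; apply: der_gapG_slope (okm _ zi) (negbT (lt_eqF (andP zi).2)).
- by move=> z /ok /okm zi; apply: der_reflect; apply: der_gapP.
- by move=> z /ok zi; rewrite oppr_gt0 dgapP_lt0.
- by rewrite opprK gapG_center.
- by rewrite opprK gapP_center.
- move=> y1 y2 h1 h2 h3; apply: h0; rewrite ?lerN2 //.
    by rewrite ltrNr.
  by rewrite ltrNl.
- move=> z /andP[x1z z0]; apply: (le_trans (gapG_le _)).
  rewrite /w mulrAC (ler_pdivlMr _ _ V0) (ler_pM2l s0).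
  have zx1 : - z <= x1 by rewrite lerNl.
  have : - z <= x0 by apply: (le_trans zx1); rewrite ge_min lexx.
  rewrite le_eqVlt => /predU1P[->|zx0]; [exact: lexx|apply: ltW].
  by apply: (gap_decr_left _ zx0 (ltW x0s)).2; rewrite oppr_gt0.
- move=> z /andP[x1z z0]; have zx1 : - z <= x1 by rewrite lerNl.
  have zi : 0 < - z < s by rewrite oppr_gt0 z0 (le_lt_trans zx1) //; case/andP: x1i.
  apply: ht; rewrite ratio_gt0 ?okm // ratio_le //.
    by apply: (le_trans zx1); rewrite ge_min lexx orbT.
  by case/andP: (okm _ zi).
Qed.

Lemma gapP_gt0 x : 0 < x < m^-1 -> x != s -> 0 < gapP x.
Proof.
move=> /andP[x0 xm]; rewrite -[ltLHS]gapP_center neq_lt => /orP[xs|sx].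
  exact: (gap_decr_left x0 xs (lexx _)).2.
exact: (gap_incr_right (lexx _) sx xm).2.
Qed.

Lemma gapG_gt0 x : 0 < x < m^-1 -> x != s -> 0 < gapG x.
Proof.
move=> /andP[x0 xm]; rewrite -[ltLHS]gapG_center neq_lt => /orP[xs|sx].
  exact: (gap_decr_left x0 xs (lexx _)).1.
exact: (gap_incr_right (lexx _) sx xm).1.
Qed.

Lemma f_funE x : f_fun n a^-1 x = gapG x / gapP x / (1 - a).
Proof.
rewrite /f_fun /gapG /gapP invfM invrK mulrA mulfK //.
by rewrite -[in RHS]opprB -[in X in _ = _ * X]opprB invrN mulrNN.
Qed.

End OneVariable.

(** * Transfers between two entries *)

Section TwoCoordinates.
Variables (R : realType) (a s sg nu K Q c : R).
Hypotheses (a0 : a != 0) (s0 : 0 < s) (K0 : 0 < K) (Q0 : 0 <= Q).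
Implicit Types z : R.

(* The functional [sg * (G - nu * P)] when two entries [z], [c - z] vary and the
   others, with product [K] and sum of [a]-th powers [Q], are fixed. *)
Let G z := (K * (z * (c - z))) `^ s.
Let S z := (Q + z `^ a + (c - z) `^ a) * s.
Let E z := S z `^ (a^-1 - 1).
Let psi z := sg * (G z - nu * S z `^ a^-1).

Let Ainv z := z^-1 - (c - z)^-1.
Let B z := z `^ (a - 1) - (c - z) `^ (a - 1).
Let psi1 z := sg * s * (G z * Ainv z - nu * (E z * B z)).
Let A1 z := - (z * z)^-1 - ((c - z) * (c - z))^-1.
Let B1 z := (a - 1) * z `^ (a - 1 - 1) + (a - 1) * (c - z) `^ (a - 1 - 1).
Let E1 z := (a^-1 - 1) * S z `^ (a^-1 - 1 - 1) * (s * (a * B z)).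
Let psi2 z := sg * s * (s * (G z * Ainv z) * Ainv z + G z * A1 z
                        - nu * (E1 z * B z + E z * B1 z)).

Let S_gt0 z : 0 < z < c -> 0 < S z.
Proof.
move=> /andP[z0 zc]; rewrite mulr_gt0 // addr_gt0 ?powR_gt0 ?subr_gt0 //.
by rewrite ltr_wpDl // powR_gt0.
Qed.

Let KG_gt0 z : 0 < z < c -> 0 < K * (z * (c - z)).
Proof. by move=> /andP[z0 zc]; rewrite !mulr_gt0 // subr_gt0. Qed.

Let derG z : 0 < z < c -> der G z (s * (G z * Ainv z)).
Proof.
move=> zi; have /andP[z0 zc] := zi; have h := KG_gt0 zi.
eapply der_eq.
  by rewrite /G; derive_tac; exact: h.
rewrite powR_sub1_div // -/(G z) /Ainv.
by field; rewrite !gt_eqF // subr_gt0.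
Qed.

Let derB z : 0 < z < c -> der B z (B1 z).
Proof.
move=> zi; have /andP[z0 zc] := zi; have h : 0 < c - z by rewrite subr_gt0.
eapply der_eq; first by rewrite /B; derive_tac; rewrite ?z0 ?h.
by rewrite /B1; ring.
Qed.

Let derA z : 0 < z < c -> der Ainv z (A1 z).
Proof.
move=> zi; have /andP[z0 zc] := zi; have h : 0 < c - z by rewrite subr_gt0.
eapply der_eq; first by rewrite /Ainv; derive_tac; rewrite ?gt_eqF.
by rewrite /A1; field; rewrite !gt_eqF.
Qed.

Let derS z : 0 < z < c -> der S z (s * (a * B z)).
Proof.
move=> zi; have /andP[z0 zc] := zi; have h : 0 < c - z by rewrite subr_gt0.
eapply der_eq; first by rewrite /S; derive_tac; rewrite ?z0 ?h.
by rewrite /B; ring.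
Qed.

Let der_psi z : 0 < z < c -> der psi z (psi1 z).
Proof.
move=> zi; have hS := S_gt0 zi.
have := derM (der_cst sg z) (derD (derG zi)
  (derN (derM (der_cst nu z) (der_powR a^-1 hS (derS zi))))).
move/der_eq; apply; rewrite /psi1 -/(E z); field; exact: a0.
Qed.

Let der_psi1 z : 0 < z < c -> der psi1 z (psi2 z).
Proof.
move=> zi; have hS := S_gt0 zi.
have dE := der_powR (a^-1 - 1) hS (derS zi).
have := derM (der_cst (sg * s) z) (derD (derM (derG zi) (derA zi))
  (derN (derM (der_cst nu z) (derM dE (derB zi))))).
move/der_eq; apply; rewrite /psi2 -/(E z) -/(E1 z); ring.
Qed.

Hypothesis sgn0 : sg != 0.

(** [psi1] vanishes at [z0]; the terms are sorted so that each side is, up to a common factor, the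
    partial derivative in one entry. *)
Lemma two_coord_first_order z0 : 0 < z0 < c ->
  (forall z, 0 < z < c -> psi z <= psi z0) ->
  G z0 / z0 - nu * E z0 * z0 `^ (a - 1) =
  G z0 / (c - z0) - nu * E z0 * (c - z0) `^ (a - 1).
Proof.
move=> zi hmax; have /andP[z00 z0c] := zi.
have c0 : 0 <= c by apply/ltW/(lt_trans z00).
have [|||_ d0] := @derive1_at_max R psi 0 c z0 c0.
- by move=> z; rewrite in_itv /= => /der_psi [].
- by rewrite in_itv /= zi.
- by move=> z; rewrite in_itv /= => /hmax.
have [_ d1] := der_psi zi.
have /eqP : psi1 z0 = 0 by rewrite -d1 -d0.
rewrite mulf_eq0 mulf_eq0 (negbTE sgn0) (gt_eqF s0) /=.
by move=> /eqP; rewrite /Ainv /B; lra.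
Qed.

(** For two equal entries [Ainv] and [B] vanish, so [psi2] reduces to [2 s / z0^2] times the
    displayed quantity. Equal entries suffice, since entries on the same side of the turning point
    are first shown to be equal. *)
Lemma two_coord_second_order z0 : 0 < z0 -> c = z0 + z0 ->
  (forall z, 0 < z < c -> psi z <= psi z0) ->
  sg * (nu * (1 - a) * E z0 * z0 `^ a - G z0) <= 0.
Proof.
move=> z00 cE hmax; rewrite leNgt; apply/negP => hpos.
have zi : 0 < z0 < c by rewrite cE; lra.
have near z : `|z - z0| < z0 -> 0 < z < c.
  by rewrite ltr_norml cE => /andP[]; lra.
have cz : c - z0 = z0 by rewrite cE; ring.
have D0 z : `|z - z0| < z0 -> der (fun z => psi z + - psi z0) z (psi1 z).
  move=> /near zi'; have := derD (der_psi zi') (der_cst (- psi z0) z).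
  by move/der_eq; apply; rewrite addr0.
have D1 z : `|z - z0| < z0 -> der psi1 z (psi2 z) by move=> /near; apply: der_psi1.
have A0 : Ainv z0 = 0 by rewrite /Ainv cz subrr.
have B0 : B z0 = 0 by rewrite /B cz subrr.
have [||||d /andP[d0 _] hd] := second_derivative_pos z00 D0 D1.
- by rewrite subrr.
- by rewrite /psi1 A0 B0; ring.
- rewrite /psi2 A0 B0 /A1 /B1 cz.
  have -> : z0 `^ (a - 1 - 1) = z0 `^ a / z0 ^+ 2.
    by rewrite !powR_sub1_div //; field; rewrite gt_eqF.
  have -> : sg * s * (s * (G z0 * 0) * 0 + G z0 * (- (z0 * z0)^-1 - (z0 * z0)^-1) -
     nu * (E1 z0 * 0 + E z0 * ((a - 1) * (z0 `^ a / z0 ^+ 2) +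
      (a - 1) * (z0 `^ a / z0 ^+ 2)))) =
     (2 * s / z0 ^+ 2) * (sg * (nu * (1 - a) * E z0 * z0 `^ a - G z0)).
    by field; rewrite gt_eqF.
  by apply: mulr_gt0 => //; apply: divr_gt0; [exact: mulr_gt0|exact: exprn_gt0].
- have /andP[_ zc] := zi; have h : 0 < c - z0 by rewrite cz.
  have hS := S_gt0 zi; have hG := KG_gt0 zi.
  have : exists e, der psi2 z0 e.
    eexists; rewrite /psi2 /G /E1 /A1 /B1 /E /Ainv /B /S.
    have e1 (x : R) : 0 < x -> x * x != 0 by move=> x0; rewrite gt_eqF // mulr_gt0.
    by derive_tac; rewrite ?e1 ?(lt0r_neq0 h) ?(lt0r_neq0 z00).
  by case=> e; apply: der_cvg.
pose z := z0 + Num.min d z0 / 2.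
have m0 : 0 < Num.min d z0 by rewrite lt_min d0.
have md : Num.min d z0 <= d by rewrite ge_min lexx.
have mz : Num.min d z0 <= z0 by rewrite ge_min lexx orbT.
have zz : `|z - z0| < d.
  by rewrite /z addrC addKr gtr0_norm; lra.
have zz' : `|z - z0| < z0 by rewrite /z addrC addKr gtr0_norm; lra.
have zne : z != z0 by rewrite gt_eqF // /z; lra.
have := hd z zz zne; rewrite subr_gt0 => h.
by have := lt_le_trans h (hmax z (near z zz')); rewrite ltxx.
Qed.

End TwoCoordinates.

(** * Shape of the interior extrema *)

Section InteriorExtremum.
Variable R : realType.

Lemma gt0_ltr_powRn (a x y : R) : a < 0 -> 0 < x -> x < y -> y `^ a < x `^ a.
Proof.
move=> an x0 xy; have y0 := lt_trans x0 xy.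
rewrite -[a]opprK !(powRN _ (- a)) ltf_pV2 ?posrE ?powR_gt0 //.
by apply: gt0_ltr_powR; rewrite ?nnegrE ?oppr_gt0 // ltW.
Qed.

Lemma powR_lt_between (a x y z : R) : a != 0 -> 0 < x -> x < y -> y < z ->
  (x `^ a < y `^ a < z `^ a) || (z `^ a < y `^ a < x `^ a).
Proof.
move=> a0 x0 xy yz; have y0 := lt_trans x0 xy; have z0 := lt_trans y0 yz.
case: (ltgtP a 0) a0 => // [an|ap] _; apply/orP; [right|left].
  by rewrite !gt0_ltr_powRn.
by apply/andP; split; apply: gt0_ltr_powR => //; rewrite nnegrE ltW.
Qed.

(* [crit G k a] is, up to a positive factor, the partial derivative of
   [G - nu * P] with respect to an entry; [e x^a - G] with [e = k (1 - a)]
   carries the sign of its derivative. *)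
Definition crit (G k a x : R) := G / x - k * x `^ (a - 1).

(** The derivative of [crit] at [z] is [(e z^a - G) / z^2] with [e = k (1 - a)]. Equal values give a
    zero strictly between [x] and [y]; as [z^a] is strictly monotone, [e z^a - G] has opposite
    strict signs at [x] and [y], against the common weak sign. The sign [tau] selects the side of
    the turning point. *)
Lemma crit_inj_lt (G k a tau x y : R) : a != 0 -> k * (1 - a) != 0 -> tau != 0 ->
  tau * (k * (1 - a) * x `^ a - G) <= 0 -> tau * (k * (1 - a) * y `^ a - G) <= 0 ->
  0 < x -> x < y -> crit G k a x <> crit G k a y.
Proof.
move=> a0 e0 tau0 hx hy x0 xy.
pose dq z := (k * (1 - a) * z `^ a - G) / (z * z).
have D z : 0 < z -> der (crit G k a) z (dq z).
  move=> z0; eapply der_eq.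
    by rewrite /crit; derive_tac; rewrite ?(lt0r_neq0 z0).
  rewrite /dq !powR_sub1_div //.
  by field; rewrite gt_eqF.
have [||z /andP[xz zy] e] := @der_mvt _ (crit G k a) dq x y xy.
- apply: (der_within (df := dq)) => z; rewrite in_itv /= => /andP[xz _].
  by apply: D; apply: lt_le_trans xz.
- by move=> z /andP[xz _]; apply: D; apply: lt_trans xz.
move=> eq; move: e; rewrite eq subrr => /esym /eqP.
have z0 := lt_trans x0 xz.
rewrite mulf_eq0 subr_eq0 (gt_eqF xy) orbF mulf_eq0 invr_eq0 mulf_eq0.
rewrite (gt_eqF z0) /= orbF => /eqP hz.
have te0 : tau * (k * (1 - a)) != 0 by rewrite mulf_neq0.
move: te0 hx hy; move: (k * (1 - a)) hz => e hz te0 hx hy.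
have : tau * (e * z `^ a - G) = 0 by rewrite hz mulr0.
have := powR_lt_between a0 x0 xz zy; move: (x `^ a) (y `^ a) (z `^ a) hx hy => X Y Z hx hy.
case: (ltgtP (tau * e) 0) te0 => // hte _ /orP[] /andP[h1 h2] h0.
- have : 0 < (tau * e) * (X - Z) by rewrite nmulr_rgt0 // subr_lt0.
  by lra.
- have : 0 < (tau * e) * (Y - Z) by rewrite nmulr_rgt0 // subr_lt0.
  by lra.
- have : 0 < (tau * e) * (Y - Z) by rewrite pmulr_rgt0 // subr_gt0.
  by lra.
- have : 0 < (tau * e) * (X - Z) by rewrite pmulr_rgt0 // subr_gt0.
  by lra.
Qed.

Lemma crit_inj (G k a tau x y : R) : a != 0 -> k * (1 - a) != 0 -> tau != 0 ->
  tau * (k * (1 - a) * x `^ a - G) <= 0 -> tau * (k * (1 - a) * y `^ a - G) <= 0 ->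
  0 < x -> 0 < y -> crit G k a x = crit G k a y -> x = y.
Proof.
move=> a0 e0 t0 hx hy x0 y0 eq.
case: (ltgtP x y) => // h.
  by case: (crit_inj_lt a0 e0 t0 hx hy x0 h eq).
by case: (crit_inj_lt a0 e0 t0 hy hx y0 h (esym eq)).
Qed.

Variables (n : nat) (a sg nu : R).
Hypotheses (n1 : (1 < n)%N) (a0 : a != 0) (nua : 0 < nu * (1 - a)) (sg0 : sg != 0).
Implicit Types v w : 'I_n -> R.

Local Notation N := (n%:R : R).

Definition psum v := (\sum_(i < n) v i `^ a) / N.
(** Taking [sg = 1] or [sg = -1] lets one maximization serve lower and upper bounds on the gap
    [s - G]. *)
Definition objective v := sg * (gmean v - nu * psum v `^ a^-1).

Variable v : 'I_n -> R.
Hypothesis v0 : forall i, 0 < v i.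
Hypothesis vmax : forall w, (forall i, 0 < w i) -> \sum_(i < n) w i = \sum_(i < n) v i ->
  objective w <= objective v.

Let k := nu * psum v `^ (a^-1 - 1).
Let e := k * (1 - a).

Let N0 : 0 < N. Proof. by rewrite ltr0n (ltn_trans _ n1). Qed.

Let psum_gt0 : 0 < psum v.
Proof.
have [i] : exists i : 'I_n, true by exists (Ordinal (ltn_trans (ltn0Sn 0) n1)).
move=> _; rewrite divr_gt0 // (bigD1 i) //= ltr_pwDl ?powR_gt0 //.
by apply: sumr_ge0 => *; apply: powR_ge0.
Qed.

Let e_gt0 : 0 < e.
Proof. by rewrite /e /k mulrAC mulr_gt0 // powR_gt0. Qed.

Let perturb i j z := fun l => if l == i then z else if l == j then v i + v j - z else v l.

Let prodKE i j w : i != j ->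
  \prod_(l < n) w l = \prod_(l < n | (l != i) && (l != j)) w l * (w i * w j).
Proof.
move=> ij; rewrite (bigD1 i) //= (bigD1 j) 1?eq_sym //= mulrA mulrC.
by [].
Qed.

Let sumQE i j (w : 'I_n -> R) : i != j ->
  \sum_(l < n) w l = \sum_(l < n | (l != i) && (l != j)) w l + w i + w j.
Proof.
by move=> ij; rewrite (bigD1 i) //= (bigD1 j) 1?eq_sym //= addrA addrC addrA.
Qed.

Let perturbE i j z : i != j ->
  [/\ perturb i j z i = z, perturb i j z j = v i + v j - z &
    forall l, (l != i) && (l != j) -> perturb i j z l = v l].
Proof.
move=> ij; rewrite /perturb !eqxx eq_sym (negbTE ij); split=> // l.
by move=> /andP[/negbTE-> /negbTE->].
Qed.

Let objective_perturb i j z : i != j -> 0 < z < v i + v j ->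
  objective (perturb i j z) =
  sg * ((\prod_(l < n | (l != i) && (l != j)) v l * (z * (v i + v j - z))) `^ N^-1
   - nu * ((\sum_(l < n | (l != i) && (l != j)) v l `^ a + z `^ a
             + (v i + v j - z) `^ a) * N^-1) `^ a^-1).
Proof.
move=> ij zi; have [e1 e2 e3] := perturbE z ij.
rewrite /objective /gmean /psum (prodKE _ ij).
rewrite (sumQE (fun l => perturb i j z l `^ a) ij) e1 e2.
have -> : \prod_(l < n | (l != i) && (l != j)) perturb i j z l =
  \prod_(l < n | (l != i) && (l != j)) v l by apply: eq_bigr.
have -> : \sum_(l < n | (l != i) && (l != j)) perturb i j z l `^ a =
  \sum_(l < n | (l != i) && (l != j)) v l `^ a.
  by apply: eq_bigr => l /e3 ->.
reflexivity.
Qed.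

Let objective_self i j : i != j -> objective v =
  sg * ((\prod_(l < n | (l != i) && (l != j)) v l * (v i * (v i + v j - v i))) `^ N^-1
   - nu * ((\sum_(l < n | (l != i) && (l != j)) v l `^ a + v i `^ a
             + (v i + v j - v i) `^ a) * N^-1) `^ a^-1).
Proof.
move=> ij; rewrite /objective /gmean /psum (prodKE _ ij).
by rewrite (sumQE (fun l => v l `^ a) ij) [v i + _ - _]addrC addKr.
Qed.

Let perturb_max i j : i != j -> forall z, 0 < z < v i + v j ->
  objective (perturb i j z) <= objective v.
Proof.
move=> ij z zi; have [e1 e2 e3] := perturbE z ij; apply: vmax.
  move=> l; rewrite /perturb; case: eqP => _; first by case/andP: zi.
  by case: eqP => // _; rewrite subr_gt0; case/andP: zi.
rewrite (sumQE _ ij) [in RHS](sumQE _ ij) e1 e2.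
have -> : \sum_(l < n | (l != i) && (l != j)) perturb i j z l =
  \sum_(l < n | (l != i) && (l != j)) v l by apply: eq_bigr.
by rewrite -!addrA; congr (_ + _); ring.
Qed.

Let K0 i j : 0 < \prod_(l < n | (l != i) && (l != j)) v l.
Proof. by apply: prodr_gt0. Qed.

Let Q0 i j : 0 <= \sum_(l < n | (l != i) && (l != j)) v l `^ a.
Proof. by apply: sumr_ge0 => *; apply: powR_ge0. Qed.

Let Ninv0 : 0 < N^-1. Proof. by rewrite invr_gt0. Qed.

Let GE i j : i != j ->
  (\prod_(l < n | (l != i) && (l != j)) v l * (v i * v j)) `^ N^-1 = gmean v.
Proof. by move=> ij; rewrite /gmean (prodKE _ ij). Qed.

Let SE i j : i != j ->
  (\sum_(l < n | (l != i) && (l != j)) v l `^ a + v i `^ a + v j `^ a) * N^-1 = psum v.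
Proof. by move=> ij; rewrite /psum (sumQE (fun l => v l `^ a) ij). Qed.

Let crit_eq i j : crit (gmean v) k a (v i) = crit (gmean v) k a (v j).
Proof.
have [->//|ij] := eqVneq i j.
have zi : 0 < v i < v i + v j by rewrite v0 ltrDl v0.
have := @two_coord_first_order R a N^-1 sg nu _ _ (v i + v j) a0 Ninv0 (K0 i j) (Q0 i j)
   sg0 (v i) zi.
rewrite [v i + v j - v i]addrC addKr GE // SE //; apply=> z zi'.
by have := perturb_max ij zi'; rewrite objective_perturb // (objective_self ij).
Qed.

(** The side of the turning point of [crit] on which the second-order condition forbids two equal
    entries. *)
Let bad i := 0 < sg * (e * v i `^ a - gmean v).

(** Two entries on this side are equal by [crit_inj] with [tau = - sg], and a transfer between them
    then violates the second-order condition. *)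
Let bad_uniq i j : bad i -> bad j -> i = j.
Proof.
move=> bi bj; apply/eqP; apply: contraT => ij.
have vij : v i = v j.
  apply: (@crit_inj (gmean v) k a (- sg)) => //.
  - by rewrite gt_eqF.
  - by rewrite oppr_eq0.
  - by rewrite mulNr oppr_le0; apply: ltW.
  - by rewrite mulNr oppr_le0; apply: ltW.
have := @two_coord_second_order R a N^-1 sg nu _ _ (v i + v j) a0 Ninv0 (K0 i j) (Q0 i j)
   (v i) (v0 i).
rewrite -{1}vij => /(_ erefl).
rewrite [v i + v j - v i]addrC addKr GE // SE //.
rewrite leNgt => h; exfalso; move: h.
have -> : nu * (1 - a) * psum v `^ (a^-1 - 1) = e by rewrite /e /k mulrAC.
rewrite -/(bad i) bi => h.
suff : false by [].
apply: h => z zi'.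
by have := perturb_max ij zi'; rewrite objective_perturb // (objective_self ij).
Qed.

Let good_eq i j : ~~ bad i -> ~~ bad j -> v i = v j.
Proof.
rewrite /bad -!leNgt => bi bj.
by apply: (@crit_inj (gmean v) k a sg) => //; rewrite gt_eqF.
Qed.

Lemma interior_extremum : (forall i j, v i = v j) \/
  exists j x, (forall i, i != j -> v i = x) /\ sg * x `^ a < sg * v j `^ a.
Proof.
have [/existsP[j bj]|/existsPn nb] := boolP [exists j, bad j]; last first.
  by left => i j; apply: good_eq.
right; exists j.
have gi i : i != j -> ~~ bad i by apply: contra => bi; rewrite (bad_uniq bi bj).
have [i ij] : exists i, i != j.
  apply/existsP; rewrite -[X in is_true X]negbK; apply/negP => /existsPn h.
  have := n1; rewrite ltnNge -[n in (n <= _)%N]card_ord; apply/negP/negPn.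
  apply/card_le1P => x _ y; rewrite !inE.
  by have := h x; have := h y; rewrite !negbK => /eqP-> /eqP->; rewrite eqxx.
exists (v i); split=> [l lj|]; first by apply: good_eq; apply: gi.
have := gi i ij; rewrite /bad -leNgt => h1; have h2 : bad j := bj; rewrite /bad in h2.
(* The strict condition at [j] minus the weak one at [i]; [e] is positive because [nu * (1 - a)]
   is. *)
have : 0 < e * (sg * v j `^ a - sg * v i `^ a) by move: h1 h2; lra.
by rewrite pmulr_rgt0 // subr_gt0.
Qed.

End InteriorExtremum.

(** * Existence of a maximum on the simplex *)

Section SimplexMaximum.
Variables (R : realType) (n : nat) (a sg nu : R).
Hypotheses (n1 : (1 < n)%N) (a0 : a != 0).
Implicit Types v w : 'I_n -> R.

Local Notation N := (n%:R : R).

Definition simplex v := (forall i, 0 <= v i) /\ \sum_(i < n) v i = 1.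

Lemma simplex_le1 v i : simplex v -> v i <= 1.
Proof. by case=> v0 <-; rewrite (bigD1 i) //= lerDl sumr_ge0. Qed.

Lemma continuous_atB (T : topologicalType) (f g : T -> R) x :
  {for x, continuous f} -> {for x, continuous g} ->
  {for x, continuous (fun u => f u - g u)}.
Proof. by move=> cf cg; apply: cvgB; [exact: cf|exact: cg]. Qed.

Lemma continuous_atZ (T : topologicalType) (f : T -> R) (k : R) x :
  {for x, continuous f} -> {for x, continuous (fun u => k * f u)}.
Proof. by move=> cf; apply: cvgM; [exact: cvg_cst|exact: cf]. Qed.

Lemma continuous_at_sum (T : topologicalType) (I : Type) (r : seq I) (F : I -> T -> R) x :
  (forall i, {for x, continuous (F i)}) ->
  {for x, continuous (fun u => \sum_(i <- r) F i u)}.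
Proof.
move=> cF; elim: r => [|i r IH].
  have -> : (fun u => \sum_(i <- [::]) F i u) = (fun=> 0).
    by apply/funext => u; rewrite big_nil.
  exact: cvg_cst.
have -> : (fun u => \sum_(j <- i :: r) F j u) = (fun u => F i u + \sum_(j <- r) F j u).
  by apply/funext => u; rewrite big_cons.
by apply: cvgD; [exact: cF|exact: IH].
Qed.

Lemma continuous_at_prod (T : topologicalType) (I : Type) (r : seq I) (F : I -> T -> R) x :
  (forall i, {for x, continuous (F i)}) ->
  {for x, continuous (fun u => \prod_(i <- r) F i u)}.
Proof.
move=> cF; elim: r => [|i r IH].
  have -> : (fun u => \prod_(i <- [::]) F i u) = (fun=> 1).
    by apply/funext => u; rewrite big_nil.
  exact: cvg_cst.
have -> : (fun u => \prod_(j <- i :: r) F j u) = (fun u => F i u * \prod_(j <- r) F j u).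
  by apply/funext => u; rewrite big_cons.
by apply: cvgM; [exact: cF|exact: IH].
Qed.

(* The constraint [kap <= \prod v] keeps the entries away from [0], where the power
   mean of negative order is not given by its formula. *)
Lemma simplex_max (kap : R) v0 : (0 < a) || (0 < kap) ->
  simplex v0 -> kap <= \prod_(i < n) v0 i ->
  exists v, [/\ simplex v, kap <= \prod_(i < n) v i &
    forall w, simplex w -> kap <= \prod_(i < n) w i ->
      objective a sg nu w <= objective a sg nu v].
Proof.
move=> hk v0s v0k.
pose row w : 'rV[R]_n := \row_i w i.
have rowE w : (fun i => row w ord0 i) = w by apply/funext => i; rewrite mxE.
pose K : set 'rV[R]_n := [set u : 'rV[R]_n | forall i, [set` `[(0 : R), 1]] (u ord0 i)]
   `&` ((fun u : 'rV[R]_n => \sum_(i < n) u ord0 i) @^-1` [set x | x = 1]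
   `&` (fun u : 'rV[R]_n => \prod_(i < n) u ord0 i) @^-1` [set x | kap <= x]).
have Ksimplex u : K u -> simplex (fun i => u ord0 i) /\ kap <= \prod_(i < n) u ord0 i.
  move=> [h1 [h2 h3]]; split=> //; split=> // i.
  by have := h1 i; rewrite /= in_itv /= => /andP[].
have simplexK w : simplex w -> kap <= \prod_(i < n) w i -> K (row w).
  move=> ws wk; split=> [i|]; last split.
  - by rewrite /= in_itv /= mxE ws.1 simplex_le1.
  - by rewrite /= -[RHS]ws.2; apply: eq_bigr => i _; rewrite mxE.
  - by rewrite /=; under eq_bigr do rewrite mxE.
have cK : compact K.
  apply: compact_closedI.
    by apply: (@rV_compact R n (fun=> [set` `[(0 : R), 1]])) => i; apply: segment_compact.
  apply: closedI.
    apply: closed_comp; last exact: closed_eq.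
    by move=> u _; apply: continuous_at_sum => i; apply: coord_continuous.
  apply: closed_comp; last exact: closed_ge.
  by move=> u _; apply: continuous_at_prod => i; apply: coord_continuous.
(* The absolute values make [F] continuous in the ambient space at every point of [K], where it
   agrees with [objective]. *)
pose F (u : 'rV[R]_n) := sg * (`|\prod_(i < n) u ord0 i| `^ N^-1
   - nu * `|(\sum_(i < n) `|u ord0 i| `^ a) / N| `^ a^-1).
have FE u : K u -> F u = objective a sg nu (fun i => u ord0 i).
  move=> /Ksimplex [[u0 _] _]; rewrite /F /objective /gmean /psum.
  have h1 : 0 <= \prod_(i < n) u ord0 i by apply: prodr_ge0 => i _.
  have h2 : \sum_(i < n) `|u ord0 i| `^ a = \sum_(i < n) u ord0 i `^ a.
    by apply: eq_bigr => i _; rewrite ger0_norm.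
  have h3 : 0 <= (\sum_(i < n) u ord0 i `^ a) / N.
    by rewrite divr_ge0 ?ler0n // sumr_ge0 // => i _; apply: powR_ge0.
  by rewrite h2 (ger0_norm h1) (ger0_norm h3).
have N0 : 0 < N by rewrite ltr0n (ltn_trans _ n1).
have cF : {within K, continuous F}.
  apply: continuous_in_subspaceT => u; rewrite inE => /Ksimplex [[u0 u1] uk].
  have upos : (0 < a) || [forall i, u ord0 i != 0].
    case/orP: hk => [->//|k0]; apply/orP; right; apply/forallP => i.
    by apply/eqP => ui; move: uk; rewrite (bigD1 i) //= ui mul0r leNgt k0.
  apply: (@continuous_atZ _ (fun u : 'rV[R]_n => `|\prod_(i < n) u ord0 i| `^ N^-1
   - nu * `|(\sum_(i < n) `|u ord0 i| `^ a) / N| `^ a^-1) sg u).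
  apply: (@continuous_atB _ (fun u : 'rV[R]_n => `|\prod_(i < n) u ord0 i| `^ N^-1)
   (fun u : 'rV[R]_n => nu * `|(\sum_(i < n) `|u ord0 i| `^ a) / N| `^ a^-1) u).
    apply: (@continuous_comp _ _ _ (fun u : 'rV[R]_n => \prod_(i < n) u ord0 i)
      (fun z : R => `|z| `^ N^-1)).
      by apply: continuous_at_prod => i; apply: coord_continuous.
    by apply: normr_powR_continuous_at; rewrite invr_gt0 N0.
  apply: continuous_atZ.
  apply: (@continuous_comp _ _ _ (fun u : 'rV[R]_n => (\sum_(i < n) `|u ord0 i| `^ a) / N)
      (fun z : R => `|z| `^ a^-1)).
    have -> : (fun u : 'rV[R]_n => (\sum_(i < n) `|u ord0 i| `^ a) / N) =
        (fun u : 'rV[R]_n => N^-1 * \sum_(i < n) `|u ord0 i| `^ a).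
      by apply/funext => z; rewrite mulrC.
    apply: continuous_atZ; apply: continuous_at_sum => i.
    apply: (@continuous_comp _ _ _ (fun u : 'rV[R]_n => u ord0 i) (fun z : R => `|z| `^ a)).
      exact: coord_continuous.
    apply: normr_powR_continuous_at.
    by case/orP: upos => [->//|/forallP ->]; rewrite orbT.
  apply: normr_powR_continuous_at; rewrite invr_gt0.
  case/orP: upos => [->//|/forallP upos]; apply/orP; right.
  rewrite mulf_neq0 ?invr_eq0 ?(gt_eqF N0) //.
  rewrite (bigD1 (Ordinal (ltn_trans (ltn0Sn 0) n1))) //= gt_eqF // ltr_pwDl //.
    by rewrite powR_gt0 // normr_gt0.
  by apply: sumr_ge0 => i _; apply: powR_ge0.
have [|u] := compact_EVT_max _ cK cF.
  by exists (row v0); apply: simplexK.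
rewrite inE => uK umax; have [us uk] := Ksimplex u uK.
exists (fun i => u ord0 i); split; [exact: us|exact: uk|move=> w ws wk].
have wK := simplexK w ws wk.
have := umax (row w); rewrite inE => /(_ wK).
by rewrite (FE u uK) (FE _ wK) rowE; apply.
Qed.

End SimplexMaximum.

(** * Reduction of a bound to the one-parameter family *)

Section SimplexBounds.
Variables (R : realType) (n : nat) (a : R).
Hypotheses (hn : (2 < n)%N) (a0 : a != 0) (a1 : a != 1).
Implicit Types (v w : 'I_n -> R) (x sg rho : R).

Local Notation N := (n%:R : R).
Local Notation s := (N^-1).
Local Notation m := (N - 1).

Let n1 : (1 < n)%N. Proof. exact: ltnW. Qed.
Let N2 : 2 < N. Proof. exact: natr_gt2. Qed.
Let N0 : 0 < N. Proof. by move: N2; lra. Qed.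
Let m0 : 0 < m. Proof. by move: N2; lra. Qed.
Let si : 0 < s < 2^-1. Proof. exact: invn_itv. Qed.
Let b0 : 1 - a != 0. Proof. by rewrite subr_eq0 eq_sym. Qed.

Definition gapGv v := s - gmean v.
Definition gapPv v := (s - psum a v `^ a^-1) / (1 - a).

Lemma big_except (T : Type) (idx : T) (op : Monoid.com_law idx) (j : 'I_n) (F : 'I_n -> T) c :
  (forall i, i != j -> F i = c) ->
  \big[op/idx]_(i < n) F i = op (F j) (iterop n.-1 op c idx).
Proof.
move=> Fc; rewrite (bigD1 j) //=; congr (op _ _).
rewrite (eq_bigr (fun=> c)) => [|i /Fc //].
by rewrite big_const cardC1 card_ord Monoid.iteropE.
Qed.

Lemma family v j x : simplex v -> (forall i, i != j -> v i = x) ->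
  [/\ v j = 1 - m * x, gmean v = g_fun n x &
      psum a v = (m * x `^ a + (1 - m * x) `^ a) / N].
Proof.
move=> [v0 v1] vx.
have nE : n.-1%:R = m :> R by rewrite -subn1 natrB ?(ltn_trans _ hn).
have mE (z : R) : z *+ n.-1 = m * z by rewrite -nE mulr_natl.
have vj : v j = 1 - m * x.
  have := v1; rewrite (big_except _ vx) /= -[iterop _ _ _ _]/(x *+ n.-1) mE.
  by lra.
split=> //.
  rewrite /gmean (big_except _ vx) /= -[iterop _ _ _ _]/(x ^+ n.-1).
  by rewrite mulrC vj.
rewrite /psum (@big_except _ _ _ j (fun i => v i `^ a) (x `^ a)) /=.
  by rewrite -[iterop _ _ _ _]/(x `^ a *+ n.-1) mE vj addrC.
by move=> i /vx ->.
Qed.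

Lemma family_gap v j x : simplex v -> (forall i, i != j -> v i = x) ->
  0 < x < m^-1 -> gapGv v = gapG n x /\ gapPv v = gapP n a x.
Proof.
move=> vs vx /andP[x0 xm]; have [_ gE pE] := family vs vx.
rewrite /gapGv /gapPv /gapG /gapP gE pE /p_fun (gt_eqF x0) (lt_eqF xm) andbF.
by rewrite invrK.
Qed.

(** The choice [nu = rho / (1 - a)] makes maximizing [objective] the same as minimizing the signed
    defect of the bound, so it is enough to check the bound at a maximizer. *)
Lemma objectiveE sg rho v : objective a sg (rho / (1 - a)) v =
  sg * (s - rho / (1 - a) * s) - sg * (gapGv v - rho * gapPv v).
Proof. by rewrite /objective /gapGv /gapPv; field; rewrite b0 gt_eqF. Qed.

(** At a constant tuple both gaps vanish. Any other extremal tuple belongs to the family, with the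
    order between its two entries that [Ho] requires. *)
Lemma interior_bound sg rho v : sg != 0 -> 0 < rho -> simplex v -> (forall i, 0 < v i) ->
  (forall w, (forall i, 0 < w i) -> \sum_(i < n) w i = \sum_(i < n) v i ->
     objective a sg (rho / (1 - a)) w <= objective a sg (rho / (1 - a)) v) ->
  (forall x, 0 < x < m^-1 -> sg * x `^ a < sg * (1 - m * x) `^ a ->
     0 <= sg * (gapG n x - rho * gapP n a x)) ->
  0 <= sg * (gapGv v - rho * gapPv v).
Proof.
move=> sg0 rho0 vs vpos vmax Ho.
have nua : 0 < rho / (1 - a) * (1 - a) by rewrite divfK.
have fam j x : (forall i, i != j -> v i = x) -> 0 < x -> 0 < x < m^-1.
  move=> vx x0; have [vj _ _] := family vs vx; have := vpos j.
  by rewrite x0 vj subr_gt0 -[m^-1]div1r ltr_pdivlMr // mulrC.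
case: (interior_extremum n1 a0 nua sg0 vpos vmax) => [vc|[j [x [vx lt]]]].
  pose j : 'I_n := Ordinal (ltnW n1).
  have vx i : i != j -> v i = v j by move=> _; apply: vc.
  have [vj _ _] := family vs vx.
  have vjs : v j = s.
    have : N * v j = 1 by move: vj; lra.
    by move=> h; rewrite -[LHS](mulKf (lt0r_neq0 N0)) h mulr1.
  have [-> ->] := family_gap vs vx (fam j _ vx (vpos j)).
  by rewrite vjs gapG_center // gapP_center // mulr0 subr0 mulr0.
have [i ij] : exists i : 'I_n, i != j.
  have [j0|] := eqVneq j (Ordinal (ltnW n1)).
    by exists (Ordinal n1); rewrite j0 -val_eqE.
  by exists (Ordinal (ltnW n1)); rewrite eq_sym.
have x0 : 0 < x by rewrite -(vx i ij).
have xi := fam j x vx x0; have [-> ->] := family_gap vs vx xi.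
by apply: Ho => //; have [<- _ _] := family vs vx.
Qed.

Lemma bound_gt0 sg rho : sg != 0 -> 0 < rho -> 0 < a ->
  (forall v, simplex v -> (exists i, v i = 0) -> 0 <= sg * (gapGv v - rho * gapPv v)) ->
  (forall x, 0 < x < m^-1 -> sg * x `^ a < sg * (1 - m * x) `^ a ->
     0 <= sg * (gapG n x - rho * gapP n a x)) ->
  forall v, simplex v -> 0 <= sg * (gapGv v - rho * gapPv v).
Proof.
move=> sg0 rho0 apos Hb Ho v vs.
have prod_ge0 (w : 'I_n -> R) : simplex w -> 0 <= \prod_(i < n) w i.
  by move=> [w0 _]; apply: prodr_ge0.
have ha : (0 < a) || (0 < (0 : R)) by rewrite apos.
have [u [us _ umax]] := @simplex_max R n a sg (rho / (1 - a)) n1 0 v ha vs (prod_ge0 v vs).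
apply: (@le_trans _ _ (sg * (gapGv u - rho * gapPv u))); last first.
  by have := umax v vs (prod_ge0 v vs); rewrite !objectiveE lerD2l lerN2.
have [/existsP[i /eqP ui]|/existsPn un] := boolP [exists i, u i == 0].
  by apply: (Hb u us); exists i.
have upos i : 0 < u i by rewrite lt_neqAle eq_sym un us.1.
apply: (interior_bound sg0 rho0 us upos _ Ho) => w wpos wsum.
have ws : simplex w by split=> [i|]; [exact: ltW|rewrite wsum us.2].
exact: (umax w ws (prod_ge0 w ws)).
Qed.

Lemma gmean_pow v : (forall i, 0 <= v i) -> gmean v ^+ n = \prod_(i < n) v i.
Proof.
move=> v0; have h : 0 <= \prod_(i < n) v i by apply: prodr_ge0.
by rewrite -powR_mulrn ?powR_ge0 // -powRrM mulVf ?powRr1 // gt_eqF.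
Qed.

(** By contradiction: a violation at [v] makes the objective at [v] a number [D > 0], because
    [rho < 1 - a] gives [nu < 1]. As the objective never exceeds [G], the tuples that matter have
    product at least [D^n], a compact set away from the zero entries. *)
Lemma bound_lt0 rho : 0 < rho < 1 - a -> a < 0 ->
  (forall x, s < x < m^-1 -> rho * gapP n a x <= gapG n x) ->
  forall v, simplex v -> (forall i, 0 < v i) -> rho * gapPv v <= gapGv v.
Proof.
move=> /andP[rho0 rhoa] an Ho v vs vpos; rewrite leNgt; apply/negP => hlt.
pose nu := rho / (1 - a).
have ba : 0 < 1 - a by lra.
have nu0 : 0 < nu by rewrite divr_gt0.
have nu1 : nu < 1 by rewrite ltr_pdivrMr // mul1r.
pose D := objective a 1 nu v.
have D0 : 0 < D.
  rewrite /D objectiveE !mul1r.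
  have h : 0 < s - nu * s.
    by rewrite subr_gt0 -[ltRHS]mul1r ltr_pM2r //; case/andP: si.
  by rewrite -/nu; lra.
have objG (w : 'I_n -> R) : (forall i, 0 <= w i) -> objective a 1 nu w <= gmean w.
  by move=> _; rewrite /objective mul1r gerBl mulr_ge0 ?powR_ge0 // ltW.
have prodD (w : 'I_n -> R) : (forall i, 0 <= w i) -> D <= gmean w -> D ^+ n <= \prod_(i < n) w i.
  by move=> w0 h; rewrite -gmean_pow // lerXn2r ?nnegrE ?powR_ge0 // ltW.
have vk : D ^+ n <= \prod_(i < n) v i by apply: prodD vs.1 _; apply: objG vs.1.
have Dn : 0 < D ^+ n by apply: exprn_gt0.
have ha : (0 < a) || (0 < D ^+ n) by rewrite Dn orbT.
have [u [us uk umax]] := @simplex_max R n a 1 nu n1 (D ^+ n) v ha vs vk.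
have upos i : 0 < u i.
  rewrite lt_neqAle us.1 andbT eq_sym; apply/eqP => ui.
  by move: uk; rewrite (bigD1 i) //= ui mul0r leNgt Dn.
have Du : D <= objective a 1 nu u by exact: (umax v vs vk).
have : 0 <= 1 * (gapGv u - rho * gapPv u).
  apply: (interior_bound (oner_neq0 R) rho0 us upos).
    move=> w wpos wsum; have w0 i : 0 <= w i by apply: ltW.
    have ws : simplex w by split=> [i|]; [exact: w0|rewrite wsum us.2].
    have [wk|wk] := leP (D ^+ n) (\prod_(i < n) w i); first exact: (umax w ws wk).
    (* Below the product threshold [gmean w < D], so the constrained maximum is one over all
       positive tuples. *)
    apply: le_trans Du; apply: (le_trans (objG w w0)).
    rewrite leNgt; apply/negP => /ltW /(prodD w w0).
    by rewrite leNgt wk.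
  move=> x xi; have [x0 xm] := andP xi; rewrite !mul1r => lt.
  rewrite subr_ge0; apply: Ho; rewrite xm andbT.
  have y0 := compl_gt0 hn xm.
  (* A negative power reverses the order: the smaller power belongs to the larger entry, which puts
     [x] to the right of [1 / n]. *)
  rewrite ltNge; apply/negP => xs.
  have xy : x <= 1 - m * x.
    have : N * x <= 1 by rewrite mulrC -ler_pdivlMr // div1r.
    by lra.
  move: xy; rewrite le_eqVlt => /predU1P[xy|xy].
    have xya : x `^ a = (1 - m * x) `^ a := congr1 (fun z : R => z `^ a) xy.
    by move: lt; rewrite xya; apply/negP; rewrite ltxx.
  by have := lt_trans lt (gt0_ltr_powRn an x0 xy); rewrite ltxx.
have := Du; rewrite /D /nu (objectiveE 1 rho u) (objectiveE 1 rho v).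
move: hlt; rewrite -subr_lt0.
move: (gapGv u - _) (gapGv v - _) (1 * (s - _)) => X Y c hY hX hXY.
by move: hY hX hXY; lra.
Qed.

End SimplexBounds.

(** * The boundary of the simplex and the ends of the family *)

Section BoundaryAndEnds.
Variables (R : realType) (n : nat) (a : R).
Hypotheses (hn : (2 < n)%N) (a0 : a != 0) (a1 : a != 1).
Implicit Types (v w : 'I_n -> R) (x rho : R).

Local Notation N := (n%:R : R).
Local Notation s := (N^-1).
Local Notation m := (N - 1).

Let N2 : 2 < N. Proof. exact: natr_gt2. Qed.
Let N0 : 0 < N. Proof. by move: N2; lra. Qed.
Let m0 : 0 < m. Proof. by move: N2; lra. Qed.
Let s0 : 0 < s. Proof. by rewrite invr_gt0. Qed.
Let sm : s < m^-1. Proof. exact: invm_gt. Qed.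
Let b0 : 1 - a != 0. Proof. by rewrite subr_eq0 eq_sym. Qed.

Lemma p_fun0 : 0 < a -> p_fun n a^-1 0 = s `^ a^-1.
Proof.
move=> apos; rewrite /p_fun ltNge invr_ge0 (ltW apos) /= invrK.
by rewrite mulr0 subr0 powR1 (powR0 a0) mulr0 add0r div1r.
Qed.

Lemma p_fun_end : 0 < a -> p_fun n a^-1 m^-1 = (m `^ (1 - a) / N) `^ a^-1.
Proof.
move=> apos; rewrite /p_fun ltNge invr_ge0 (ltW apos) /= invrK.
rewrite mulfV ?(lt0r_neq0 m0) // subrr (powR0 a0) addr0 powRV //.
by rewrite powR_split // powRr1 ?(ltW m0) // powRN.
Qed.

Lemma g_fun0 : g_fun n 0 = 0 :> R.
Proof.
rewrite /g_fun expr0n; have -> : n.-1 == 0%N = false by case: (n) hn => [|[]].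
by rewrite mul0r powR0 // invr_eq0 gt_eqF.
Qed.

Lemma g_fun_end : g_fun n m^-1 = 0.
Proof.
rewrite /g_fun mulfV ?(lt0r_neq0 m0) // subrr mulr0 powR0 //.
by rewrite invr_eq0 gt_eqF.
Qed.

Lemma gapP_end_gt0 : 0 < a -> 0 < gapP n a 0 /\ 0 < gapP n a m^-1.
Proof.
move=> apos; split.
  have [_ cP] := @gap_within_closed R n a hn 0 s (lexx 0) (ltW sm) apos.
  have : - gapP n a 0 < - gapP n a s.
    apply: (@der_sincr _ (fun z => - gapP n a z) (fun z => - dgapP n a z) _ _ s0 (withinN cP)).
      move=> z /andP[z0 zs]; apply: derN; apply: der_gapP => //.
      by rewrite z0 (lt_trans zs sm).
    by move=> z zi; rewrite oppr_gt0; apply: dgapP_lt0.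
  by rewrite ltrN2 gapP_center.
have [_ cP] := @gap_within_closed R n a hn s m^-1 (ltW s0) (lexx _) apos.
rewrite -[ltLHS](gapP_center hn a0).
apply: (der_sincr sm cP).
  move=> z /andP[sz zm]; apply: der_gapP => //.
  by rewrite zm (lt_trans s0 sz).
by move=> z zi; apply: dgapP_gt0.
Qed.

Lemma gap_psum_mono (S1 S2 : R) : 0 < a -> 0 <= S1 -> 0 <= S2 ->
  0 <= (1 - a) * (S2 - S1) ->
  (s - S2 `^ a^-1) / (1 - a) <= (s - S1 `^ a^-1) / (1 - a).
Proof.
move=> apos S10 S20 h.
have r0 : 0 <= a^-1 by rewrite invr_ge0 ltW.
case: (ltgtP (1 - a) 0) b0 => // hb _.
  rewrite ler_nM2r ?invr_lt0 // lerD2l lerN2.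
  by apply: ge0_ler_powR; rewrite ?nnegrE //; move: h; rewrite nmulr_rge0 // subr_le0.
rewrite ler_pM2r ?invr_gt0 // lerD2l lerN2.
by apply: ge0_ler_powR; rewrite ?nnegrE //; move: h; rewrite pmulr_rge0 // subr_ge0.
Qed.

Lemma psum_ge0 v : 0 <= psum a v.
Proof. by rewrite divr_ge0 ?(ltW N0) // sumr_ge0 // => i _; apply: powR_ge0. Qed.

(** The entries lie in [[0, 1]] and sum to [1]; comparing [v^a] with [v] entry by entry shows that a
    vertex is extreme, and a vertex is the family at [x = 0]. *)
Lemma gapPv_le v : 0 < a -> simplex v -> gapPv a v <= gapP n a 0.
Proof.
move=> apos vs; rewrite /gapPv /gapP p_fun0 //.
apply: (gap_psum_mono apos (ltW s0) (psum_ge0 v)).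
have [v0 v1] := vs.
have -> : psum a v - s = (\sum_(i < n) (v i `^ a - v i)) * s.
  by rewrite /psum sumrB v1 mulrBl mul1r.
rewrite mulrA mulr_ge0 ?(ltW s0) // mulr_sumr sumr_ge0 // => i _.
have [->|vi0] := eqVneq (v i) 0; first by rewrite powR0 // subrr mulr0.
have vpos : 0 < v i <= 1 by rewrite lt_neqAle eq_sym vi0 v0 simplex_le1.
have [ha|ha] := leP a 1.
  by rewrite mulr_ge0 ?subr_ge0 // ger1_powR.
by rewrite mulr_le0 ?subr_le0 ?(ltW ha) // ge1r_powR // ltW.
Qed.

(** Jensen's inequality on the other [n - 1] entries: equal entries are extreme, which is the family
    at [x = 1 / (n - 1)]. *)
Lemma gapPv_ge v j : 0 < a -> simplex v -> v j = 0 -> gapP n a m^-1 <= gapPv a v.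
Proof.
move=> apos vs vj; rewrite /gapPv /gapP p_fun_end //.
have M0 : 0 <= m `^ (1 - a) / N by rewrite divr_ge0 ?powR_ge0 // ltW.
apply: (gap_psum_mono apos (psum_ge0 v) M0).
have [v0 v1] := vs.
(* Jensen through the tangent at [1]: the numbers [m * v i] with [i != j] have mean [1], so the
   linear parts cancel in the sum. *)
pose Q i := (m * v i) `^ a - 1 - a * (m * v i - 1).
have Q0 i : 0 <= a * (a - 1) * Q i.
  have [vi0|vi0] := eqVneq (v i) 0.
    rewrite /Q vi0 mulr0 powR0 //.
    have -> : a * (a - 1) * (0 - 1 - a * (0 - 1)) = a * (a - 1) ^+ 2 by ring.
    by rewrite mulr_ge0 ?sqr_ge0 // ltW.
  by apply: powR_tangent; rewrite mulr_gt0 // lt_neqAle eq_sym vi0 v0.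
have sumv : \sum_(i < n | i != j) v i = 1 by have := v1; rewrite (bigD1 j) //= vj add0r.
have sumva : \sum_(i < n | i != j) v i `^ a = psum a v * N.
  rewrite /psum divfK ?(lt0r_neq0 N0) // [in RHS](bigD1 j) //= vj powR0 //.
  by rewrite add0r.
have sum1 : \sum_(i < n | i != j) (1 : R) = m.
  rewrite sumr_const cardC1 card_ord -subn1 natrB //.
  exact: ltn_trans hn.
have sumQ : \sum_(i < n | i != j) Q i = m `^ a * (psum a v * N) - m.
  have -> : \sum_(i < n | i != j) Q i = \sum_(i < n | i != j)
      (m `^ a * v i `^ a + ((a - 1) * 1 + (- (a * m)) * v i)).
    by apply: eq_bigr => i _; rewrite /Q powRM ?(ltW m0) //; ring.
  by rewrite !big_split /= -!mulr_sumr sumva sumv sum1; ring.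
have : 0 <= \sum_(i < n | i != j) a * (a - 1) * Q i by apply: sumr_ge0 => i _.
rewrite -mulr_sumr sumQ -mulrA pmulr_rge0 // => h.
have mE : m = m `^ a * m `^ (1 - a) by rewrite powR_mul_compl.
have ma0 := powR_gt0 a m0.
have -> : (1 - a) * (m `^ (1 - a) / N - psum a v) =
  ((a - 1) * (m `^ a * (psum a v * N) - m)) * (m `^ a * N)^-1.
  have -> : m `^ a * (psum a v * N) - m = m `^ a * (psum a v * N - m `^ (1 - a)).
    by rewrite mulrBr -mE.
  by field; rewrite !gt_eqF.
by rewrite mulr_ge0 // invr_ge0 mulr_ge0 ?(ltW ma0) // ltW.
Qed.

Lemma gmean_zero v j : v j = 0 -> gmean v = 0.
Proof.
move=> vj; rewrite /gmean (bigD1 j) //= vj mul0r powR0 //.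
by rewrite invr_eq0 gt_eqF.
Qed.

(** On the boundary [G = 0] and the largest [gapP] is the hardest case, so the limit of the family
    at [x = 0] suffices. Inside, [x^a < y^a] with [a > 0] means [x < 1 / n]. *)
Lemma lower_bound_left rho : 0 < a -> 0 < rho ->
  (forall x, 0 < x < s -> rho * gapP n a x <= gapG n x) ->
  forall v, simplex v -> rho * gapPv a v <= gapGv v.
Proof.
move=> apos rho0 Ho v vs.
have : 0 <= 1 * (gapGv v - rho * gapPv a v); last by rewrite mul1r subr_ge0.
apply: (bound_gt0 hn a0 a1 (oner_neq0 R) rho0 apos _ _ vs).
  move=> w ws [j wj]; rewrite mul1r subr_ge0 /gapGv (gmean_zero wj) subr0.
  have [cG cP] := @gap_within_closed R n a hn 0 s (lexx 0) (ltW sm) apos.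
  have [h _] := @within_limit_ge0 _ (fun z => gapG n z + - (rho * gapP n a z)) 0 s s0
    (withinD cG (withinN (withinZ (k := rho) cP))) (fun z zi => etrans (subr_ge0 _ _) (Ho z zi)).
  move: h; rewrite subr_ge0 /gapG g_fun0 subr0; apply: le_trans.
  by rewrite ler_pM2l // gapPv_le.
move=> x /andP[x0 xm]; rewrite !mul1r => lt; rewrite subr_ge0; apply: Ho.
rewrite x0 /= ltNge; apply/negP => sx.
have yx : 1 - m * x <= x.
  have : 1 <= N * x by rewrite mulrC -ler_pdivrMr // div1r.
  by lra.
have y0 := compl_gt0 hn xm.
have := lt_le_trans lt (@ge0_ler_powR R a (ltW apos) (1 - m * x) x _ _ yx).
by rewrite !nnegrE ltxx => h; suff : false by []; apply: h; apply: ltW.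
Qed.

(** With [sg = -1] both choices are reversed: the hardest boundary point has the smallest [gapP], at
    [x = 1 / (n - 1)], and the interior candidates have [x > 1 / n]. *)
Lemma upper_bound_right rho : 0 < a -> 0 < rho ->
  (forall x, s < x < m^-1 -> gapG n x <= rho * gapP n a x) ->
  forall v, simplex v -> gapGv v <= rho * gapPv a v.
Proof.
move=> apos rho0 Ho v vs.
have neg1 : (-1 : R) != 0 by rewrite oppr_eq0 oner_eq0.
have : 0 <= -1 * (gapGv v - rho * gapPv a v); last by rewrite mulN1r oppr_ge0 subr_le0.
apply: (bound_gt0 hn a0 a1 neg1 rho0 apos _ _ vs).
  move=> w ws [j wj]; rewrite mulN1r oppr_ge0 subr_le0 /gapGv (gmean_zero wj) subr0.
  have [cG cP] := @gap_within_closed R n a hn s m^-1 (ltW s0) (lexx _) apos.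
  have [_ h] := @within_limit_ge0 _ (fun z => rho * gapP n a z + - gapG n z) s m^-1 sm
    (withinD (withinZ (k := rho) cP) (withinN cG)) (fun z zi => etrans (subr_ge0 _ _) (Ho z zi)).
  move: h; rewrite subr_ge0 /gapG g_fun_end subr0 => h; apply: (le_trans h).
  by rewrite ler_pM2l //; apply: gapPv_ge wj.
move=> x /andP[x0 xm]; rewrite !mulN1r ltrN2 => lt; rewrite oppr_ge0 subr_le0; apply: Ho.
rewrite xm andbT ltNge; apply/negP => sx.
have yx : x <= 1 - m * x.
  have : N * x <= 1 by rewrite mulrC -ler_pdivlMr // div1r.
  by lra.
have y0 := compl_gt0 hn xm.
have := lt_le_trans lt (@ge0_ler_powR R a (ltW apos) x (1 - m * x) _ _ yx).
by rewrite !nnegrE ltxx => h; suff : false by []; apply: h; apply: ltW.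
Qed.

Lemma prod_powR v : (forall i, 0 <= v i) ->
  \prod_(i < n) v i `^ a = (\prod_(i < n) v i) `^ a.
Proof.
move=> v0; pose P (X Y : R) := 0 <= Y /\ X = Y `^ a.
suff [_ ->] : P (\prod_(i < n) v i `^ a) (\prod_(i < n) v i) by [].
apply: (big_rec2 P); first by split=> //; rewrite powR1.
by move=> i X Y _ [Y0 ->]; split; [rewrite mulr_ge0|rewrite powRM].
Qed.

(* AM-GM applied to the [a]-th powers. *)
Lemma gmean_psum v : (forall i, 0 < v i) ->
  gmean v `^ a <= psum a v ?= iff [forall i, forall j, v i `^ a == v j `^ a].
Proof.
move=> v0.
have v0' i : 0 <= v i by apply: ltW.
have := @leif_AGM R 'I_n predT (fun i => v i `^ a) (fun i _ => powR_ge0 _ _).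
have -> : #|[pred _ : 'I_n | true]| = n by rewrite card_ord.
rewrite /= (prod_powR v0') -(gmean_pow hn v0').
have g0 : 0 <= gmean v by apply: powR_ge0.
have -> : (gmean v ^+ n) `^ a = (gmean v `^ a) ^+ n.
  by rewrite -(powR_mulrn n g0) -(powR_mulrn n (powR_ge0 _ a)) powRAC.
have n0 : (0 < n)%N by apply: ltn_trans hn.
rewrite -/(psum a v) => -[h1 h2].
split.
  by move: h1; rewrite ler_pXn2r ?nnegrE ?powR_ge0 ?psum_ge0.
by rewrite -(eqrXn2 n0) ?powR_ge0 ?psum_ge0 // h2.
Qed.

End BoundaryAndEnds.

(** * From the gaps to the mean ratio *)

Section MeanRatio.
Variables (R : realType) (n : nat) (a : R).
Hypotheses (hn : (2 < n)%N) (a0 : a != 0) (a1 : a != 1).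
Implicit Types (v w : 'I_n -> R) (x rho : R).

Local Notation N := (n%:R : R).
Local Notation s := (N^-1).
Local Notation m := (N - 1).

Let N2 : 2 < N. Proof. exact: natr_gt2. Qed.
Let N0 : 0 < N. Proof. by move: N2; lra. Qed.
Let m0 : 0 < m. Proof. by move: N2; lra. Qed.
Let s0 : 0 < s. Proof. by rewrite invr_gt0. Qed.
Let b0 : 1 - a != 0. Proof. by rewrite subr_eq0 eq_sym. Qed.

Lemma gap_diff v : gapGv v - (1 - a) * gapPv a v = psum a v `^ a^-1 - gmean v.
Proof. by rewrite /gapGv /gapPv mulrC divfK //; ring. Qed.

Lemma gap_diff_gt0 v : (forall i, 0 < v i) -> gmean v `^ a < psum a v ->
  0 < a * (psum a v `^ a^-1 - gmean v).
Proof.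
move=> v0 lt; have g0 : 0 < gmean v by apply: powR_gt0; apply: prodr_gt0.
have gE : gmean v = (gmean v `^ a) `^ a^-1.
  by rewrite -powRrM mulfV // powRr1 // ltW.
have ga0 : 0 < gmean v `^ a by apply: powR_gt0.
case: (ltgtP a 0) a0 => // ha _.
  rewrite nmulr_rgt0 // subr_lt0 [ltRHS]gE.
  by apply: gt0_ltr_powRn => //; rewrite invr_lt0.
rewrite pmulr_rgt0 // subr_gt0 [ltLHS]gE.
by apply: gt0_ltr_powR; rewrite ?invr_gt0 ?nnegrE ?psum_ge0 // ltW.
Qed.

Lemma gap_diff_ge0 v : (forall i, 0 <= v i) -> (a < 0 -> forall i, 0 < v i) ->
  0 <= a * (psum a v `^ a^-1 - gmean v).
Proof.
move=> v0 vneg.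
have [/existsP[i /eqP vi]|/existsPn vn] := boolP [exists i, v i == 0].
  have [an|ap] := ltP a 0; first by have := vneg an i; rewrite vi ltxx.
  by rewrite (gmean_zero hn vi) subr0 mulr_ge0 // powR_ge0.
have vpos i : 0 < v i by rewrite lt_neqAle eq_sym vn v0.
have [le _] := gmean_psum a hn vpos.
move: le; rewrite le_eqVlt => /predU1P[eq|lt]; last exact/ltW/gap_diff_gt0.
by rewrite -eq -powRrM mulfV // powRr1 ?powR_ge0 // subrr mulr0.
Qed.

(** The equality case of AM-GM: for [x != 1 / n] the tuple of the family is not constant, so [P - G]
    has strictly the sign of [a]. *)
Lemma gap_strict x : 0 < x < m^-1 -> x != s ->
  0 < a * (gapG n x - (1 - a) * gapP n a x).
Proof.
move=> xi xs; have /andP[x0 xm] := xi; have y0 := compl_gt0 hn xm.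
pose j : 'I_n := Ordinal (ltnW (ltnW hn)).
pose v (i : 'I_n) : R := if i == j then 1 - m * x else x.
have vx i : i != j -> v i = x by rewrite /v => /negbTE ->.
have vj : v j = 1 - m * x by rewrite /v eqxx.
have vpos i : 0 < v i by rewrite /v; case: eqP.
have vs : simplex v.
  split=> [i|]; first exact/ltW/vpos.
  rewrite (big_except _ vx) /= vj -[iterop _ _ _ _]/(x *+ n.-1).
  have -> : x *+ n.-1 = m * x.
    have <- : n.-1%:R = m :> R by rewrite -subn1 natrB // (ltn_trans _ hn).
    by rewrite mulr_natl.
  by ring.
have [<- <-] := family_gap a hn vs vx xi; rewrite gap_diff.
apply: gap_diff_gt0 => //; rewrite (lt_leif (gmean_psum a hn vpos)).
apply/negP => /forallP /(_ j) /forallP /(_ (Ordinal (ltnW hn))).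
rewrite vj vx // => /eqP h; move/negP: xs; apply.
have xy : 1 - m * x = x.
  have := congr1 (fun z : R => z `^ a^-1) h.
  by rewrite /= -!powRrM mulfV // !powRr1 // ltW.
have : N * x = 1 by move: xy; lra.
by move=> {}h; rewrite -[x](mulKf (lt0r_neq0 N0)) h mulr1.
Qed.

(** All three means are homogeneous, so dividing by the total leaves the ratio unchanged. The
    hypothesis [P <> G] excludes a zero total and, for negative order, a zero entry: both means are
    then [0]. *)
Lemma mean_ratio_gap (x : 'I_n -> R) : (forall i, 0 <= x i) -> pmean a x <> gmean x ->
  exists v, [/\ simplex v, a < 0 -> forall i, 0 < v i,
    0 < a * (gapGv v - (1 - a) * gapPv a v) &
    mean_ratio a x = gapGv v / (gapGv v - (1 - a) * gapPv a v)].
Proof.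
move=> x0 PG.
have xneg : a < 0 -> forall i, 0 < x i.
  move=> an i; rewrite lt_neqAle x0 andbT; apply/eqP => xi; apply: PG.
  rewrite /pmean an (gmean_zero hn (esym xi)) /=.
  by case: existsP => // -[]; exists i; rewrite -xi.
pose T := \sum_(i < n) x i.
have T0 : 0 < T.
  rewrite lt_neqAle sumr_ge0 // andbT; apply/eqP => T0; apply: PG.
  have xz i : x i = 0.
    have := @psumr_eq0P R 'I_n predT x (fun i _ => x0 i) (esym T0) i.
    by apply.
  have i : 'I_n := Ordinal (ltnW (ltnW hn)).
  rewrite (gmean_zero hn (xz i)) /pmean.
  have [an|ap] := ltP a 0; first by have := xneg an i; rewrite xz ltxx.
  rewrite /= big1 ?mul0r ?powR0 // ?invr_eq0 // => k _.
  by rewrite xz powR0.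
pose v i := x i / T.
have xE i : x i = T * v i by rewrite /v mulrC divfK // gt_eqF.
have v0 i : 0 <= v i by rewrite divr_ge0 // ltW.
have vs : simplex v.
  by split=> //; rewrite -mulr_suml -/T divff // gt_eqF.
have gE : gmean x = T * gmean v.
  rewrite /gmean (eq_bigr (fun i => T * v i)) => [|i _]; last exact: xE.
  rewrite big_split /= prodr_const card_ord.
  have h : 0 <= \prod_(i < n) v i by apply: prodr_ge0.
  rewrite powRM ?exprn_ge0 ?(ltW T0) // -powR_mulrn ?(ltW T0) // -powRrM.
  by rewrite mulfV ?powRr1 ?(ltW T0) // gt_eqF.
have pE : pmean a x = T * psum a v `^ a^-1.
  rewrite /pmean; have -> : (a < 0) && [exists i, x i == 0] = false.
    apply/negP => /andP[an /existsP[i]].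
    by rewrite gt_eqF // xneg.
  have -> : \sum_(i < n) x i `^ a = T `^ a * \sum_(i < n) v i `^ a.
    rewrite mulr_sumr; apply: eq_bigr => i _.
    by rewrite xE powRM // ltW.
  rewrite -mulrA -/(psum a v) powRM ?powR_ge0 ?psum_ge0 // -powRrM mulfV //.
  by rewrite powRr1 // ltW.
have vneg : a < 0 -> forall i, 0 < v i by move=> an i; rewrite divr_gt0 // xneg.
exists v; split=> //.
  rewrite gap_diff lt_neqAle gap_diff_ge0 // andbT eq_sym mulf_neq0 //.
  rewrite subr_eq0; apply/eqP => h; apply: PG.
  by rewrite pE gE h.
rewrite gap_diff /mean_ratio pE gE -mulrBr /amean -/T /gapGv -mulrBr.
by rewrite -mulf_div divff ?mul1r // gt_eqF.
Qed.

Section Comparison.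
Variables u V b rho : R.
Hypotheses (den_gt0 : 0 < (rho - b) * (u - b * V)).

(** The difference of the two fractions has the sign of [b (u - rho V)] once the two denominators
    have the same sign. *)
Let cross : rho / (rho - b) - u / (u - b * V) =
  b * (u - rho * V) * ((rho - b) * (u - b * V))^-1.
Proof.
have := den_gt0; have [->|h1] := eqVneq (rho - b) 0; first by rewrite mul0r ltxx.
have [->|h2] := eqVneq (u - b * V) 0; first by rewrite mulr0 ltxx.
by move=> _; field; rewrite h1 h2.
Qed.

Lemma ratio_upper : 0 <= b * (u - rho * V) -> u / (u - b * V) <= rho / (rho - b).
Proof.
by move=> h; rewrite -subr_ge0 cross mulr_ge0 // invr_ge0 ltW.
Qed.

Lemma ratio_lower : b * (u - rho * V) <= 0 -> rho / (rho - b) <= u / (u - b * V).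
Proof.
by move=> h; rewrite -subr_le0 cross mulr_le0_ge0 // invr_ge0 ltW.
Qed.

End Comparison.

Lemma omegaE rho : rho - (1 - a) != 0 ->
  rho / (1 - a) / (rho / (1 - a) - 1) = rho / (rho - (1 - a)).
Proof. by move=> h; field; rewrite b0 h. Qed.

(* The end values: [g = 0] there, so that [rho = s / gapP] and
   [rho / (rho - (1 - a)) = s / p]. *)
Lemma end_omega x : g_fun n x = 0 -> 0 < gapP n a x -> 0 < p_fun n a^-1 x ->
  let rho := gapG n x / gapP n a x in
  [/\ 0 < rho, 0 < rho - (1 - a) & rho / (rho - (1 - a)) = s / p_fun n a^-1 x].
Proof.
move=> gx Vx px rho; have UE : gapG n x = s by rewrite /gapG gx subr0.
have VE : (1 - a) * gapP n a x = s - p_fun n a^-1 x by rewrite mulrC divfK.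
have rE : rho - (1 - a) = p_fun n a^-1 x / gapP n a x.
  have -> : p_fun n a^-1 x = s - (1 - a) * gapP n a x by rewrite VE; ring.
  by rewrite /rho UE; field; rewrite !gt_eqF.
rewrite rE; split; first by rewrite /rho UE divr_gt0.
  by rewrite divr_gt0.
by rewrite /rho UE; field; rewrite !gt_eqF.
Qed.

Lemma omega_right : 0 < a -> s / p_fun n a^-1 m^-1 = (N / m) `^ (a^-1 - 1).
Proof.
move=> apos; rewrite p_fun_end //.
rewrite !powRM ?invr_ge0 ?powR_ge0 ?(ltW N0) ?(ltW m0) // -powRrM !powRV //.
rewrite -[X in _ = _ * X]powRN.
have -> : - (a^-1 - 1) = 1 - a^-1 by ring.
have -> : (1 - a) * a^-1 = a^-1 - 1 by field.
have -> : 1 - a^-1 = - (a^-1 - 1) by ring.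
rewrite powRN (powR_sub1_div _ N0).
have h1 := powR_gt0 a^-1 N0; have h2 := powR_gt0 (a^-1 - 1) m0.
by field; rewrite !gt_eqF.
Qed.

Lemma omega_left : 0 < a -> s / p_fun n a^-1 0 = N `^ (a^-1 - 1).
Proof.
move=> apos; rewrite p_fun0 // powRV // (powR_sub1_div _ N0) invrK.
by rewrite mulrC.
Qed.

Lemma p_fun_ends_gt0 : 0 < a -> 0 < p_fun n a^-1 0 /\ 0 < p_fun n a^-1 m^-1.
Proof.
move=> apos; rewrite p_fun0 // p_fun_end //; split; apply: powR_gt0 => //.
by rewrite divr_gt0 // powR_gt0.
Qed.

End MeanRatio.

(** * Bounds on the mean ratio in terms of [f] *)

Section RatioBounds.
Variables (R : realType) (n : nat) (a : R).
Hypotheses (hn : (2 < n)%N) (a0 : a != 0) (a1 : a != 1).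
Implicit Types (x : 'I_n -> R) (z rho : R).

Local Notation N := (n%:R : R).
Local Notation s := (N^-1).
Local Notation m := (N - 1).

Lemma is_min_f_fun (l u z : R) : a < 1 -> l < z < u ->
  (forall y, l < y < u -> gapG n z / gapP n a z <= gapG n y / gapP n a y) ->
  is_min_on (f_fun n a^-1) `]l, u[ (f_fun n a^-1 z).
Proof.
move=> alt zi zmin; split; first by exists z; [rewrite /= in_itv|exact: erefl].
move=> w [y /=]; rewrite in_itv /= => /zmin h <-.
have c0 : 0 < (1 - a)^-1 by rewrite invr_gt0 subr_gt0.
by rewrite (f_funE n a1 z) (f_funE n a1 y) (ler_pM2r c0).
Qed.

Lemma is_max_f_fun (l u z : R) : a < 1 -> l < z < u ->
  (forall y, l < y < u -> gapG n y / gapP n a y <= gapG n z / gapP n a z) ->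
  is_max_on (f_fun n a^-1) `]l, u[ (f_fun n a^-1 z).
Proof.
move=> alt zi zmax; split; first by exists z; [rewrite /= in_itv|exact: erefl].
move=> w [y /=]; rewrite in_itv /= => /zmax h <-.
have c0 : 0 < (1 - a)^-1 by rewrite invr_gt0 subr_gt0.
by rewrite (f_funE n a1 z) (f_funE n a1 y) (ler_pM2r c0).
Qed.

(** [f] is the quotient of the gaps divided by [1 - a], here negative, so a minimum of the quotient
    is a maximum of [f]. *)
Lemma is_max_f_fun_gt1 (l u z : R) : 1 < a -> l < z < u ->
  (forall y, l < y < u -> gapG n z / gapP n a z <= gapG n y / gapP n a y) ->
  is_max_on (f_fun n a^-1) `]l, u[ (f_fun n a^-1 z).
Proof.
move=> alt zi zmin; split; first by exists z; [rewrite /= in_itv|exact: erefl].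
move=> w [y /=]; rewrite in_itv /= => /zmin h <-.
have c0 : (1 - a)^-1 < 0 by rewrite invr_lt0 subr_lt0.
by rewrite (f_funE n a1 z) (f_funE n a1 y) (ler_nM2r c0).
Qed.

(** [rho - (1 - a)] is [(P - G) / gapP] at the tuple of the family, so [gap_strict] gives its sign
    and, with it, [nu != 1]. *)
Lemma interior_slope z : 0 < z < m^-1 -> z != s ->
  let rho := gapG n z / gapP n a z in
  [/\ 0 < rho, 0 < a * (rho - (1 - a)) &
      f_fun n a^-1 z / (f_fun n a^-1 z - 1) = rho / (rho - (1 - a))].
Proof.
move=> zi zs rho; have V0 := gapP_gt0 hn a0 a1 zi zs.
have U0 := gapG_gt0 hn a0 a1 zi zs.
have h : 0 < a * (rho - (1 - a)).
  have := gap_strict hn a0 a1 zi zs.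
  have -> : gapG n z - (1 - a) * gapP n a z = (rho - (1 - a)) * gapP n a z.
    by rewrite [RHS]mulrBl /rho divfK // gt_eqF.
  by rewrite mulrA (pmulr_lgt0 _ V0).
split=> //; first exact: divr_gt0.
rewrite (f_funE n a1 z) (omegaE a1) //; apply: contraTneq h => ->.
by rewrite mulr0 ltxx.
Qed.

Let pos_mul (u v : R) : 0 < a * u -> 0 < a * v -> 0 < u * v.
Proof.
case: (ltgtP a 0) a0 => // ha _.
  by rewrite !(nmulr_rgt0 _ ha) => u0 v0; rewrite (nmulr_rgt0 _ u0).
by rewrite !(pmulr_rgt0 _ ha) => u0 v0; rewrite (pmulr_rgt0 _ u0).
Qed.

Lemma ratio_le_of_lower rho x : a < 1 -> 0 < a * (rho - (1 - a)) ->
  (forall v : 'I_n -> R, simplex v -> (a < 0 -> forall i, 0 < v i) ->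
     rho * gapPv a v <= gapGv v) ->
  (forall i, 0 <= x i) -> pmean a x <> gmean x ->
  mean_ratio a x <= rho / (rho - (1 - a)).
Proof.
move=> alt hr hb x0 PG; have [v [vs vneg d ->]] := mean_ratio_gap hn a0 a1 x0 PG.
apply: ratio_upper; first exact: pos_mul.
by rewrite mulr_ge0 ?subr_ge0 ?(ltW alt) // hb.
Qed.

Lemma ratio_ge_of_upper rho x : a < 1 -> 0 < a * (rho - (1 - a)) ->
  (forall v : 'I_n -> R, simplex v -> gapGv v <= rho * gapPv a v) ->
  (forall i, 0 <= x i) -> pmean a x <> gmean x ->
  rho / (rho - (1 - a)) <= mean_ratio a x.
Proof.
move=> alt hr hb x0 PG; have [v [vs vneg d ->]] := mean_ratio_gap hn a0 a1 x0 PG.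
apply: ratio_lower; first exact: pos_mul.
by rewrite mulr_ge0_le0 ?subr_ge0 ?(ltW alt) // subr_le0 hb.
Qed.

Lemma ratio_ge_of_lower_gt1 rho x : 1 < a -> 0 < a * (rho - (1 - a)) ->
  (forall v : 'I_n -> R, simplex v -> rho * gapPv a v <= gapGv v) ->
  (forall i, 0 <= x i) -> pmean a x <> gmean x ->
  rho / (rho - (1 - a)) <= mean_ratio a x.
Proof.
move=> alt hr hb x0 PG; have [v [vs vneg d ->]] := mean_ratio_gap hn a0 a1 x0 PG.
apply: ratio_lower; first exact: pos_mul.
by rewrite mulr_le0_ge0 ?subr_le0 ?(ltW alt) // subr_ge0 hb.
Qed.

Lemma ratio_le_of_upper_gt1 rho x : 1 < a -> 0 < a * (rho - (1 - a)) ->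
  (forall v : 'I_n -> R, simplex v -> gapGv v <= rho * gapPv a v) ->
  (forall i, 0 <= x i) -> pmean a x <> gmean x ->
  mean_ratio a x <= rho / (rho - (1 - a)).
Proof.
move=> alt hr hb x0 PG; have [v [vs vneg d ->]] := mean_ratio_gap hn a0 a1 x0 PG.
apply: ratio_upper; first exact: pos_mul.
by rewrite mulr_le0 ?subr_le0 ?(ltW alt) // hb.
Qed.

Let right_slope : (1 < a) || (s <= a < 1) -> let rho := gapG n m^-1 / gapP n a m^-1 in
  [/\ 0 < a * (rho - (1 - a)), rho / (rho - (1 - a)) = (N / m) `^ (a^-1 - 1) &
   forall v : 'I_n -> R, simplex v -> gapGv v <= rho * gapPv a v].
Proof.
move=> ha rho.
have s0 : 0 < s by case/andP: (invn_itv R hn).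
have apos : 0 < a.
  by case/orP: ha => [|/andP[h _]]; [lra|apply: lt_le_trans h].
have [_ V0] := gapP_end_gt0 hn a0 a1 apos.
have [_ p0] := p_fun_ends_gt0 hn a0 apos.
have [r0 rb rE] := end_omega hn a1 (g_fun_end R hn) V0 p0.
rewrite -/rho in r0 rb rE; split.
- exact: mulr_gt0.
- by rewrite rE omega_right.
- apply: (upper_bound_right hn a0 a1 apos r0) => y yi.
  have := gap_end_right hn a0 a1 ha yi.
  by rewrite /rho mulrAC ler_pdivlMr.
Qed.

Lemma ratio_ge_right x : s <= a < 1 -> (forall i, 0 <= x i) -> pmean a x <> gmean x ->
  (N / m) `^ (a^-1 - 1) <= mean_ratio a x.
Proof.
move=> ai; have [|hr <- hb] := right_slope; first by rewrite ai orbT.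
by apply: ratio_ge_of_upper => //; case/andP: ai.
Qed.

Lemma ratio_le_right_gt1 x : 1 < a -> (forall i, 0 <= x i) -> pmean a x <> gmean x ->
  mean_ratio a x <= (N / m) `^ (a^-1 - 1).
Proof.
move=> ai; have [|hr <- hb] := right_slope; first by rewrite ai.
exact: ratio_le_of_upper_gt1.
Qed.

Lemma ratio_le_left x : 0 < a <= 1 - s -> (forall i, 0 <= x i) -> pmean a x <> gmean x ->
  mean_ratio a x <= N `^ (a^-1 - 1).
Proof.
move=> ai; have [apos as1] := andP ai.
have s0 : 0 < s by case/andP: (invn_itv R hn).
have [V0 _] := gapP_end_gt0 hn a0 a1 apos.
have [p0 _] := p_fun_ends_gt0 hn a0 apos.
have [r0 rb rE] := end_omega hn a1 (g_fun0 R hn) V0 p0.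
rewrite -omega_left // -rE.
apply: ratio_le_of_lower; [lra|exact: mulr_gt0|move=> v vs _].
apply: (lower_bound_left hn a0 a1 apos r0) vs => y yi.
have := gap_end_left hn a0 a1 ai yi.
by rewrite mulrAC ler_pdivrMr.
Qed.

End RatioBounds.

(** * The five ranges of the order *)

Theorem theorem1 (R : realType) (n : nat) (alpha : R)
    (hn : (2 < n)%N) (halpha0 : alpha <> 0) (halpha1 : alpha <> 1) :
  let r := alpha^-1 in
  (alpha < 0 ->
    exists nu1 : R,
      is_min_on (f_fun n r) `]n%:R^-1, (n%:R - 1)^-1[ nu1 /\
      forall x : 'I_n -> R, (forall i, 0 <= x i) ->
        pmean alpha x <> gmean x ->
        (-oo < (mean_ratio alpha x)%:E)%E /\
        mean_ratio alpha x <= nu1 / (nu1 - 1)) /\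
  (1 < alpha ->
    exists nu2 : R,
      is_max_on (f_fun n r) `]0, n%:R^-1[ nu2 /\
      forall x : 'I_n -> R, (forall i, 0 <= x i) ->
        pmean alpha x <> gmean x ->
        nu2 / (nu2 - 1) <= mean_ratio alpha x /\
        mean_ratio alpha x <= (n%:R / (n%:R - 1)) `^ (alpha^-1 - 1)) /\
  (2^-1 < alpha -> alpha < 1 -> n%:R < (1 - alpha)^-1 ->
    exists nu3 : R,
      is_min_on (f_fun n r) `]0, n%:R^-1[ nu3 /\
      forall x : 'I_n -> R, (forall i, 0 <= x i) ->
        pmean alpha x <> gmean x ->
        (n%:R / (n%:R - 1)) `^ (alpha^-1 - 1) <= mean_ratio alpha x /\
        mean_ratio alpha x <= nu3 / (nu3 - 1)) /\
  ([/\ 2^-1 <= alpha, alpha < 1 & (1 - alpha)^-1 <= n%:R] \/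
   [/\ 0 < alpha, alpha <= 2^-1 & alpha^-1 <= n%:R] ->
    forall x : 'I_n -> R, (forall i, 0 <= x i) ->
      pmean alpha x <> gmean x ->
      (n%:R / (n%:R - 1)) `^ (alpha^-1 - 1) <= mean_ratio alpha x /\
      mean_ratio alpha x <= n%:R `^ (alpha^-1 - 1)) /\
  (0 < alpha -> alpha < 2^-1 -> n%:R < alpha^-1 ->
    exists nu4 : R,
      is_max_on (f_fun n r) `]n%:R^-1, (n%:R - 1)^-1[ nu4 /\
      forall x : 'I_n -> R, (forall i, 0 <= x i) ->
        pmean alpha x <> gmean x ->
        nu4 / (nu4 - 1) <= mean_ratio alpha x /\
        mean_ratio alpha x <= n%:R `^ (alpha^-1 - 1)).
Proof.
move=> r.
have a0 : alpha != 0 by apply/eqP.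
have a1 : alpha != 1 by apply/eqP.
have /andP[s0 s2] := invn_itv R hn.
have sm := invm_gt R hn.
have N0 : 0 < n%:R :> R by rewrite -invr_gt0.
have right_side (z : R) : n%:R^-1 < z < (n%:R - 1)^-1 ->
    0 < z < (n%:R - 1)^-1 /\ z != n%:R^-1.
  by move=> /andP[sz zm]; rewrite (lt_trans s0 sz) zm gt_eqF.
have left_side (z : R) : 0 < z < n%:R^-1 -> 0 < z < (n%:R - 1)^-1 /\ z != n%:R^-1.
  by move=> /andP[z0 zs]; rewrite z0 (lt_trans zs sm) lt_eqF.
have lower (I : R -> Prop) z : (forall y, I y -> 0 < y < (n%:R - 1)^-1 /\ y != n%:R^-1) ->
    (forall y, I y -> gapG n z / gapP n alpha z <= gapG n y / gapP n alpha y) ->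
    forall y, I y -> gapG n z / gapP n alpha z * gapP n alpha y <= gapG n y.
  move=> hI hz y Iy; have [yi ys] := hI y Iy; have V0 := gapP_gt0 hn a0 a1 yi ys.
  by rewrite -(ler_pdivlMr _ _ V0); apply: hz.
have upper (I : R -> Prop) z : (forall y, I y -> 0 < y < (n%:R - 1)^-1 /\ y != n%:R^-1) ->
    (forall y, I y -> gapG n y / gapP n alpha y <= gapG n z / gapP n alpha z) ->
    forall y, I y -> gapG n y <= gapG n z / gapP n alpha z * gapP n alpha y.
  move=> hI hz y Iy; have [yi ys] := hI y Iy; have V0 := gapP_gt0 hn a0 a1 yi ys.
  by rewrite -(ler_pdivrMr _ _ V0); apply: hz.
split; [|split; [|split; [|split]]].
- move=> an; have [z zi zmin] := ratio_min_right hn a0 a1 an.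
  have [zi' zs] := right_side z zi.
  have [rho0 hr fE] := interior_slope hn a0 a1 zi' zs.
  have alt : alpha < 1 by lra.
  exists (f_fun n r z); split; first exact: (is_min_f_fun a1 alt zi zmin).
  move=> x x0 PG; split; first by rewrite ltNyr.
  rewrite /r fE; apply: (ratio_le_of_lower hn a0 a1 alt hr _ x0 PG) => v vs vneg.
  (* For negative order [hr] is exactly the upper bound on [rho] that keeps the maximization away
     from the boundary. *)
  have rho1 : gapG n z / gapP n alpha z < 1 - alpha.
    by move: hr; rewrite (nmulr_rgt0 _ an) subr_lt0.
  apply: (bound_lt0 hn a0 a1 _ an _ vs (vneg an)); first by rewrite rho0.
  exact: (lower (fun y => n%:R^-1 < y < (n%:R - 1)^-1) z right_side zmin).
- move=> a2; have sa : 1 - n%:R^-1 < alpha by lra.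
  have apos : 0 < alpha by lra.
  have [z zi zmin] := ratio_min_left hn a0 a1 sa.
  have [zi' zs] := left_side z zi.
  have [rho0 hr fE] := interior_slope hn a0 a1 zi' zs.
  exists (f_fun n r z); split; first exact: (is_max_f_fun_gt1 a1 a2 zi zmin).
  move=> x x0 PG; split; last exact: (ratio_le_right_gt1 hn a0 a1 a2 x0 PG).
  rewrite /r fE; apply: (ratio_ge_of_lower_gt1 hn a0 a1 a2 hr _ x0 PG).
  apply: (lower_bound_left hn a0 a1 apos rho0).
  exact: (lower (fun y => 0 < y < n%:R^-1) z left_side zmin).
- move=> a2 alt na.
  (* The hypothesis on [n] says that [alpha] is in the range where the slope blows up as [t] tends
     to [0]. *)
  have sa : 1 - n%:R^-1 < alpha.
    have : 1 - alpha < n%:R^-1.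
      by rewrite -[ltLHS]invrK ltf_pV2 ?posrE ?invr_gt0 //; lra.
    by lra.
  have apos : 0 < alpha by lra.
  have [z zi zmin] := ratio_min_left hn a0 a1 sa.
  have [zi' zs] := left_side z zi.
  have [rho0 hr fE] := interior_slope hn a0 a1 zi' zs.
  exists (f_fun n r z); split; first exact: (is_min_f_fun a1 alt zi zmin).
  move=> x x0 PG; split.
    by apply: (ratio_ge_right hn a0 a1 _ x0 PG); apply/andP; split; lra.
  rewrite /r fE; apply: (ratio_le_of_lower hn a0 a1 alt hr _ x0 PG) => v vs _.
  apply: (lower_bound_left hn a0 a1 apos rho0 _ vs).
  exact: (lower (fun y => 0 < y < n%:R^-1) z left_side zmin).
- move=> h x x0 PG.
  (* Either alternative amounts to [1 / n <= alpha <= 1 - 1 / n], where the slope is monotone on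
     each side of [1]. *)
  have [sa ai] : n%:R^-1 <= alpha < 1 /\ 0 < alpha <= 1 - n%:R^-1.
    case: h => [[h1 h2 h3]|[h1 h2 h3]].
      have : n%:R^-1 <= 1 - alpha.
        by rewrite -[leRHS]invrK lef_pV2 ?posrE ?invr_gt0 //; lra.
      by split; apply/andP; split; lra.
    have : n%:R^-1 <= alpha.
      by rewrite -[leRHS]invrK lef_pV2 ?posrE ?invr_gt0 //; lra.
    by split; apply/andP; split; lra.
  split; first exact: (ratio_ge_right hn a0 a1 sa x0 PG).
  exact: (ratio_le_left hn a0 a1 ai x0 PG).
- move=> apos a2 na.
  (* In this range the slope tends to [0] for large [t], so the maximum on the right is attained
     inside. *)
  have sa : alpha < n%:R^-1.
    by rewrite -[ltLHS]invrK ltf_pV2 ?posrE ?invr_gt0 //; lra.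
  have alt : alpha < 1 by lra.
  have ai : 0 < alpha < n%:R^-1 by rewrite apos.
  have [z zi zmax] := ratio_max_right hn a0 a1 ai.
  have [zi' zs] := right_side z zi.
  have [rho0 hr fE] := interior_slope hn a0 a1 zi' zs.
  exists (f_fun n r z); split; first exact: (is_max_f_fun a1 alt zi zmax).
  move=> x x0 PG; split; last first.
    by apply: (ratio_le_left hn a0 a1 _ x0 PG); apply/andP; split; lra.
  rewrite /r fE; apply: (ratio_ge_of_upper hn a0 a1 alt hr _ x0 PG).
  apply: (upper_bound_right hn a0 a1 apos rho0).
  exact: (upper (fun y => n%:R^-1 < y < (n%:R - 1)^-1) z right_side zmax).
Qed.
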